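(* Let $Z(x_+)$ be an $N\times M$ complex matrix (of rank $M$) whose entries are holomorphic functions of $x_+$, defining a holomorphic solution $Z:S^2\to G(M,N)$ of the bosonic grassmannian $G(M,N)$ sigma model, and suppose the associated surface has constant Gaussian curvature, i.e. with $g=\partial_+\partial_-\ln\det(Z^\dagger Z)$ one has $\kappa:=-\frac{1}{g}\partial_+\partial_-\ln g$ equal to a constant. Let $\eta(x_+)$ be a fermionic (Grassmann-odd) function of $x_+$, let $\theta_+$ be a Grassmann-odd coordinate, and consider the supersymmetric invariant holomorphic extension $$W(x_+,\theta_+)=Z(x_+)+i\theta_+\eta(x_+)\,\partial_+Z(x_+).$$ Define the supersymmetric metric $\tilde g=\partial_+\partial_-\ln\det(W^\dagger W)$ and the supersymmetric Gaussian curvature $\tilde\kappa=-\frac{1}{\tilde g}\partial_+\partial_-\ln\tilde g$. Then $\tilde\kappa$ is constant and $\tilde\kappa=\kappa$.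
   Context: The superspace has bosonic coordinates $x_\pm$ ($x_-$ the complex conjugate of $x_+$, bosonic part compactified to $S^2$) and anticommuting Grassmann coordinates $\theta_\pm$; $\partial_\pm=\partial/\partial x_\pm$. Conjugation $\dagger$ sends functions of $(x_+,\theta_+)$ to functions of $(x_-,\theta_-)$, with $\eta^\dagger=\eta^\dagger(x_-)$. The grassmannian $G(M,N)$ is the space of $M$-dimensional subspaces of $\mathbb{C}^N$; a holomorphic solution of the bosonic $G(M,N)$ sigma model is given (up to gauge) by an $N\times M$ matrix $Z(x_+)$ depending holomorphically on $x_+$ only, the map being its column span. Functions of Grassmann variables are expanded as finite polynomials in $\theta_\pm$, and $\ln$ is defined by the (terminating) Taylor expansion in the nilpotent parts. *)

(* Defs.v *)
From HB Require Import structures.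
From mathcomp Require Import all_boot all_order all_algebra.
From mathcomp Require Import fingroup perm.
From mathcomp Require Import complex.
From mathcomp Require Import all_classical all_reals all_analysis.

Set Implicit Arguments.
Unset Strict Implicit.
Unset Printing Implicit Defensive.

Import Order.TTheory GRing.Theory Num.Theory.
Local Open Scope ring_scope.

Definition cabs {R : realType} (z : R[i]) : R :=
  Num.sqrt (complex.Re z ^+ 2 + complex.Im z ^+ 2).

Definition cconj {R : realType} (z : R[i]) : R[i] := Complex (complex.Re z) (- complex.Im z).

Definition ci {R : realType} : R[i] := Complex 0 1.

Definition rC {R : realType} (x : R) : R[i] := Complex x 0.

Definition copen {R : realType} (U : R[i] -> Prop) : Prop :=
  forall z, U z -> exists r : R, 0 < r /\ forall w, cabs (w - z) < r -> U w.

Definition holo_on {R : realType} (U : R[i] -> Prop) (f : R[i] -> R[i]) : Prop :=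
  forall z, U z -> exists l : R[i], forall eps : R, 0 < eps ->
    exists delta : R, 0 < delta /\
      forall h : R[i], 0 < cabs h -> cabs h < delta ->
        cabs (f (z + h) - f z - l * h) <= eps * cabs h.

Definition pdx {R : realType} (f : R[i] -> R[i]) (z : R[i]) : R[i] :=
  Complex (derive1 (fun t : R => complex.Re (f (z + rC t))) 0)
          (derive1 (fun t : R => complex.Im (f (z + rC t))) 0).
Definition pdy {R : realType} (f : R[i] -> R[i]) (z : R[i]) : R[i] :=
  Complex (derive1 (fun t : R => complex.Re (f (z + Complex 0 t))) 0)
          (derive1 (fun t : R => complex.Im (f (z + Complex 0 t))) 0).

Definition dplus {R : realType} (f : R[i] -> R[i]) (z : R[i]) : R[i] :=
  (rC 2)^-1 * (pdx f z - ci * pdy f z).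
Definition dminus {R : realType} (f : R[i] -> R[i]) (z : R[i]) : R[i] :=
  (rC 2)^-1 * (pdx f z + ci * pdy f z).

Definition cadj {R : realType} {N M : nat} (Z : 'M[R[i]]_(N, M)) : 'M[R[i]]_(M, N) :=
  \matrix_(i, j) cconj (Z j i).

(* g = d_+ d_- ln det(Z^dagger Z)  (det(Z^dagger Z) is real positive) *)
Definition bos_metric {R : realType} {N M : nat} (Z : R[i] -> 'M[R[i]]_(N, M))
  (z : R[i]) : R[i] :=
  dplus (dminus (fun w => rC (ln (cabs (\det (cadj (Z w) *m Z w)))))) z.

(* kappa = - (1/g) d_+ d_- ln g   (g is real positive) *)
Definition bos_curv {R : realType} {N M : nat} (Z : R[i] -> 'M[R[i]]_(N, M))
  (z : R[i]) : R[i] :=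
  - (bos_metric Z z)^-1 *
    dplus (dminus (fun w => rC (ln (cabs (bos_metric Z w))))) z.

(* Grassmann algebra with K anticommuting generators e_0, ..., e_{K-1} *)
(* over C: an element is the family of its coefficients a_S on the    *)
(* monomials e_S = e_{s1} e_{s2} ... e_{sk}  (s1 < s2 < ... < sk).     *)

Definition grass (R : realType) (K : nat) := {ffun {set 'I_K} -> R[i]}.

(* number of inversions between disjoint monomials:  e_A e_B = (-1)^inv e_(A u B) *)
Definition ginv_count {K : nat} (A B : {set 'I_K}) : nat :=
  #|[pred p : 'I_K * 'I_K | (p.1 \in A) && (p.2 \in B) && (p.2 < p.1)%N]|.

Definition gmul {R : realType} {K : nat} (a b : grass R K) : grass R K :=
  [ffun S : {set 'I_K} => \sum_(A : {set 'I_K} | A \subset S)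
               (-1) ^+ (ginv_count A (S :\: A)) * a A * b (S :\: A)].

Definition gsc {R : realType} {K : nat} (c : R[i]) : grass R K :=
  [ffun S : {set 'I_K} => if S == finset.set0 then c else 0].

Definition gscale {R : realType} {K : nat} (c : R[i]) (a : grass R K) : grass R K :=
  [ffun S : {set 'I_K} => c * a S].

Definition ggen {R : realType} {K : nat} (k : 'I_K) : grass R K :=
  [ffun S : {set 'I_K} => if S == finset.set1 k then 1 else 0].

Definition gprod {R : realType} {K : nat} (s : seq (grass R K)) : grass R K :=
  foldr gmul (gsc 1) s.

Definition gpow {R : realType} {K : nat} (a : grass R K) (k : nat) : grass R K :=
  iter k (gmul a) (gsc 1).

Definition gbody {R : realType} {K : nat} (a : grass R K) : R[i] := a finset.set0.
Definition gsoul {R : realType} {K : nat} (a : grass R K) : grass R K :=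
  a - gsc (gbody a).

(* ln by the terminating Taylor expansion in the nilpotent part:
   ln a = ln(body) + sum_{k>=1} (-1)^(k+1)/k (soul/body)^k ;
   the body of the arguments used below is real positive, and ln(body) is
   taken as ln |body|. *)
Definition gln {R : realType} {K : nat} (a : grass R K) : grass R K :=
  gsc (rC (ln (cabs (gbody a)))) +
  \sum_(1 <= k < K.+1)
     gscale ((-1) ^+ k.+1 / k%:R) (gpow (gscale (gbody a)^-1 (gsoul a)) k).

Definition ginvG {R : realType} {K : nat} (a : grass R K) : grass R K :=
  gscale (gbody a)^-1
    (\sum_(0 <= k < K.+1) gpow (gscale (- (gbody a)^-1) (gsoul a)) k).

(* Conjugation.  sigma is the involution of the generators; monomials are
   conjugated with reversal of order, (e_{s1}...e_{sk})^dagger =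
   e_{sigma sk} ... e_{sigma s1}, and coefficients are complex conjugated. *)
Definition gconj {R : realType} {K : nat} (sigma : 'I_K -> 'I_K) (a : grass R K)
  : grass R K :=
  \sum_(S : {set 'I_K})
     gscale (cconj (a S)) (gprod [seq ggen (sigma k) | k <- rev (enum S)]).

Definition gmxmul {R : realType} {K p q r : nat}
  (A : 'M[grass R K]_(p, q)) (B : 'M[grass R K]_(q, r)) : 'M[grass R K]_(p, r) :=
  \matrix_(i, j) \sum_(k < q) gmul (A i k) (B k j).

Definition gadj {R : realType} {K N M : nat} (sigma : 'I_K -> 'I_K)
  (W : 'M[grass R K]_(N, M)) : 'M[grass R K]_(M, N) :=
  \matrix_(i, j) gconj sigma (W j i).

(* Leibniz determinant (entries used below are even, hence commute) *)
Definition gdet {R : realType} {K M : nat} (A : 'M[grass R K]_M) : grass R K :=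
  \sum_(s : 'S_M) gscale ((-1) ^+ s) (gprod [seq A i (s i) | i <- enum 'I_M]).

Definition gdplus {R : realType} {K : nat} (F : R[i] -> grass R K) (z : R[i])
  : grass R K := [ffun S : {set 'I_K} => dplus (fun w => F w S) z].
Definition gdminus {R : realType} {K : nat} (F : R[i] -> grass R K) (z : R[i])
  : grass R K := [ffun S : {set 'I_K} => dminus (fun w => F w S) z].

(* Superspace.  The Grassmann algebra has K = n+2 generators:          *)
(*   e_0 = theta_+,  e_1 = theta_-,  e_2, ..., e_{n+1} the odd          *)
(*   generators in which the fermionic function eta takes its values.  *)
(* Conjugation swaps theta_+ and theta_- and fixes e_2, ..., e_{n+1}.  *)

Definition theta_p {R : realType} {n : nat} : grass R n.+2 := ggen (inord 0).
Definition theta_m {R : realType} {n : nat} : grass R n.+2 := ggen (inord 1).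

Definition sconj_gen {n : nat} (k : 'I_n.+2) : 'I_n.+2 :=
  if val k == 0%N then inord 1 else if val k == 1%N then inord 0 else k.

(* eta is a fermionic (Grassmann odd) function of x_+ only:
   its values are odd elements of the Grassmann algebra generated by
   e_2..e_{n+1} (no theta's), with coefficients holomorphic in x_+ on U *)
Definition fermionic_holo {R : realType} {n : nat} (U : R[i] -> Prop)
  (eta : R[i] -> grass R n.+2) : Prop :=
  (forall z (S : {set 'I_n.+2}), eta z S != 0 ->
      odd #|S| /\ (inord 0 \notin S) /\ (inord 1 \notin S)) /\
  (forall S, holo_on U (fun z => eta z S)).

Definition superW {R : realType} {n N M : nat} (Z : R[i] -> 'M[R[i]]_(N, M))
  (eta : R[i] -> grass R n.+2) (z : R[i]) : 'M[grass R n.+2]_(N, M) :=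
  \matrix_(i, j)
    (gsc (Z z i j) +
     gscale (ci * dplus (fun w => Z w i j) z) (gmul theta_p (eta z))).

Definition super_metric {R : realType} {n N M : nat} (Z : R[i] -> 'M[R[i]]_(N, M))
  (eta : R[i] -> grass R n.+2) (z : R[i]) : grass R n.+2 :=
  gdplus (gdminus (fun w =>
     gln (gdet (gmxmul (gadj sconj_gen (superW Z eta w)) (superW Z eta w))))) z.

Definition super_curv {R : realType} {n N M : nat} (Z : R[i] -> 'M[R[i]]_(N, M))
  (eta : R[i] -> grass R n.+2) (z : R[i]) : grass R n.+2 :=
  gscale (-1)
    (gmul (ginvG (super_metric Z eta z))
          (gdplus (gdminus (fun w => gln (super_metric Z eta w))) z)).

(* Main.v *)
Require Import Defs.
From HB Require Import structures.
From mathcomp Require Import all_boot all_order all_algebra.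
From mathcomp Require Import fingroup perm.
From mathcomp Require Import complex.
From mathcomp Require Import all_classical all_reals all_analysis.
From mathcomp Require Import ring lra.
Import Order.TTheory GRing.Theory Num.Theory.
Import numFieldNormedType.Exports.
Local Open Scope ring_scope.

(** Since [theta_+] squares to zero, [W(x_+, theta_+) = Z(x_+ + e)] with
    [e = i theta_+ eta(x_+)] even of square zero: an exact Taylor expansion. Likewise
    [W^dagger] is [Z^dagger] at [x_- + e^dagger], so [transport], which expands a function
    at [(x_+ + e, x_- + e^dagger)], is a ring morphism that sends [Z] to [W], commutes with
    logarithms and satisfies the chain rules [d_+ (T f) = (1 + d_+ e) T (d_+ f)] and
    [d_- (T f) = (1 + d_- e^dagger) T (d_- f)]. Writing [J = (1 + d_+ e)(1 + d_- e^dagger)],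
    the super metric is [J T(g)], and
    [d_+ d_- ln (J T(g)) = d_+ d_- T(ln g) = J T(d_+ d_- ln g) = - kappa J T(g)], the factor
    [ln J = d_+ e + d_- e^dagger] being annihilated by [d_+ d_-].

    These computations take up to three derivatives of [Z] in [x_+], whereas the hypothesis
    is complex differentiability at each point only. The missing regularity comes from
    Goursat's bisection argument and Cauchy's formula on rectangles. *)

(** * Complex differentiation in terms of [cabs] *)

(** That [e] squares to zero does not suffice: products such as [e * d_+ e] must vanish as well.
    Differentiation acts coefficientwise, so every monomial of [e] and of its derivatives contains
    [theta_+], and every monomial of [e^dagger] and of its derivatives contains [theta_-]; hence all
    products within one family vanish. Products across the two families survive: this is why the
    expansion carries a mixed derivative, and why the souls met below have vanishing cube rather
    than vanishing square, so that every logarithm stops at second order. All these elements are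
    even and live in a commutative ring, where the remaining identities are polynomial.

    The operators [dplus] and [dminus] are built from derivatives along two lines through a point,
    so they need not commute on arbitrary functions, while the chain rules rely on commutation. It
    is proved for the class generated from holomorphic functions by conjugation, sums, products,
    inverses and logarithms of moduli, which contains [det(Z^dagger Z)], the metric and its
    logarithm. *)

Lemma is_derive_mulr (K : numFieldType) (f g : K^o -> K^o) (x l l' : K^o) :
  is_derive x 1 f l -> is_derive x 1 g l' ->
  is_derive x 1 (fun w => f w * g w) (f x * l' + g x * l).
Proof. exact: is_deriveM. Qed.

Lemma is_derive_invr (K : numFieldType) (f : K^o -> K^o) (x l : K^o) :
  f x != 0 -> is_derive x 1 f l ->
  is_derive x 1 (fun w => (f w)^-1) (- f x ^- 2 * l).
Proof.
by move=> fx0 [df <-]; split; [exact: derivableV | rewrite deriveV].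
Qed.

Section NumFieldContinuity.
Variables (K : numFieldType) (f g : K^o -> K^o) (x : K^o).
Hypotheses (fx : {for x, continuous f}) (gx : {for x, continuous g}).

Lemma continuous_addr : {for x, continuous (fun w => f w + g w : K^o)}.
Proof. exact: continuousD. Qed.

Lemma continuous_subr : {for x, continuous (fun w => f w - g w : K^o)}.
Proof. exact: continuousB. Qed.

Lemma continuous_mulr : {for x, continuous (fun w => f w * g w : K^o)}.
Proof. exact: continuousM. Qed.

Lemma continuous_invr :
  f x != 0 -> {for x, continuous (fun w => (f w)^-1 : K^o)}.
Proof. by move=> ?; exact: continuousV. Qed.

End NumFieldContinuity.

Section Modulus.
Variable R : realType.
Implicit Types (z w h l : R[i]) (f g : R[i] -> R[i]).

Lemma normC_cabs z : `|z| = rC (cabs z).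
Proof. by case: z. Qed.

Lemma cabs_normc z : cabs z = ComplexField.Normc.normc z.
Proof. by case: z. Qed.

Lemma cabs_ge0 z : 0 <= cabs z.
Proof. exact: sqrtr_ge0. Qed.

Lemma cabsM z w : cabs (z * w) = cabs z * cabs w.
Proof. by rewrite !cabs_normc ComplexField.Normc.normcM. Qed.

Lemma cabsV z : cabs z^-1 = (cabs z)^-1.
Proof. by rewrite !cabs_normc ComplexField.Normc.normcV. Qed.

Lemma cabsN z : cabs (- z) = cabs z.
Proof. by case: z => a b; rewrite /cabs /= !sqrrN. Qed.

Lemma cabs_subC z w : cabs (z - w) = cabs (w - z).
Proof. by rewrite -cabsN opprB. Qed.

Lemma cabs0 : cabs 0 = 0 :> R.
Proof. by rewrite cabs_normc ComplexField.Normc.normc0. Qed.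

Lemma cabs_rC (x : R) : cabs (rC x) = `|x|.
Proof. by rewrite /cabs /= expr0n addr0 sqrtr_sqr. Qed.

Lemma cabs_ci : cabs (ci : R[i]) = 1.
Proof. by rewrite /cabs /= expr0n add0r expr1n sqrtr1. Qed.

Lemma cabs_eq0 z : (cabs z == 0) = (z == 0).
Proof.
apply/eqP/eqP => [|->]; last exact: cabs0.
by rewrite cabs_normc; exact: ComplexField.Normc.eq0_normc.
Qed.

Lemma cabs_gt0 z : (0 < cabs z) = (z != 0).
Proof. by rewrite lt_neqAle cabs_ge0 andbT eq_sym cabs_eq0. Qed.

Lemma cabsD z w : cabs (z + w) <= cabs z + cabs w.
Proof.
by have := ler_normD z w; rewrite !normC_cabs lecE /= => /andP[].
Qed.

Lemma cabsB z w : cabs (z - w) <= cabs z + cabs w.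
Proof. by rewrite -(cabsN w) cabsD. Qed.

Lemma ler_Re_cabs z : `|complex.Re z| <= cabs z.
Proof.
rewrite -sqrtr_sqr /cabs ler_wsqrtr// lerDl sqr_ge0.
by [].
Qed.

Lemma ler_Im_cabs z : `|complex.Im z| <= cabs z.
Proof.
rewrite -sqrtr_sqr /cabs ler_wsqrtr// lerDr sqr_ge0.
by [].
Qed.

Lemma cabs_le_ReIm z : cabs z <= `|complex.Re z| + `|complex.Im z|.
Proof.
case: z => a b; rewrite [Complex a b](_ : _ = rC a + ci * rC b); last first.
  by rewrite /rC /ci; simpc.
by rewrite (le_trans (cabsD _ _))// cabsM cabs_ci mul1r !cabs_rC /=; simpc.
Qed.

Definition ccont f z := forall e : R, 0 < e ->
  exists2 d : R, 0 < d & forall w, cabs (w - z) < d -> cabs (f w - f z) < e.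

Definition cder f z l := forall e : R, 0 < e ->
  exists2 d : R, 0 < d & forall h, cabs h < d ->
    cabs (f (z + h) - f z - l * h) <= e * cabs h.

(** Comparable complex numbers have equal imaginary parts, so the complex-valued radii of the
    topology on [R[i]^o] are real; this is the bridge to estimates in [cabs]. *)
Lemma gtr0_rC (x : R[i]) : 0 < x -> exists2 e : R, 0 < e & x = rC e.
Proof.
by case: x => a b; rewrite ltcE /= => /andP[/eqP-> a0]; exists a.
Qed.

Lemma nbhs_cabs (P : set (R[i]^o)) z :
  nbhs (z : R[i]^o) P <->
  exists2 d : R, 0 < d & forall w, cabs (w - z) < d -> P w.
Proof.
split.
- move=> /nbhs_ballP[e /= /gtr0_rC[d d0 ->] P']; exists d => // w wd.
  by apply: P'; rewrite /ball /= normC_cabs ltcR cabs_subC.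
- move=> [d d0 P']; apply/nbhs_ballP; exists (rC d).
    by rewrite /= (ltcR 0).
  by move=> w; rewrite /ball /= normC_cabs ltcR cabs_subC; exact: P'.
Qed.

Lemma ccontP f z : ccont f z <-> {for z, continuous (f : R[i]^o -> R[i]^o)}.
Proof.
split=> [fz|/cvgrPdist_lt fz].
- apply/(@cvgrPdist_lt _ _ _ (nbhs (z : R[i]^o)) (nbhs_filter _)) => _ /gtr0_rC[e e0 ->].
  apply/nbhs_cabs; have [d d0 H] := fz _ e0; exists d => // w /H.
  by rewrite normC_cabs ltcR cabs_subC.
- move=> e e0; have /fz/nbhs_cabs[d d0 H] : 0 < rC e by rewrite (ltcR 0).
  by exists d => // w /H; rewrite normC_cabs ltcR cabs_subC.
Qed.

Lemma cderP f z l :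
  cder f z l <-> is_derive (z : R[i]^o) 1 (f : R[i]^o -> R[i]^o) l.
Proof.
have key h : h != 0 -> l - h^-1 * (f (h + z) - f z) =
   - h^-1 * (f (z + h) - f z - l * h).
  by move=> h0; rewrite [h + z]addrC; field.
have cvgE : cder f z l <->
  ((fun h : R[i]^o => h^-1 *: ((f \o shift z) (h *: (1 : R[i]^o)) - f z)) @ 0^'
     --> (l : R[i]^o))%classic.
  split=> [fz|/(@cvgrPdist_le _ (R[i]^o) _ (dnbhs (0 : R[i]^o)) (dnbhs_filter _)) fz].
  - apply/(@cvgrPdist_le _ (R[i]^o) _ (dnbhs (0 : R[i]^o)) (dnbhs_filter _)) => _ /gtr0_rC[e e0 ->].
    rewrite near_withinE; apply/nbhs_cabs; have [d d0 H] := fz _ e0.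
    exists d => // h; rewrite subr0 => /H hd h0.
    rewrite /= -[h *: 1]/(h * 1) mulr1 -[_ *: _]/(_ * _) key// normC_cabs lecR.
    by rewrite cabsM cabsN cabsV ler_pdivrMl ?cabs_gt0// [cabs h * e]mulrC.
  - move=> e e0; have /fz : 0 < rC e by rewrite (ltcR 0).
    rewrite near_withinE => /nbhs_cabs[d d0 H].
    exists d => // h; have [->|h0] := eqVneq h 0.
      by rewrite addr0 subrr mulr0 subr0 cabs0 mulr0.
    rewrite -[X in cabs X < _]subr0 => /H /(_ h0).
    rewrite /= -[h *: 1]/(h * 1) mulr1 -[_ *: _]/(_ * _) key// normC_cabs lecR.
    by rewrite cabsM cabsN cabsV ler_pdivrMl ?cabs_gt0// [cabs h * e]mulrC.
rewrite cvgE; split=> [fl|[df <-]]; last exact: df.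
by split; [apply/cvg_ex; exists l|apply/cvg_lim].
Qed.

Lemma cder_cont f z l : cder f z l -> ccont f z.
Proof.
by move=> /cderP[/derivable1_diffP/differentiable_continuous ? _]; apply/ccontP.
Qed.

Lemma cder_ext f g z l (r : R) : 0 < r ->
  (forall w, cabs (w - z) < r -> f w = g w) -> cder f z l -> cder g z l.
Proof.
move=> r0 fg fz e /fz[d d0 H]; exists (Num.min d r); first by rewrite lt_min d0.
move=> h; rewrite lt_min => /andP[/H + hr].
by rewrite !fg// ?subrr ?cabs0// addrAC subrr add0r.
Qed.

Lemma cder_cst (c : R[i]) z : cder (fun=> c) z 0.
Proof. by apply/cderP; exact: is_derive_cst. Qed.

Lemma cderD f g z l l' : cder f z l -> cder g z l' ->
  cder (fun w => f w + g w) z (l + l').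
Proof. by move=> /cderP ? /cderP ?; apply/cderP; exact: is_deriveD. Qed.

Lemma cderB f g z l l' : cder f z l -> cder g z l' ->
  cder (fun w => f w - g w) z (l - l').
Proof. by move=> /cderP ? /cderP ?; apply/cderP; exact: is_deriveB. Qed.

Lemma cder_subr c z : cder (fun w => w - c) z 1.
Proof.
move=> e e0; exists 1 => // h _.
have -> : z + h - c - (z - c) - 1 * h = 0 by ring.
by rewrite cabs0 mulr_ge0// ?cabs_ge0// ltW.
Qed.

Lemma cderM f g z l l' : cder f z l -> cder g z l' ->
  cder (fun w => f w * g w) z (f z * l' + g z * l).
Proof.
by move=> /cderP fl /cderP gl; apply/cderP; exact: (@is_derive_mulr (R[i])).
Qed.

Lemma cderV f z l : f z != 0 -> cder f z l ->
  cder (fun w => (f w)^-1) z (- f z ^- 2 * l).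
Proof.
by move=> fz0 /cderP fl; apply/cderP; exact: (@is_derive_invr (R[i])).
Qed.

Lemma ccont_cst (c : R[i]) z : ccont (fun=> c) z.
Proof. exact: cder_cont (cder_cst c z). Qed.

Lemma ccontD f g z : ccont f z -> ccont g z -> ccont (fun w => f w + g w) z.
Proof.
move=> /(proj1 (ccontP _ _)) fz /(proj1 (ccontP _ _)) gz.
by apply: (proj2 (ccontP _ _)); exact: (@continuous_addr (R[i]) f g z fz gz).
Qed.

Lemma ccontB f g z : ccont f z -> ccont g z -> ccont (fun w => f w - g w) z.
Proof.
move=> /(proj1 (ccontP _ _)) fz /(proj1 (ccontP _ _)) gz.
by apply: (proj2 (ccontP _ _)); exact: (@continuous_subr (R[i]) f g z fz gz).
Qed.

Lemma ccontM f g z : ccont f z -> ccont g z -> ccont (fun w => f w * g w) z.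
Proof.
move=> /(proj1 (ccontP _ _)) fz /(proj1 (ccontP _ _)) gz.
by apply: (proj2 (ccontP _ _)); exact: (@continuous_mulr (R[i]) f g z fz gz).
Qed.

Lemma ccontV f z : f z != 0 -> ccont f z -> ccont (fun w => (f w)^-1) z.
Proof.
move=> fz0 /(proj1 (ccontP _ _)) fz.
by apply: (proj2 (ccontP _ _)); exact: (@continuous_invr (R[i]) f z fz fz0).
Qed.

Lemma holo_onP (U : R[i] -> Prop) f :
  holo_on U f <-> forall z, U z -> exists l, cder f z l.
Proof.
split=> fU z /fU[l fl]; exists l => e e0; have [d] := fl e e0.
- move=> [d0 H]; exists d => // h hd; have [->|h0] := eqVneq h 0.
    by rewrite addr0 subrr mulr0 subr0 cabs0 mulr0.
  by apply: H => //; rewrite cabs_gt0.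
- by move=> d0 H; exists d; split => // h _; exact: H.
Qed.

End Modulus.

(** * Integrals along segments *)

Section SegmentIntegral.
Variable R : realType.
Implicit Types (a b m M : R) (f g : R -> R).

(** Continuity is two-sided even at the end points. It is available because the integrands are
    restrictions to a line of functions continuous in the plane at each point of the segment. *)
Definition rcont a b f := forall t, a <= t <= b -> {for t, continuous f}.

Definition rint a b f : R := Rintegral (@lebesgue_measure R) `[a, b]%classic f.

Lemma rcont_integrable a b f : rcont a b f ->
  (@lebesgue_measure R).-integrable `[a, b]%classic (EFin \o f).
Proof.
move=> fc; apply: continuous_compact_integrable; first exact: segment_compact.
apply: continuous_in_subspaceT => t; rewrite inE /= in_itv /=; exact: fc.
Qed.

Lemma rintD a b f g : rcont a b f -> rcont a b g ->
  rint a b (fun t => f t + g t) = rint a b f + rint a b g.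
Proof. by move=> fc gc; apply: RintegralD => //; exact: rcont_integrable. Qed.

Lemma rintB a b f g : rcont a b f -> rcont a b g ->
  rint a b (fun t => f t - g t) = rint a b f - rint a b g.
Proof. by move=> fc gc; apply: RintegralB => //; exact: rcont_integrable. Qed.

Lemma rintZ a b k f : rcont a b f ->
  rint a b (fun t => k * f t) = k * rint a b f.
Proof. by move=> fc; apply: RintegralZl => //; exact: rcont_integrable. Qed.

Lemma eq_rint a b f g : (forall t, a <= t <= b -> f t = g t) ->
  rint a b f = rint a b g.
Proof.
by move=> fg; apply: eq_Rintegral => t; rewrite inE /= in_itv /=; exact: fg.
Qed.

Lemma rint_cst a b k : a <= b -> rint a b (fun=> k) = k * (b - a).
Proof.
move=> ab; rewrite /rint Rintegral_cst//=.
by rewrite lebesgue_measure_itv /= lte_fin; case: ltgtP ab => //= -> _; rewrite subrr.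
Qed.

Lemma rint_split a c b f : a <= c -> c <= b -> rcont a b f ->
  rint a b f = rint a c f + rint c b f.
Proof.
move=> ac cb fc; have fi := rcont_integrable _ _ _ fc.
apply/eqP; rewrite addrC -subr_eq; apply/eqP.
rewrite /rint Rintegral_itvB//=.
rewrite Rintegral_itv_obnd_cbnd//; apply: integrableS fi => // t /=.
by rewrite !in_itv /= => /andP[/ltW ct ->]; rewrite (le_trans ac).
Qed.

Lemma rint_le a b f M : a <= b -> rcont a b f ->
  (forall t, a <= t <= b -> f t <= M) -> rint a b f <= M * (b - a).
Proof.
move=> ab fc fM; rewrite -rint_cst//; apply: le_Rintegral => //.
- exact: rcont_integrable.
- by apply: rcont_integrable => t _; exact: cst_continuous.
Qed.

Lemma rint_ge a b f m : a <= b -> rcont a b f ->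
  (forall t, a <= t <= b -> m <= f t) -> m * (b - a) <= rint a b f.
Proof.
move=> ab fc fM; rewrite -rint_cst//; apply: le_Rintegral => //.
- by apply: rcont_integrable => t _; exact: cst_continuous.
- exact: rcont_integrable.
Qed.

Lemma rint_norm a b f M : a <= b -> rcont a b f ->
  (forall t, a <= t <= b -> `|f t| <= M) -> `|rint a b f| <= M * (b - a).
Proof.
move=> ab fc fM; rewrite ler_norml -mulNr rint_ge ?rint_le// => t /fM.
  by rewrite ler_norml => /andP[].
by rewrite ler_norml => /andP[].
Qed.

Implicit Types (p q : R -> R[i]).

Definition scont a b p := rcont a b (fun t => complex.Re (p t)) /\
  rcont a b (fun t => complex.Im (p t)).

Definition cint a b p : R[i] :=
  Complex (rint a b (fun t => complex.Re (p t)))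
          (rint a b (fun t => complex.Im (p t))).

Lemma cReD (z w : R[i]) : complex.Re (z + w) = complex.Re z + complex.Re w.
Proof. by case: z w => ? ? []. Qed.
Lemma cImD (z w : R[i]) : complex.Im (z + w) = complex.Im z + complex.Im w.
Proof. by case: z w => ? ? []. Qed.
Lemma cReB (z w : R[i]) : complex.Re (z - w) = complex.Re z - complex.Re w.
Proof. by case: z w => ? ? []. Qed.
Lemma cImB (z w : R[i]) : complex.Im (z - w) = complex.Im z - complex.Im w.
Proof. by case: z w => ? ? []. Qed.
Lemma cReM (z w : R[i]) : complex.Re (z * w) =
  complex.Re z * complex.Re w - complex.Im z * complex.Im w.
Proof. by case: z w => ? ? []. Qed.
Lemma cImM (z w : R[i]) : complex.Im (z * w) =
  complex.Re z * complex.Im w + complex.Im z * complex.Re w.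
Proof. by case: z w => ? ? []. Qed.

Lemma rcontZ a b k f : rcont a b f -> rcont a b (fun t => k * f t).
Proof. by move=> fc t tab; apply: continuousM; [exact: cst_continuous|exact: fc]. Qed.

Lemma cintB a b p q : scont a b p -> scont a b q ->
  cint a b (fun t => p t - q t) = cint a b p - cint a b q.
Proof.
move=> [p1 p2] [q1 q2]; rewrite /cint; simpc; rewrite -!rintB//.
by congr Complex; apply: eq_rint => t _; rewrite ?cReB ?cImB.
Qed.

Lemma cintZ a b (k : R[i]) p : scont a b p ->
  cint a b (fun t => k * p t) = k * cint a b p.
Proof.
move=> [p1 p2]; case: k => k l; rewrite /cint; simpc; congr Complex.
- rewrite -(rintZ _ _ k _ p1) -(rintZ _ _ l _ p2) -rintB; [|exact: rcontZ..].
  by apply: eq_rint => t _; rewrite cReM.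
- rewrite -(rintZ _ _ k _ p2) -(rintZ _ _ l _ p1) -rintD; [|exact: rcontZ..].
  by apply: eq_rint => t _; rewrite cImM.
Qed.

Lemma eq_cint a b p q : (forall t, a <= t <= b -> p t = q t) ->
  cint a b p = cint a b q.
Proof. by move=> pq; congr Complex; apply: eq_rint => t /pq ->. Qed.

Lemma cint_cst a b (k : R[i]) : a <= b -> cint a b (fun=> k) = k * rC (b - a).
Proof. by move=> ab; rewrite /cint !rint_cst//; case: k => k l; rewrite /rC; simpc. Qed.

Lemma cint_split a c b p : a <= c -> c <= b -> scont a b p ->
  cint a b p = cint a c p + cint c b p.
Proof.
by move=> ac cb [p1 p2]; rewrite /cint (rint_split a c b)// (rint_split a c b (fun t => complex.Im _)).
Qed.

(** The factor 2 comes from bounding the real and the imaginary part separately by [M]. *)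
Lemma cint_norm a b p M : a <= b -> scont a b p ->
  (forall t, a <= t <= b -> cabs (p t) <= M) -> cabs (cint a b p) <= 2 * M * (b - a).
Proof.
move=> ab [p1 p2] pM; apply: le_trans (cabs_le_ReIm _ _) _.
rewrite -mulrA (_ : 2 * _ = M * (b - a) + M * (b - a)); last by ring.
by apply: lerD; apply: rint_norm => // t /pM; apply: le_trans;
  [exact: ler_Re_cabs|exact: ler_Im_cabs].
Qed.

End SegmentIntegral.

(** * Bisection of rectangles *)

Section Bisection.
Variable R : realType.

Lemma nested_intervals (u v : nat -> R) :
  (forall m n, u m <= v n) -> exists p, forall n, u n <= p <= v n.
Proof.
move=> uv; exists (sup (range u)) => n; apply/andP; split.
  apply: ub_le_sup; last by exists n.
  by exists (v 0%N) => _ [m _ <-].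
by apply: ge_sup; [exists (u 0%N); exists 0%N|move=> _ [m _ <-]].
Qed.

Lemma halving_lt (L d : R) : 0 < d -> exists n : nat, L / 2 ^+ n < d.
Proof.
move=> d0; exists (Num.bound (L / d)).
rewrite ltr_pdivrMr ?exprn_gt0// mulrC -ltr_pdivrMr//.
have [L0|L0] := ltP (L / d) 0; first by rewrite (lt_trans L0)// exprn_gt0.
apply: lt_trans (archi_boundP L0) _.
by rewrite -natrX ltr_nat ltn_expl.
Qed.

Record rect := Rect { lft : R; rgt : R; bot : R; top : R }.

Definition subrect (r s : rect) :=
  [/\ lft s <= lft r <= rgt r, rgt r <= rgt s,
      bot s <= bot r <= top r & top r <= top s].

Definition midx r := (lft r + rgt r) / 2.
Definition midy r := (bot r + top r) / 2.

Definition quarters r :=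
  [:: Rect (lft r) (midx r) (bot r) (midy r);
      Rect (midx r) (rgt r) (bot r) (midy r);
      Rect (lft r) (midx r) (midy r) (top r);
      Rect (midx r) (rgt r) (midy r) (top r)].

Definition isquarter r s :=
  [\/ s = nth r (quarters r) 0, s = nth r (quarters r) 1,
      s = nth r (quarters r) 2 | s = nth r (quarters r) 3].

Lemma isquarterP r s : lft r <= rgt r -> bot r <= top r -> isquarter r s ->
  [/\ subrect s r, rgt s - lft s = (rgt r - lft r) / 2 &
      top s - bot s = (top r - bot r) / 2].
Proof.
by move=> ? ?; rewrite /isquarter /subrect /= /midx /midy => -[] ->;
   split=> /=; try split=> /=; try (apply/andP; split); lra.
Qed.

(** Bisection as an induction principle: a counterexample would produce nested counterexamples
    shrinking to a point, against the local hypothesis there. It serves both for Goursat's theorem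
    and in place of compactness. *)
Lemma rect_bisection (Q : rect -> Prop) (s : rect) :
  lft s <= rgt s -> bot s <= top s ->
  (forall r, subrect r s -> (forall q, isquarter r q -> Q q) -> Q r) ->
  (forall x y, lft s <= x <= rgt s -> bot s <= y <= top s ->
    exists2 d : R, 0 < d & forall r, subrect r s ->
      lft r <= x <= rgt r -> bot r <= y <= top r ->
      rgt r - lft r < d -> top r - bot r < d -> Q r) ->
  Q s.
Proof.
move=> sx sy quad loc; apply: contrapT => nQs.
have ss : subrect s s by split=> //; rewrite lexx.
(* A bad rectangle has a bad quarter by the contrapositive of [quad]; choice makes this a map on a
   sigma type, which can be iterated. *)
pose bad := {r : rect | subrect r s /\ ~ Q r}.
have next (r : bad) : {r' : bad | isquarter (sval r) (sval r')}.
  case: r => r [rs nQr] /=; apply: cid.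
  have [q [rq nQq]] : exists q, isquarter r q /\ ~ Q q.
    apply: contrapT => H; apply: nQr; apply: quad => // q rq.
    by apply: contrapT => nQq; apply: H; exists q.
  have [/andP[r1 r2] r3 /andP[r4 r5] r6] := rs.
  have [qr _ _] := isquarterP _ _ r2 r5 rq.
  suff qs : subrect q s by exists (exist _ q (conj qs nQq)).
  have [/andP[q1 q2] q3 /andP[q4 q5] q6] := qr.
  split; try (apply/andP; split => //); try lra.
pose S := fix S n : bad := if n is m.+1 then sval (next (S m))
                           else exist _ s (conj ss nQs).
pose r n := sval (S n).
have rs n : subrect (r n) s by have [] := svalP (S n).
have rQ n : ~ Q (r n) by have [] := svalP (S n).
have rle n : lft (r n) <= rgt (r n) /\ bot (r n) <= top (r n).
  by have [/andP[_ ?] _ /andP[_ ?] _] := rs n.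
have step n : isquarter (r n) (r n.+1) by exact: svalP (next (S n)).
have stepP n := isquarterP _ _ (rle n).1 (rle n).2 (step n).
have size n : rgt (r n) - lft (r n) = (rgt s - lft s) / 2 ^+ n /\
              top (r n) - bot (r n) = (top s - bot s) / 2 ^+ n.
  elim: n => [|n [IH1 IH2]]; first by rewrite expr0 !divr1.
  have [_ -> ->] := stepP n; rewrite IH1 IH2 exprSr !invfM !mulrA.
  by split.
have mono m n : (m <= n)%N -> subrect (r n) (r m).
  move=> /subnKC <-; elim: (n - m)%N => [|k IH].
    by rewrite addn0; split=> //; rewrite lexx ?(rle m).1 ?(rle m).2.
  have [/andP[a1 a2] a3 /andP[a4 a5] a6] := IH.
  have [+ _ _] := stepP (m + k)%N; rewrite -addnS.
  move=> [/andP[b1 b2] b3 /andP[b4 b5] b6].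
  by split; try (apply/andP; split => //); lra.
have [x xP] : exists x, forall n, lft (r n) <= x <= rgt (r n).
  apply: nested_intervals => m n.
  have [/andP[a1 a2] a3 _ _] := mono m _ (leq_maxl m n).
  have [_ b3 _ _] := mono n _ (leq_maxr m n).
  by lra.
have [y yP] : exists y, forall n, bot (r n) <= y <= top (r n).
  apply: nested_intervals => m n.
  have [_ _ /andP[a1 a2] a3] := mono m _ (leq_maxl m n).
  have [_ _ _ b3] := mono n _ (leq_maxr m n).
  by lra.
have [d d0 dP] := loc x y (xP 0%N) (yP 0%N).
have [n1 n1d] := halving_lt (rgt s - lft s) d d0.
have [n2 n2d] := halving_lt (top s - bot s) d d0.
pose n := maxn n1 n2.
apply: (rQ n); apply: dP => //.
  have [/andP[a1 a2] a3 _ _] := mono n1 n (leq_maxl _ _).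
  by rewrite -(size n1).1 in n1d; lra.
have [_ _ /andP[a1 a2] a3] := mono n2 n (leq_maxr _ _).
by rewrite -(size n2).2 in n2d; lra.
Qed.

End Bisection.
Arguments Rect {R}.

(** * Contour integrals over rectangles *)

Section Contour.
Variable R : realType.
Implicit Types (F G : R[i] -> R[i]) (r s : rect R) (z w : R[i]).

Definition inrect r z :=
  lft _ r <= complex.Re z <= rgt _ r /\ bot _ r <= complex.Im z <= top _ r.

Definition onbd r z := inrect r z /\
  [\/ complex.Im z = bot _ r, complex.Im z = top _ r,
      complex.Re z = rgt _ r | complex.Re z = lft _ r].

Definition wfrect r := lft _ r <= rgt _ r /\ bot _ r <= top _ r.

(* Opposite sides are integrated together, so that an affine F has constant
   integrands. *)
Definition contour F r : R[i] :=
  cint _ (lft _ r) (rgt _ r)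
    (fun x => F (Complex x (bot _ r)) - F (Complex x (top _ r))) +
  ci * cint _ (bot _ r) (top _ r)
    (fun y => F (Complex (rgt _ r) y) - F (Complex (lft _ r) y)).

Lemma continuous_ReIm_path (p : R -> R[i]) (t : R) :
  (forall e, 0 < e -> exists2 d, 0 < d &
     forall u, `|u - t| < d -> cabs (p u - p t) < e) ->
  {for t, continuous (fun u => complex.Re (p u))} /\
  {for t, continuous (fun u => complex.Im (p u))}.
Proof.
move=> pt; split; apply/(@cvgrPdist_lt _ R^o _ (nbhs (t : R^o)) (nbhs_filter _)) => e e0;
  have [d d0 H] := pt e e0; apply/nbhs_ballP; exists d => // u;
  rewrite /ball /= distrC => /H; rewrite distrC; apply: le_lt_trans.
- by rewrite -cReB ler_Re_cabs.
- by rewrite -cImB ler_Im_cabs.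
Qed.

(** Horizontal and vertical sides are both isometric parametrisations, so one argument covers
    them. *)
Lemma scont_path (a b : R) (p : R -> R[i]) F :
  (forall u t, cabs (p u - p t) = `|u - t|) ->
  (forall t, a <= t <= b -> ccont _ F (p t)) ->
  scont _ a b (fun t => F (p t)).
Proof.
move=> pE Fc; have key t : a <= t <= b -> forall e, 0 < e -> exists2 d, 0 < d &
     forall u, `|u - t| < d -> cabs (F (p u) - F (p t)) < e.
  move=> tab e /(Fc t tab)[d d0 H]; exists d => // u ut; apply: H.
  by rewrite pE.
by split=> t /key /(@continuous_ReIm_path (fun t => F (p t)) t)[].
Qed.

Lemma scont_hside F (a b y : R) :
  (forall x, a <= x <= b -> ccont _ F (Complex x y)) ->
  scont _ a b (fun x => F (Complex x y)).
Proof.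
apply: (@scont_path a b (fun x => Complex x y)) => u t.
have -> : Complex u y - Complex t y = rC (u - t) by simpc.
exact: cabs_rC.
Qed.

Lemma scont_vside F (a b x : R) :
  (forall y, a <= y <= b -> ccont _ F (Complex x y)) ->
  scont _ a b (fun y => F (Complex x y)).
Proof.
apply: (@scont_path a b (fun y => Complex x y)) => u t.
have -> : Complex x u - Complex x t = ci * rC (u - t) by rewrite /ci /rC; simpc.
by rewrite cabsM cabs_ci mul1r cabs_rC.
Qed.

Definition bcont F r := forall z, onbd r z -> ccont _ F z.

Section BoundaryContinuity.
Variables (F : R[i] -> R[i]) (r : rect R).
Hypotheses (rp : wfrect r) (Fc : bcont F r).

Lemma scont_bot : scont _ (lft _ r) (rgt _ r) (fun x => F (Complex x (bot _ r))).
Proof.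
by apply: scont_hside => x xr; apply: Fc; split; [split; rewrite //= lexx rp.2|constructor 1].
Qed.

Lemma scont_top : scont _ (lft _ r) (rgt _ r) (fun x => F (Complex x (top _ r))).
Proof.
by apply: scont_hside => x xr; apply: Fc; split; [split; rewrite //= lexx rp.2|constructor 2].
Qed.

Lemma scont_rgt : scont _ (bot _ r) (top _ r) (fun y => F (Complex (rgt _ r) y)).
Proof.
by apply: scont_vside => x xr; apply: Fc; split; [split; rewrite //= lexx rp.1|constructor 3].
Qed.

Lemma scont_lft : scont _ (bot _ r) (top _ r) (fun y => F (Complex (lft _ r) y)).
Proof.
by apply: scont_vside => x xr; apply: Fc; split; [split; rewrite //= lexx rp.1|constructor 4].
Qed.

End BoundaryContinuity.

Lemma scontB (a b : R) (p q : R -> R[i]) : scont _ a b p -> scont _ a b q ->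
  scont _ a b (fun t => p t - q t).
Proof.
move=> [p1 p2] [q1 q2]; split=> t tab.
- rewrite (_ : (fun _ => _) = fun t => complex.Re (p t) - complex.Re (q t)).
    by apply: continuousB; [exact: p1|exact: q1].
  by apply/funext => u; rewrite cReB.
- rewrite (_ : (fun _ => _) = fun t => complex.Im (p t) - complex.Im (q t)).
    by apply: continuousB; [exact: p2|exact: q2].
  by apply/funext => u; rewrite cImB.
Qed.

Lemma contourE F r : wfrect r -> bcont F r -> contour F r =
  cint _ (lft _ r) (rgt _ r) (fun x => F (Complex x (bot _ r))) -
  cint _ (lft _ r) (rgt _ r) (fun x => F (Complex x (top _ r))) +
  ci * (cint _ (bot _ r) (top _ r) (fun y => F (Complex (rgt _ r) y)) -
        cint _ (bot _ r) (top _ r) (fun y => F (Complex (lft _ r) y))).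
Proof.
move=> rp Fc; rewrite /contour !cintB//; solve
  [exact: (scont_bot F r) | exact: (scont_top F r) | exact: (scont_rgt F r)
  |exact: (scont_lft F r)].
Qed.

Lemma eq_contour F G r : wfrect r -> (forall z, onbd r z -> F z = G z) ->
  contour F r = contour G r.
Proof.
move=> rp FG; congr (_ + _ * _); apply: eq_cint => t tr.
- by rewrite !FG//; split; try (split; rewrite /= ?lexx ?rp.2//);
    [constructor 2|constructor 1].
- by rewrite !FG//; split; try (split; rewrite /= ?lexx ?rp.1//);
    [constructor 4|constructor 3].
Qed.

Lemma contourB F G r : wfrect r -> bcont F r -> bcont G r ->
  contour (fun z => F z - G z) r = contour F r - contour G r.
Proof.
move=> rp Fc Gc; have FGc : bcont (fun z => F z - G z) r.
  by move=> z zr; apply: ccontB; [exact: Fc|exact: Gc].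
rewrite !contourE// !cintB; try solve
  [exact: (scont_bot F r) | exact: (scont_top F r) | exact: (scont_rgt F r)
  |exact: (scont_lft F r) | exact: (scont_bot G r) | exact: (scont_top G r)
  |exact: (scont_rgt G r) | exact: (scont_lft G r)].
by ring.
Qed.

Lemma contourZ (k : R[i]) F r : wfrect r -> bcont F r ->
  contour (fun z => k * F z) r = k * contour F r.
Proof.
move=> rp Fc; have kFc : bcont (fun z => k * F z) r.
  by move=> z zr; apply: ccontM; [exact: ccont_cst|exact: Fc].
rewrite !contourE// !cintZ; try solve
  [exact: (scont_bot F r) | exact: (scont_top F r) | exact: (scont_rgt F r)
  |exact: (scont_lft F r)].
by ring.
Qed.

Lemma contour_norm F r (M : R) : wfrect r -> bcont F r ->
  (forall z, onbd r z -> cabs (F z) <= M) ->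
  cabs (contour F r) <= 4 * M * ((rgt _ r - lft _ r) + (top _ r - bot _ r)).
Proof.
move=> rp Fc FM.
have h1 : cabs (cint _ (lft _ r) (rgt _ r)
    (fun x => F (Complex x (bot _ r)) - F (Complex x (top _ r)))) <=
    2 * (M + M) * (rgt _ r - lft _ r).
  apply: cint_norm; first exact: rp.1.
    by apply: scontB; [exact: (scont_bot F r)|exact: (scont_top F r)].
  move=> t tr; apply: le_trans (cabsB _ _ _) _; apply: lerD; apply: FM;
    by split; [split; rewrite //= lexx rp.2|(constructor 1 + constructor 2)].
have h2 : cabs (cint _ (bot _ r) (top _ r)
    (fun y => F (Complex (rgt _ r) y) - F (Complex (lft _ r) y))) <=
    2 * (M + M) * (top _ r - bot _ r).
  apply: cint_norm; first exact: rp.2.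
    by apply: scontB; [exact: (scont_rgt F r)|exact: (scont_lft F r)].
  move=> t tr; apply: le_trans (cabsB _ _ _) _; apply: lerD; apply: FM;
    by split; [split; rewrite //= lexx rp.1|(constructor 3 + constructor 4)].
rewrite /contour; apply: le_trans (cabsD _ _ _) _.
by rewrite cabsM cabs_ci mul1r; nra.
Qed.

(** The two constant integrands are [k] times [i (bot - top)] and [k] times [rgt - lft]; they
    contribute [- i k] and [+ i k] times the area. *)
Lemma contour_affine (k c : R[i]) r : wfrect r ->
  contour (fun z => c + k * z) r = 0.
Proof.
move=> rp; rewrite /contour.
rewrite (eq_cint _ _ _ _ (fun=> k * (ci * rC (bot _ r - top _ r)))); last first.
  by move=> t _; case: (k) => a b; case: (c) => c1 c2; rewrite /ci /rC; simpc;
     congr Complex; ring.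
rewrite [cint _ (bot _ r) _ _](eq_cint _ _ _ _ (fun=> k * rC (rgt _ r - lft _ r))); last first.
  by move=> t _; case: (k) => a b; case: (c) => c1 c2; rewrite /ci /rC; simpc;
     congr Complex; ring.
rewrite !cint_cst ?rp.1 ?rp.2//.
by case: (k) => a b; rewrite /ci /rC; simpc; rewrite -[0]/(Complex 0 0); congr Complex; ring.
Qed.

Lemma contour_splitx F r (c : R) : wfrect r -> lft _ r <= c <= rgt _ r ->
  (forall z, inrect r z -> ccont _ F z) ->
  contour F r = contour F (Rect (lft _ r) c (bot _ r) (top _ r)) +
                contour F (Rect c (rgt _ r) (bot _ r) (top _ r)).
Proof.
move=> rp /andP[lc cr] Fc.
have b0 : bcont F r by move=> z [zr _]; exact: Fc.
have b1 : bcont F (Rect (lft _ r) c (bot _ r) (top _ r)).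
  move=> z [[/= /andP[z1 z2] z3] _]; apply: Fc; split => //.
  by rewrite z1 (le_trans z2).
have b2 : bcont F (Rect c (rgt _ r) (bot _ r) (top _ r)).
  move=> z [[/= /andP[z1 z2] z3] _]; apply: Fc; split => //.
  by rewrite z2 andbT (le_trans lc).
have p1 : wfrect (Rect (lft _ r) c (bot _ r) (top _ r)) by split => //; case: rp.
have p2 : wfrect (Rect c (rgt _ r) (bot _ r) (top _ r)) by split => //; case: rp.
rewrite !contourE//= (cint_split _ (lft _ r) c)//; last exact: (scont_bot F r).
rewrite [X in _ - X + _](cint_split _ (lft _ r) c)//; last exact: (scont_top F r).
by ring.
Qed.

Lemma contour_splity F r (c : R) : wfrect r -> bot _ r <= c <= top _ r ->
  (forall z, inrect r z -> ccont _ F z) ->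
  contour F r = contour F (Rect (lft _ r) (rgt _ r) (bot _ r) c) +
                contour F (Rect (lft _ r) (rgt _ r) c (top _ r)).
Proof.
move=> rp /andP[lc cr] Fc.
have b0 : bcont F r by move=> z [zr _]; exact: Fc.
have b1 : bcont F (Rect (lft _ r) (rgt _ r) (bot _ r) c).
  move=> z [[/= z3 /andP[z1 z2]] _]; apply: Fc; split => //.
  by rewrite z1 (le_trans z2).
have b2 : bcont F (Rect (lft _ r) (rgt _ r) c (top _ r)).
  move=> z [[/= z3 /andP[z1 z2]] _]; apply: Fc; split => //.
  by rewrite z2 andbT (le_trans lc).
have p1 : wfrect (Rect (lft _ r) (rgt _ r) (bot _ r) c) by split => //; case: rp.
have p2 : wfrect (Rect (lft _ r) (rgt _ r) c (top _ r)) by split => //; case: rp.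
rewrite !contourE//= (cint_split _ (bot _ r) c)//; last exact: (scont_rgt F r).
rewrite [X in ci * (_ - X)](cint_split _ (bot _ r) c)//; last exact: (scont_lft F r).
by ring.
Qed.

End Contour.

(** * Goursat's theorem *)

Section Cauchy.
Variable R : realType.
Implicit Types (F G : R[i] -> R[i]) (r s : rect R) (z w : R[i]).

Lemma sub_inrect r s z : subrect _ r s -> inrect _ r z -> inrect _ s z.
Proof.
move=> [/andP[a1 a2] a3 /andP[a4 a5] a6] [/andP[b1 b2] /andP[b3 b4]].
by split; apply/andP; split; lra.
Qed.

Lemma sub_wfrect r s : subrect _ r s -> wfrect _ r.
Proof. by move=> [/andP[_ ?] _ /andP[_ ?] _]. Qed.

Lemma mid_between (a b : R) : a <= b -> a <= (a + b) / 2 <= b.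
Proof. by move=> ?; apply/andP; split; lra. Qed.

Lemma contour_quarters F r : wfrect _ r ->
  (forall z, inrect _ r z -> ccont _ F z) ->
  contour _ F r = \sum_(q <- quarters _ r) contour _ F q.
Proof.
move=> rp Fc; rewrite (contour_splitx _ F r (midx _ r))//; last first.
  exact: mid_between rp.1.
have [/andP[m1 m2] /andP[n1 n2]] := (mid_between _ _ rp.1, mid_between _ _ rp.2).
rewrite (contour_splity _ F (Rect _ (midx _ r) _ _) (midy _ r))//=; first last.
- move=> z /= [/= /andP[z1 z2] z3]; apply: Fc; split => //.
  by rewrite z1 (le_trans z2).
- by apply/andP.
- by split => //; exact: rp.2.
rewrite (contour_splity _ F (Rect (midx _ r) _ _ _) (midy _ r))//=; first last.
- move=> z /= [/= /andP[z1 z2] z3]; apply: Fc; split => //.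
  by rewrite z2 andbT (le_trans _ z1).
- by apply/andP.
- by split => //; exact: rp.2.
rewrite !big_cons big_nil.
by rewrite addr0 addrACA -addrA.
Qed.

Lemma cabs_sub_le z w (a b : R) :
  `|complex.Re z - complex.Re w| <= a -> `|complex.Im z - complex.Im w| <= b ->
  cabs (z - w) <= a + b.
Proof.
move=> za zb; apply: le_trans (cabs_le_ReIm _ _) _.
by rewrite cReB cImB lerD.
Qed.

(** For each [c > 0] the bound [c * A] is propagated by bisection: [A] is quadratic in the side
    lengths, so the bounds of four quarters add up to that of the whole, and near a point [F]
    differs from an affine function, whose contour integral is 0, by a small multiple of the
    size. *)
Lemma goursat F s : wfrect _ s ->
  (forall z, inrect _ s z -> exists l, cder _ F z l) -> contour _ F s = 0.
Proof.
move=> sp Fd; have Fc z : inrect _ s z -> ccont _ F z.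
  by move=> /Fd[l]; exact: cder_cont.
pose A r := (rgt _ r - lft _ r) ^+ 2 + (top _ r - bot _ r) ^+ 2.
have H c : 0 < c -> cabs (contour _ F s) <= c * A s.
  move=> c0; pose Q r := cabs (contour _ F r) <= c * A r.
  apply: (rect_bisection _ Q); [exact: sp.1|exact: sp.2| |].
  - move=> r rs Qq; have rp := sub_wfrect _ _ rs.
    rewrite /Q contour_quarters//; last by move=> z /(sub_inrect _ _ _ rs)/Fc.
    have q q' : isquarter _ r q' -> cabs (contour _ F q') <= c * (A r / 4).
      move=> rq; apply: le_trans (Qq _ rq) _; rewrite ler_pM2l// /A.
      by have [_ -> ->] := isquarterP _ _ _ rp.1 rp.2 rq; lra.
    rewrite 4!big_cons big_nil addr0.
    apply: le_trans (cabsD _ _ _) _.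
    apply: le_trans (lerD (lexx _) (cabsD _ _ _)) _.
    apply: le_trans (lerD (lexx _) (lerD (lexx _) (cabsD _ _ _))) _.
    have := (q _ (Or41 _ _ _ erefl), q _ (Or42 _ _ _ erefl),
             q _ (Or43 _ _ _ erefl), q _ (Or44 _ _ _ erefl)).
    rewrite /=; move: (cabs _) (cabs _) (cabs _) (cabs _) => a1 a2 a3 a4.
    by move: (A r) => a5 [[[q1 q2] q3] q4]; lra.
  - move=> x y xs ys; have [l lP] := Fd (Complex x y) (conj xs ys).
    (* The contour bound then gives [4 * (c / 8) * (wd + ht)^2], at most [c * (wd^2 + ht^2)] because
       [(wd - ht)^2] is nonnegative. *)
    have [d d0 dP] := lP (c / 8) ltac:(lra).
    exists (d / 2); first by lra.
    move=> r rs /andP[x1 x2] /andP[y1 y2] w1 h1; have rp := sub_wfrect _ _ rs.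
    rewrite /Q; set p := Complex x y in lP dP.
    pose E := fun z => F z - ((F p - l * p) + l * z).
    have Ac : bcont _ (fun z => (F p - l * p) + l * z) r.
      move=> z _; apply: ccontD; first exact: ccont_cst.
      apply: ccontM; first exact: ccont_cst.
      by move=> e e0; exists e.
    have Fbc : bcont _ F r by move=> z [/(sub_inrect _ _ _ rs)/Fc].
    have -> : contour _ F r = contour _ E r.
      by rewrite contourB// contour_affine// subr0.
    have w0 : 0 <= rgt _ r - lft _ r by rewrite subr_ge0 rp.1.
    have h0 : 0 <= top _ r - bot _ r by rewrite subr_ge0 rp.2.
    move: w0 h0 w1 h1; set wd := rgt _ r - lft _ r; set ht := top _ r - bot _ r.
    move=> w0 h0 w1 h1.
    have EM z : onbd _ r z -> cabs (E z) <= c / 8 * (wd + ht).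
      move=> [[/andP[z1 z2] /andP[z3 z4]] _].
      have zp : cabs (z - p) <= wd + ht.
        by apply: cabs_sub_le; rewrite /= ler_norml; apply/andP; split; rewrite /wd /ht; lra.
      have zd : cabs (z - p) < d by apply: le_lt_trans zp _; lra.
      have := dP _ zd; have -> : p + (z - p) = z by ring.
      have -> : F z - F p - l * (z - p) = E z by rewrite /E; ring.
      by move/le_trans; apply; rewrite ler_pM2l//; lra.
    have Ec : bcont _ E r by move=> z zr; apply: ccontB; [exact: Fbc|exact: Ac].
    apply: le_trans (contour_norm _ _ _ _ rp Ec EM) _.
    rewrite -/wd -/ht /A -/wd -/ht.
    have : 0 <= c * (wd - ht) ^+ 2 by rewrite mulr_ge0 ?sqr_ge0// ltW.
    by lra.
apply/eqP; rewrite -cabs_eq0; apply: contrapT => /negP.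
rewrite neq_lt ltNge cabs_ge0 /= => k0.
set k := cabs _ in k0 H.
have A0 : 0 <= A s by rewrite addr_ge0 ?sqr_ge0.
have Ap : 0 < A s + 1 by lra.
(* The shift by 1 covers degenerate rectangles, where [A s] is 0; with this [c] the bound [H] would
   force [k < k / 2]. *)
have c0 : 0 < k / 2 / (A s + 1) by rewrite !divr_gt0.
have := H _ c0; have : k / 2 / (A s + 1) * (A s + 1) = k / 2.
  by rewrite mulfVK// gt_eqF.
by rewrite mulrDr mulr1; lra.
Qed.

Definition inside r z :=
  lft _ r < complex.Re z < rgt _ r /\ bot _ r < complex.Im z < top _ r.

Lemma inside_inrect r z : inside r z -> inrect _ r z.
Proof. by move=> [/andP[a b] /andP[c d]]; split; rewrite !ltW. Qed.

Lemma inside_wfrect r z : inside r z -> wfrect _ r.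
Proof.
by move=> [/andP[a b] /andP[c d]]; split; apply: ltW; [exact: lt_trans a b|exact: lt_trans c d].
Qed.

Local Ltac box := solve
  [ assumption | lra | apply/andP; split; rewrite /=; lra | split; rewrite /=; lra
  | match goal with H : _ |- forall z, _ => by [exact: H | apply: H; rewrite /=; lra] end
  | left; left; lra | left; right; lra | right; left; lra | right; right; lra ].

(** Goursat's theorem disposes of everything outside a small square around [z0], and on the boundary
    of that square continuity keeps [F] bounded, so its contour integral is of the order of the side
    length. *)
Lemma cauchy_removable F s z0 : inside s z0 ->
  (forall z, inrect _ s z -> ccont _ F z) ->
  (forall z, inrect _ s z -> z != z0 -> exists l, cder _ F z l) ->
  contour _ F s = 0.
Proof.
move=> z0s Fc Fd; have sp := inside_wfrect _ _ z0s.
have := z0s; rewrite /inside; case: z0 z0s Fd => x y /= z0s Fd.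
move=> [/andP[x1 x2] /andP[y1 y2]].
have split5 (e : R) : 0 < e -> lft _ s <= x - e -> x + e <= rgt _ s ->
    bot _ s <= y - e -> y + e <= top _ s ->
    contour _ F s = contour _ F (Rect (x - e) (x + e) (y - e) (y + e)).
  move=> e0 e1 e2 e3 e4.
  have sub0 a b c d : lft _ s <= a <= b -> b <= rgt _ s -> bot _ s <= c <= d ->
     d <= top _ s -> (b < x \/ x < a) \/ (d < y \/ y < c) ->
     contour _ F (Rect a b c d) = 0.
    move=> a1 b1 c1 d1 out; apply: goursat.
      by split; [case/andP: a1|case/andP: c1].
    move=> z zr; apply: Fd; first by apply: sub_inrect zr.
    apply/eqP => zxy; move: zr out; rewrite zxy => -[/= /andP[u1 u2] /andP[u3 u4]].
    by case; case; lra.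
  have Fc' a b c d : lft _ s <= a -> b <= rgt _ s -> bot _ s <= c ->
     d <= top _ s -> forall z, inrect _ (Rect a b c d) z -> ccont _ F z.
    move=> ? ? ? ? z [/= /andP[? ?] /andP[? ?]]; apply: Fc.
    by split; apply/andP; split; lra.
  have [s1 s2] := sp.
  rewrite (contour_splitx _ F s (x - e)); [|by box..].
  rewrite sub0 ?add0r; [|by box..].
  rewrite (contour_splitx _ F _ (x + e)) /=; [|by box..].
  rewrite [X in _ + X]sub0 ?addr0; [|by box..].
  rewrite (contour_splity _ F _ (y - e)) /=; [|by box..].
  rewrite sub0 ?add0r; [|by box..].
  rewrite (contour_splity _ F _ (y + e)) /=; [|by box..].
  by rewrite [X in _ + X]sub0 ?addr0; [|by box..].
pose z0 := Complex x y.
have [d d0 dP] := Fc z0 (inside_inrect _ _ z0s) 1 ltr01.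
pose M := cabs (F z0) + 1.
have M0 : 0 < M by rewrite ltr_wpDl// cabs_ge0.
(* A square of half side at most [g] stays in [s], and its points are at distance at most
   [2 * g < d] from [z0]. *)
pose g := Num.min (d / 4) (Num.min (Num.min (x - lft _ s) (rgt _ s - x)) (Num.min (y - bot _ s) (top _ s - y))).
have g0 : 0 < g by rewrite !lt_min !subr_gt0 x1 x2 y1 y2 divr_gt0.
(* The constant is [4 * M] times the sum [4 * e] of width and height. *)
have bound e : 0 < e -> e <= g -> cabs (contour _ F s) <= 16 * M * e.
  move=> e0; rewrite !le_min => /andP[e1 /andP[/andP[e2 e3] /andP[e4 e5]]].
  rewrite (split5 e)//; try lra.
  have rp : wfrect _ (Rect (x - e) (x + e) (y - e) (y + e)) by split => /=; lra.
  apply: le_trans (contour_norm _ _ _ M rp _ _) _ => /=.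
  - move=> z [[/= /andP[? ?] /andP[? ?]] _]; apply: Fc.
    by split; apply/andP; split; lra.
  - move=> z [[/= /andP[? ?] /andP[? ?]] _].
    have /dP : cabs (z - z0) < d.
      apply: le_lt_trans (cabs_sub_le _ _ e e _ _) _ => /=;
        by [rewrite ler_norml; apply/andP; split; lra|lra].
    move=> lt1; have -> : F z = F z0 + (F z - F z0) by ring.
    by apply: le_trans (cabsD _ _ _) _; rewrite /M lerD2l ltW.
  - by lra.
apply/eqP; rewrite -cabs_eq0; apply: contrapT => /negP.
rewrite neq_lt ltNge cabs_ge0 /= => k0.
set k := cabs _ in k0 bound.
(* With this choice [16 * M * e] is at most [k / 2]. *)
pose e := Num.min g (k / (32 * M)).
have e0 : 0 < e by rewrite lt_min g0 divr_gt0// mulr_gt0.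
have := bound e e0 ltac:(by rewrite ge_min lexx).
have : e <= k / (32 * M) by rewrite ge_min lexx orbT.
rewrite ler_pdivlMr ?mulr_gt0//.
by lra.
Qed.

End Cauchy.

(** * Cauchy formula and derivatives of holomorphic functions *)

Section CauchyFormula.
Variable R : realType.
Implicit Types (F G : R[i] -> R[i]) (r s : rect R) (z w h : R[i]).

Lemma inside_ball r z : inside _ r z ->
  exists2 d : R, 0 < d & forall w, cabs (w - z) < d -> inside _ r w.
Proof.
case: z => x y [/= /andP[x1 x2] /andP[y1 y2]].
exists (Num.min (Num.min (x - lft _ r) (rgt _ r - x))
                (Num.min (y - bot _ r) (top _ r - y))).
  by rewrite !lt_min !subr_gt0 x1 x2 y1 y2.
move=> w; rewrite !lt_min => /andP[/andP[d1 d2] /andP[d3 d4]].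
have := ler_Re_cabs _ (w - Complex x y); have := ler_Im_cabs _ (w - Complex x y).
rewrite cReB cImB /= !ler_norml => /andP[? ?] /andP[? ?].
by split; apply/andP; split; lra.
Qed.

Lemma onbd_inside r z : inside _ r z -> ~ onbd _ r z.
Proof. by move=> [/andP[? ?] /andP[? ?]] [_ []]; lra. Qed.

(** Differentiation under the integral sign: a remainder quadratic in [h], uniformly on the
    boundary, stays quadratic after integration, so no dominated convergence is involved. *)
Lemma contour_deriv r (K : R[i] -> R[i] -> R[i]) (K' : R[i] -> R[i]) z (C d : R) :
  wfrect _ r -> 0 < d -> 0 <= C ->
  (forall h, cabs h < d -> bcont _ (K (z + h)) r) -> bcont _ K' r ->
  (forall h w, cabs h < d -> onbd _ r w ->
     cabs (K (z + h) w - K z w - h * K' w) <= C * cabs h ^+ 2) ->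
  cder _ (fun z => contour _ (K z) r) z (contour _ K' r).
Proof.
move=> rp d0 C0 Kc K'c KM e e0.
have Kzc : bcont _ (K z) r by rewrite -(addr0 z); apply: Kc; rewrite cabs0.
pose L := (rgt _ r - lft _ r) + (top _ r - bot _ r).
have L0 : 0 <= L by rewrite addr_ge0// subr_ge0 ?rp.1 ?rp.2.
have CL : 0 <= 4 * C * L by rewrite !mulr_ge0.
pose D := 4 * C * L + 1; have D0 : 0 < D by rewrite /D; lra.
exists (Num.min d (e / D)); first by rewrite lt_min d0 divr_gt0.
move=> h; rewrite lt_min => /andP[hd he].
have hKc : bcont _ (fun w => h * K' w) r.
  by move=> w wr; apply: ccontM; [exact: ccont_cst|exact: K'c].
have hK := Kc _ hd.
have dc : bcont _ (fun w => K (z + h) w - K z w) r.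
  by move=> w wr; apply: ccontB; [exact: hK|exact: Kzc].
rewrite [_ * h]mulrC -contourZ// -contourB// -contourB//.
have Ec : bcont _ (fun w => K (z + h) w - K z w - h * K' w) r.
  by move=> w wr; apply: ccontB; [exact: dc|exact: hKc].
apply: le_trans (contour_norm _ _ _ _ rp Ec (fun w => KM h w hd)) _.
rewrite -/L; have h0 := cabs_ge0 _ h.
have he' : cabs h * D <= e by rewrite -ler_pdivlMr// ltW.
have -> : 4 * (C * cabs h ^+ 2) * L = (4 * C * L * cabs h) * cabs h by ring.
apply: ler_wpM2r => //; apply: le_trans he'.
by rewrite /D mulrC ler_wpM2l//; lra.
Qed.

Section Kernels.
Variables (r : rect R) (F : R[i] -> R[i]) (B : R) (z : R[i]).
Hypotheses (zr : inside _ r z) (Fc : bcont _ F r).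
Hypothesis (FB : forall w, onbd _ r w -> cabs (F w) <= B).

Lemma bcont_kernel z' : inside _ r z' -> bcont _ (fun w => F w * (w - z')^-1) r.
Proof.
move=> z'r w wr; apply: ccontM; first exact: Fc.
apply: ccontV; last exact: cder_cont (cder_subr _ _ _).
by rewrite subr_eq0; apply/eqP => wz; apply: onbd_inside z'r _; rewrite -wz.
Qed.

Lemma bcont_kernelX z' k : inside _ r z' ->
  bcont _ (fun w => F w * (w - z')^-1 ^+ k) r.
Proof.
move=> z'r; elim: k => [|k IH] w wr.
  by apply: ccontM; [exact: Fc|exact: ccont_cst].
rewrite (_ : (fun _ => _) = fun w => (F w * (w - z')^-1 ^+ k) * (w - z')^-1).
  apply: ccontM; first exact: IH.
  apply: ccontV; last exact: cder_cont (cder_subr _ _ _).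
  by rewrite subr_eq0; apply/eqP => wz; apply: onbd_inside z'r _; rewrite -wz.
by apply/funext => u; rewrite exprSr mulrA.
Qed.

(** The resolvent identity [q - p = h * p * q] turns the remainders of the Cauchy kernels into
    [h ^+ 2] times products of [F], [p] and [q]. The radius is half that of a ball about [z] inside
    the rectangle, whence the bound doubles from [p] to [q]. *)
Lemma kernel_bounds : exists d P : R, [/\ 0 < d, 0 <= P,
  (forall h, cabs h < d -> inside _ r (z + h)) &
  forall h w, cabs h < d -> onbd _ r w ->
    let p := (w - z)^-1 in let q := (w - (z + h))^-1 in
    [/\ q - p = h * p * q, cabs p <= P & cabs q <= 2 * P]].
Proof.
have [d d0 dP] := inside_ball _ _ zr.
have dist w : onbd _ r w -> d <= cabs (w - z).
  by move=> wr; rewrite leNgt; apply/negP => /dP/onbd_inside.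
exists (d / 2), d^-1; split; rewrite ?invr_ge0 ?divr_gt0// ?ltW//.
  move=> h hd; apply: dP; have -> : z + h - z = h by ring.
  by lra.
move=> h w hd /dist wd p q.
have wz : d / 2 <= cabs (w - (z + h)).
  have := cabsD _ (w - (z + h)) h.
  have -> : w - (z + h) + h = w - z by ring.
  by lra.
have p0 : w - z != 0 by rewrite -cabs_gt0; lra.
have q0 : w - (z + h) != 0 by rewrite -cabs_gt0; lra.
split.
- by rewrite /p /q; field; rewrite q0 p0.
- by rewrite /p cabsV lef_pV2// posrE; lra.
- rewrite /q cabsV.
  have -> : 2 * d^-1 = (d / 2)^-1 by rewrite invfM invrK mulrC.
  by rewrite lef_pV2// posrE; lra.
Qed.

Let B0 : 0 <= B.
Proof.
have [/andP[x1 x2] /andP[y1 y2]] := zr; have rp := inside_wfrect _ _ _ zr.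
apply: le_trans (FB (Complex (lft _ r) (bot _ r)) _); first exact: cabs_ge0.
by split; [split; rewrite /= lexx ?rp.1 ?rp.2|constructor 1].
Qed.

Lemma cder_kernel1 : cder _ (fun z => contour _ (fun w => F w * (w - z)^-1) r) z
  (contour _ (fun w => F w * (w - z)^-1 ^+ 2) r).
Proof.
have [d [P [d0 P0 hd H]]] := kernel_bounds.
apply: (contour_deriv r (fun z w => F w * (w - z)^-1) _ _ (B * (P ^+ 2 * (2 * P))) d) => //.
- exact: inside_wfrect zr.
- by rewrite !mulr_ge0// exprn_ge0.
- by move=> h /hd; exact: bcont_kernel.
- exact: bcont_kernelX.
move=> h w hd' wr; have [] := H h w hd' wr.
move: (w - z)^-1 (w - (z + h))^-1 => p q E pP qP.
have -> : F w * q - F w * p - h * (F w * p ^+ 2) = F w * (p ^+ 2 * q) * h ^+ 2.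
  have -> : F w * q - F w * p - h * (F w * p ^+ 2) =
     F w * ((q - p) - h * p ^+ 2) by ring.
  rewrite E; have -> : h * p * q - h * p ^+ 2 = h * p * (q - p) by ring.
  by rewrite E; ring.
rewrite !cabsM -!expr2 ler_wpM2r ?exprn_ge0 ?cabs_ge0//.
by rewrite !ler_pM ?cabs_ge0 ?mulr_ge0 ?FB ?cabs_ge0.
Qed.

Lemma cder_kernel2 : cder _ (fun z => contour _ (fun w => F w * (w - z)^-1 ^+ 2) r) z
  (contour _ (fun w => 2 * (F w * (w - z)^-1 ^+ 3)) r).
Proof.
have [d [P [d0 P0 hd H]]] := kernel_bounds.
apply: (contour_deriv r (fun z w => F w * (w - z)^-1 ^+ 2) _ _
  (B * (P * P * (2 * P) * (2 * P + (P + P)))) d) => //.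
- exact: inside_wfrect zr.
- by rewrite !mulr_ge0// !addr_ge0// mulr_ge0.
- by move=> h /hd; exact: bcont_kernelX.
- by move=> w wr; apply: ccontM; [exact: ccont_cst|exact: bcont_kernelX].
move=> h w hd' wr; have [] := H h w hd' wr.
move: (w - z)^-1 (w - (z + h))^-1 => p q E pP qP.
have -> : F w * q ^+ 2 - F w * p ^+ 2 - h * (2 * (F w * p ^+ 3)) =
    F w * (p * p * q * (q + (p + p))) * h ^+ 2.
  have -> : F w * q ^+ 2 - F w * p ^+ 2 - h * (2 * (F w * p ^+ 3)) =
     F w * ((q - p) * (q + p) - h * (2 * p ^+ 3)) by ring.
  rewrite E; have -> : h * p * q * (q + p) - h * (2 * p ^+ 3) =
    h * p * ((q - p) * (q + (p + p))) by ring.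
  by rewrite E; ring.
rewrite !cabsM -!expr2 ler_wpM2r ?exprn_ge0 ?cabs_ge0//.
have qpp : cabs (q + (p + p)) <= 2 * P + (P + P).
  apply: le_trans (cabsD _ _ _) (lerD qP _).
  exact: le_trans (cabsD _ _ _) (lerD pP pP).
by rewrite !ler_pM ?mulr_ge0 ?cabs_ge0 ?FB.
Qed.

End Kernels.

(** Local boundedness comes from continuity, and the maximum of four bounds passes from the quarters
    to the whole. *)
Lemma inrect_bounded r F : wfrect _ r -> (forall z, inrect _ r z -> ccont _ F z) ->
  exists B, forall z, inrect _ r z -> cabs (F z) <= B.
Proof.
move=> rp Fc.
apply: (rect_bisection _ (fun q => exists B, forall z, inrect _ q z -> cabs (F z) <= B));
  [exact: rp.1|exact: rp.2| |].
- move=> q qr H.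
  have [B1 H1] := H _ (Or41 _ _ _ erefl); have [B2 H2] := H _ (Or42 _ _ _ erefl).
  have [B3 H3] := H _ (Or43 _ _ _ erefl); have [B4 H4] := H _ (Or44 _ _ _ erefl).
  exists (Num.max (Num.max B1 B2) (Num.max B3 B4)).
  move=> z [/andP[x1 x2] /andP[y1 y2]]; rewrite !le_max.
  have [xm|xm] := leP (complex.Re z) (midx _ q);
    have [ym|ym] := leP (complex.Im z) (midy _ q).
  + by rewrite H1//; split; rewrite /=; lra.
  + by rewrite H3 ?orbT//; split; rewrite /=; lra.
  + by rewrite H2 ?orbT//; split; rewrite /=; lra.
  + by rewrite H4 ?orbT//; split; rewrite /=; lra.
- move=> x y xr yr; have [d d0 dP] := Fc (Complex x y) (conj xr yr) 1 ltr01.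
  exists (d / 2); first by lra.
  move=> q qr /andP[x1 x2] /andP[y1 y2] w1 h1.
  exists (cabs (F (Complex x y)) + 1) => z [/andP[z1 z2] /andP[z3 z4]].
  have /dP Fz : cabs (z - Complex x y) < d.
    apply: le_lt_trans (cabs_sub_le _ _ _ (rgt _ q - lft _ q) (top _ q - bot _ q) _ _) _ => /=;
      try (rewrite ler_norml; apply/andP; split); lra.
  have -> : F z = F (Complex x y) + (F z - F (Complex x y)) by ring.
  by apply: le_trans (cabsD _ _ _) _; rewrite lerD2l ltW.
Qed.

Lemma Im_inv z : complex.Im z^-1 =
  - complex.Im z / (complex.Re z ^+ 2 + complex.Im z ^+ 2).
Proof. by case: z => a b; rewrite /= mulNr. Qed.

Lemma Re_inv z : complex.Re z^-1 =
  complex.Re z / (complex.Re z ^+ 2 + complex.Im z ^+ 2).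
Proof. by case: z. Qed.

(* The value 2 pi i is not needed: each side contributes positively to the
   imaginary part. *)
Lemma contour_inv_neq0 r z : inside _ r z -> contour _ (fun w => (w - z)^-1) r != 0.
Proof.
move=> zr; have rp := inside_wfrect _ _ _ zr.
have b0 : bcont _ (fun w => (w - z)^-1) r.
  move=> w wr; apply: ccontV; last exact: cder_cont (cder_subr _ _ _).
  by rewrite subr_eq0; apply/eqP => wz; apply: onbd_inside zr _; rewrite -wz.
have [h1 h2] := scontB _ _ _ _ _ (scont_bot _ _ _ rp b0) (scont_top _ _ _ rp b0).
have [v1 v2] := scontB _ _ _ _ _ (scont_rgt _ _ _ rp b0) (scont_lft _ _ _ rp b0).
suff : 0 < complex.Im (contour _ (fun w => (w - z)^-1) r).
  by apply: contraTneq => ->; rewrite ltxx.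
rewrite /contour cImD cImM [complex.Re ci]/= [complex.Im ci]/= mul0r mul1r add0r.
move: zr; rewrite /inside; case: z b0 h1 h2 v1 v2 => x y _ h1 h2 v1 v2.
move=> [/= /andP[x1 x2] /andP[y1 y2]].
pose L := (rgt _ r - lft _ r); pose H := (top _ r - bot _ r).
have L0 : 0 < L by rewrite subr_gt0; lra.
have H0 : 0 < H by rewrite subr_gt0; lra.
pose D := (L ^+ 2 + H ^+ 2)^-1.
have D0 : 0 < D by rewrite invr_gt0 ltr_wpDr ?sqr_ge0 ?exprn_gt0.
(* Comparison of integrals requires a constant lower bound: no boundary point is further from [z]
   than the diagonal, so [D] bounds the inverse squared distance from below along each side. *)
have frac (a u v : R) : 0 <= a -> (0 < `|u|) || (0 < `|v|) -> `|u| <= L -> `|v| <= H ->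
    a * D <= a / (u ^+ 2 + v ^+ 2).
  move=> a0 uv0 uL vH; rewrite ler_wpM2l// lef_pV2 ?posrE.
  - by rewrite -(real_normK (num_real u)) -(real_normK (num_real v)) lerD// ler_pXn2r ?nnegrE// ltW.
  - by rewrite ltr_wpDr ?sqr_ge0 ?exprn_gt0.
  - by case/orP: uv0; rewrite normr_gt0 => uv; [rewrite ltr_wpDr|rewrite ltr_wpDl];
       rewrite ?sqr_ge0// lt_def sqrf_eq0 uv sqr_ge0.
apply: ltr_pwDl.
- apply: lt_le_trans (rint_ge _ _ _ _ ((y - bot _ r) * D) rp.1 h2 _).
    by rewrite !mulr_gt0// subr_gt0.
  move=> t /andP[t1 t2]; rewrite cImB !Im_inv !cReB !cImB /=.
  have f1 : (y - bot _ r) * D <= (y - bot _ r) / ((t - x) ^+ 2 + (bot _ r - y) ^+ 2).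
    apply: frac; [lra|by rewrite !normr_gt0 !subr_eq0 (lt_eqF y1) ?orbT|
      by rewrite ler_norml /L; apply/andP; split; lra|
      by rewrite ler_norml /H; apply/andP; split; lra].
  have f2 : (top _ r - y) * D <= (top _ r - y) / ((t - x) ^+ 2 + (top _ r - y) ^+ 2).
    apply: frac; [lra|by rewrite !normr_gt0 !subr_eq0 (gt_eqF y2) ?orbT|
      by rewrite ler_norml /L; apply/andP; split; lra|
      by rewrite ler_norml /H; apply/andP; split; lra].
  have f3 : 0 <= (top _ r - y) * D by rewrite mulr_ge0 ?subr_ge0// ltW.
  rewrite !mulNr opprK -mulNr opprB.
  by apply: le_trans f1 _; rewrite lerDl (le_trans f3).
- apply: le_trans (rint_ge _ _ _ _ ((rgt _ r - x) * D) rp.2 v1 _).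
    by rewrite ltW// !mulr_gt0// subr_gt0.
  move=> t /andP[t1 t2]; rewrite cReB !Re_inv !cReB !cImB /=.
  have f1 : (rgt _ r - x) * D <= (rgt _ r - x) / ((rgt _ r - x) ^+ 2 + (t - y) ^+ 2).
    apply: frac; [lra|by rewrite !normr_gt0 !subr_eq0 (gt_eqF x2) ?orbT|
      by rewrite ler_norml /L; apply/andP; split; lra|
      by rewrite ler_norml /H; apply/andP; split; lra].
  have f2 : (x - lft _ r) * D <= (x - lft _ r) / ((lft _ r - x) ^+ 2 + (t - y) ^+ 2).
    apply: frac; [lra|by rewrite !normr_gt0 !subr_eq0 (lt_eqF x1) ?orbT|
      by rewrite ler_norml /L; apply/andP; split; lra|
      by rewrite ler_norml /H; apply/andP; split; lra].
  have f3 : 0 <= (x - lft _ r) * D by rewrite mulr_ge0 ?subr_ge0// ltW.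
  rewrite -mulNr opprB.
  by apply: le_trans f1 _; rewrite lerDl (le_trans f3).
Qed.

(** The difference quotient of [F] at [z], completed by the derivative, is continuous at [z] and
    differentiable elsewhere, so its contour integral vanishes; splitting the quotient gives the
    formula. *)
Lemma cauchy_formula r F z : inside _ r z ->
  (forall w, inrect _ r w -> exists l, cder _ F w l) ->
  F z * contour _ (fun w => (w - z)^-1) r = contour _ (fun w => F w * (w - z)^-1) r.
Proof.
move=> zr Fd; have rp := inside_wfrect _ _ _ zr.
have [l lP] := Fd z (inside_inrect _ _ _ zr).
have Fc w : inrect _ r w -> ccont _ F w by move=> /Fd[l']; exact: cder_cont.
pose q w := if w == z then l else (F w - F z) * (w - z)^-1.
have qd w : inrect _ r w -> w != z -> exists l, cder _ q w l.
  move=> wr wz; have [l' l'P] := Fd w wr.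
  have wz0 : w - z != 0 by rewrite subr_eq0.
  have D1 := cderB _ _ _ _ _ _ l'P (cder_cst _ (F z) w).
  have D2 := cderV _ (fun w => w - z) w 1 wz0 (cder_subr _ z w).
  have D := cderM _ _ _ _ _ _ D1 D2.
  (* Within distance [cabs (w - z)] of [w] the exceptional point [z] is not met. *)
  eexists; apply: (cder_ext _ _ _ _ _ (cabs (w - z)) _ _ D); first by rewrite cabs_gt0.
  move=> u uw; rewrite /q; case: eqP => // uz.
  by move: uw; rewrite uz cabs_subC ltxx.
have qc w : inrect _ r w -> ccont _ q w.
  move=> wr; have [->|wz] := eqVneq w z; last by have [l'] := qd w wr wz; exact: cder_cont.
  move=> e e0; have [d d0 dP] := lP (e / 2) ltac:(lra).
  exists d => // u ud; rewrite /q eqxx; case: eqP => [_|/eqP uz].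
    by rewrite subrr cabs0.
  have uz0 : u - z != 0 by rewrite subr_eq0.
  have := dP _ ud; have -> : z + (u - z) = u by ring.
  have -> : F u - F z - l * (u - z) = ((F u - F z) * (u - z)^-1 - l) * (u - z).
    by rewrite mulrBl -mulrA mulVf// mulr1.
  by rewrite cabsM ler_pM2r ?cabs_gt0//; lra.
have q0 := cauchy_removable _ q r z zr qc qd.
have bF : bcont _ F r by move=> w [wr _]; exact: Fc.
have b1 := bcont_kernel _ _ bF z zr.
have b2 : bcont _ (fun w => (w - z)^-1) r.
  move=> w wr; apply: ccontV; last exact: cder_cont (cder_subr _ _ _).
  by rewrite subr_eq0; apply/eqP => wz; apply: onbd_inside zr _; rewrite -wz.
have b3 : bcont _ (fun w => F z * (w - z)^-1) r.
  by move=> w wr; apply: ccontM; [exact: ccont_cst|exact: b2].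
rewrite -contourZ//; apply/eqP; rewrite eq_sym -subr_eq0 -contourB// -q0.
apply/eqP; apply: eq_contour => // w wr; rewrite /q; case: eqP => [wz|_].
  by case: (onbd_inside _ _ zr); rewrite -wz.
by rewrite mulrBl.
Qed.

(* F = I / c with I(z) and c(z) the contour integrals of F(w) / (w - z) and
   1 / (w - z), which can be differentiated under the integral sign. *)
Lemma holo_derivative (U : R[i] -> Prop) F z0 : copen U -> holo_on U F -> U z0 ->
  exists F', exists2 d : R, 0 < d &
    (forall z, cabs (z - z0) < d -> cder _ F z (F' z)) /\ exists l, cder _ F' z0 l.
Proof.
move=> Uo /holo_onP FU Uz0; have [d [d0 dU]] := Uo z0 Uz0.
pose r := Rect (complex.Re z0 - d / 4) (complex.Re z0 + d / 4)
               (complex.Im z0 - d / 4) (complex.Im z0 + d / 4).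
have z0r : inside _ r z0 by split; apply/andP; split; rewrite /=; lra.
have rp := inside_wfrect _ _ _ z0r.
have [e e0 er] := inside_ball _ _ z0r.
have Fd z : inrect _ r z -> exists l, cder _ F z l.
  move=> [/= /andP[x1 x2] /andP[y1 y2]]; apply: FU; apply: dU.
  by apply: le_lt_trans (cabs_sub_le _ _ _ (d / 4) (d / 4) _ _) _;
    rewrite ?ler_norml; try (apply/andP; split); lra.
have Fc z : inrect _ r z -> ccont _ F z by move=> /Fd[l]; exact: cder_cont.
have [B FB] := inrect_bounded _ _ rp Fc.
have Fb : bcont _ F r by move=> z [/Fc].
have Gb : bcont _ (fun=> 1) r by move=> z _; exact: ccont_cst.
have FB' w : onbd _ r w -> cabs (F w) <= B by move=> [/FB].
have GB w : onbd _ r w -> cabs (1 : R[i]) <= 1.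
  by move=> _; rewrite /cabs /= expr0n expr1n addr0 sqrtr1.
pose I z := contour _ (fun w => F w * (w - z)^-1) r.
pose I2 z := contour _ (fun w => F w * (w - z)^-1 ^+ 2) r.
(* The factor 1 presents [c] as the Cauchy integral of a constant function, so that the kernel
   lemmas cover it too. *)
pose c z := contour _ (fun w => 1 * (w - z)^-1) r.
pose c2 z := contour _ (fun w => 1 * (w - z)^-1 ^+ 2) r.
have cE z : c z = contour _ (fun w => (w - z)^-1) r.
  by apply: eq_contour => // w _; rewrite mul1r.
have c0 z : inside _ r z -> c z != 0 by rewrite cE; exact: contour_inv_neq0.
have FE z : inside _ r z -> F z = I z * (c z)^-1.
  by move=> zr; rewrite /I -cauchy_formula// -cE mulfK// c0.
(* This is the quotient rule for [I / c]. It again consists of contour integrals, which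
   [cder_kernel2] differentiates once more. *)
exists (fun z => I z * (- c z ^- 2 * c2 z) + (c z)^-1 * I2 z), e => //; split.
- move=> z /er zr.
  have [e' e'0 e'r] := inside_ball _ _ zr.
  apply: (cder_ext _ (fun z => I z * (c z)^-1) _ _ _ e' e'0).
    by move=> w /e'r/FE ->.
  apply: cderM; first exact: (cder_kernel1 _ _ B).
  by apply: cderV; [exact: c0|exact: (cder_kernel1 _ _ 1)].
- have dI := cder_kernel1 r F B z0 z0r Fb FB'.
  have dI2 := cder_kernel2 r F B z0 z0r Fb FB'.
  have dc := cder_kernel1 r (fun=> 1) 1 z0 z0r Gb GB.
  have dc2 := cder_kernel2 r (fun=> 1) 1 z0 z0r Gb GB.
  have dV := cderV _ _ _ _ (c0 _ z0r) dc.
  have dVV := cderM _ _ _ _ _ _ dV dV.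
  have D1 := cderM _ _ _ _ _ _ dI (cderM _ _ _ _ _ _ dVV dc2).
  have D2 := cderM _ _ _ _ _ _ dV dI2.
  eexists; apply: (cder_ext _ _ _ _ _ 1 _ _ (cderB _ _ _ _ _ _ D2 D1)) => // w _.
  by rewrite -invfM -expr2 mulNr mulrN addrC.
Qed.

End CauchyFormula.

(** * The Grassmann algebra *)

HB.instance Definition _ (R : realType) (K : nat) :=
  GRing.Zmodule.copy (grass R K) {ffun {set 'I_K} -> R[i]}.

Section Grassmann.
Variables (R : realType) (K : nat).
Local Notation G := (grass R K).
Implicit Types (a b c : G) (A B C D S T : {set 'I_K}).

Definition gsign A B : R[i] := (-1) ^+ ginv_count A B.

Lemma ginv_countE A B :
  ginv_count A B = (\sum_(i in A) \sum_(j in B) (j < i)%N)%N.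
Proof.
rewrite /ginv_count -sum1_card pair_big /= -big_mkcondr /=.
by apply: eq_bigl => p; rewrite unfold_in.
Qed.

Lemma sum_disjointU (F : 'I_K -> nat) A B : [disjoint A & B] ->
  (\sum_(i in A :|: B) F i = \sum_(i in A) F i + \sum_(i in B) F i)%N.
Proof. by move=> AB; rewrite -bigU//=; apply: eq_bigl => i; rewrite !inE. Qed.

Lemma ginv_count_setUl A B C : [disjoint A & B] ->
  ginv_count (A :|: B) C = (ginv_count A C + ginv_count B C)%N.
Proof. by move=> AB; rewrite !ginv_countE sum_disjointU. Qed.

Lemma ginv_count_setUr A B C : [disjoint B & C] ->
  ginv_count A (B :|: C) = (ginv_count A B + ginv_count A C)%N.
Proof.
move=> BC; rewrite !ginv_countE -big_split /=; apply: eq_bigr => i _.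
by rewrite sum_disjointU.
Qed.

(** Every pair in [A * B] has distinct entries, hence is an inversion in exactly one of the two
    orders. *)
Lemma ginv_count_sym A B : [disjoint A & B] ->
  (ginv_count A B + ginv_count B A = #|A| * #|B|)%N.
Proof.
move=> AB; rewrite !ginv_countE [X in (_ + X)%N]exchange_big /= -big_split /=.
rewrite -sum_nat_const; apply: eq_bigr => i iA.
rewrite -big_split -sum1_card /=; apply: eq_bigr => j jB.
have : val i != val j.
  apply: contraTneq jB => /val_inj <-.
  by have /pred0P/(_ i) /= := AB; rewrite iA /= => ->.
by rewrite /=; case: ltngtP.
Qed.

Lemma disjoint_setDr A S : [disjoint A & S :\: A].
Proof.
by rewrite -finset.setI_eq0 finset.setIC finset.setDE -finset.setIA
   [~: A :&: A]finset.setIC finset.setICr finset.setI0.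
Qed.

Lemma gsign0l A : gsign finset.set0 A = 1.
Proof. by rewrite /gsign ginv_countE big_set0 expr0. Qed.

Lemma gmulE a b S : gmul a b S =
  \sum_(A : {set 'I_K} | A \subset S) gsign A (S :\: A) * a A * b (S :\: A).
Proof. by rewrite ffunE. Qed.

Lemma gmulDl a b c : gmul (a + b) c = gmul a c + gmul b c.
Proof.
apply/ffunP => S; rewrite !(gmulE, ffunE) -big_split /=.
by apply: eq_bigr => A _; rewrite ffunE; ring.
Qed.

Lemma gscaleE (k : R[i]) a : gscale k a = gmul (gsc k) a.
Proof.
apply/ffunP => S; rewrite gmulE !ffunE (bigD1 finset.set0) ?finset.sub0set//= big1.
  by rewrite addr0 gsign0l finset.setD0 !ffunE eqxx mul1r.
by move=> A /andP[_ A0]; rewrite ffunE (negbTE A0) mulr0 mul0r.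
Qed.

Lemma gmul1g a : gmul (gsc 1) a = a.
Proof. by rewrite -gscaleE; apply/ffunP => S; rewrite ffunE mul1r. Qed.

(** Both sides are sums over ordered partitions of [S] into three sets. The signs agree because
    inversion counts are additive over disjoint unions in either argument. *)
Lemma gmulA a b c : gmul a (gmul b c) = gmul (gmul a b) c.
Proof.
apply/ffunP => S; rewrite !gmulE.
under [RHS]eq_bigr do rewrite gmulE mulr_sumr mulr_suml.
rewrite (exchange_big_dep (fun A => A \subset S)) /=; last first.
  by move=> D A DS /fintype.subset_trans; apply.
apply: eq_bigr => A AS; rewrite gmulE mulr_sumr.
rewrite [RHS](reindex_onto (fun B => A :|: B) (fun D => D :\: A)) /=; last first.
  by move=> D /andP[_ AD]; rewrite finset.setDE finset.setUIr finset.setUCr finset.setIT; apply/finset.setUidPr.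
apply: eq_big => B.
  rewrite finset.subUset AS finset.subsetUl andbT /= finset.setDUl finset.setDv finset.set0U finset.subsetD.
  by congr (_ && _); apply/idP/eqP => [/finset.setDidPl|/finset.setDidPl].
rewrite finset.subsetD => /andP[BS BA].
rewrite finset.setDUl finset.setDv finset.set0U (finset.setDidPl BA) -finset.setDDl.
set C := (S :\: A) :\: B.
have AB : [disjoint A & B] by rewrite disjoint_sym.
have SE : S :\: A = B :|: C.
  by rewrite /C -{1}(finset.setID (S :\: A) B) (finset.setIidPr _)// finset.subsetD BS.
have BC : [disjoint B & C] by exact: disjoint_setDr.
have e1 : gsign (A :|: B) C = gsign A C * gsign B C.
  by rewrite /gsign ginv_count_setUl// exprD.
have e2 : gsign A (S :\: A) = gsign A B * gsign A C.
  by rewrite /gsign SE ginv_count_setUr// exprD.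
by rewrite e1 e2; ring.
Qed.

Definition gparity (e : bool) a := forall S, a S != 0 -> odd #|S| = e.

(** This is the ideal generated by the generator [k]; since that generator squares to zero, any two
    members of the ideal have product zero. *)
Definition gthrough (k : 'I_K) a := forall S, a S != 0 -> k \in S.

Lemma gmul_neq0 a b S : gmul a b S != 0 ->
  exists A, [/\ A \subset S, a A != 0 & b (S :\: A) != 0].
Proof.
move=> ab; apply: contrapT => H; move/eqP: ab; apply.
rewrite gmulE big1// => A AS; have [->|aA] := eqVneq (a A) 0.
  by rewrite mulr0 mul0r.
have [->|bA] := eqVneq (b (S :\: A)) 0; first by rewrite mulr0.
by case: H; exists A.
Qed.

Lemma gparityM e1 e2 a b : gparity e1 a -> gparity e2 b ->
  gparity (e1 (+) e2) (gmul a b).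
Proof.
move=> ae be S /gmul_neq0[A [AS /ae <- /be <-]].
by rewrite -(cardsID A S) oddD (finset.setIidPr AS).
Qed.

Lemma gthroughMl k a b : gthrough k a -> gthrough k (gmul a b).
Proof. by move=> ak S /gmul_neq0[A [/fintype.subsetP AS /ak/AS]]. Qed.

Lemma gthroughMr k a b : gthrough k b -> gthrough k (gmul a b).
Proof. by move=> bk S /gmul_neq0[A [AS _ /bk]]; rewrite inE => /andP[]. Qed.

Lemma gthrough_mul0 k a b : gthrough k a -> gthrough k b -> gmul a b = 0.
Proof.
move=> ak bk; apply/ffunP => S; rewrite [RHS]ffunE; apply/eqP.
apply: contrapT => /negP/gmul_neq0[A [_ /ak kA /bk]].
by rewrite inE kA.
Qed.

(** Taking complements in [S] exchanges the factors; by [ginv_count_sym] the signs differ by [-1] to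
    the product of the two cardinals, which is even. *)
Lemma gmul_even a b : gparity false a -> gparity false b -> gmul a b = gmul b a.
Proof.
move=> ae be; apply/ffunP => S; rewrite !gmulE.
have DK A : A \subset S -> S :\: (S :\: A) = A.
  by move=> AS; rewrite finset.setDDr finset.setDv finset.set0U; apply/finset.setIidPr.
rewrite (reindex_onto (fun A => S :\: A) (fun A => S :\: A)) /=; last first.
  by move=> A /DK.
apply: eq_big => A.
  rewrite finset.subsetDl /=; apply/eqP/idP => [<-|/DK//].
  exact: finset.subsetDl.
rewrite finset.subsetDl /= => /eqP AK; rewrite AK.
have [->|aA] := eqVneq (a (S :\: A)) 0; first by rewrite !mulr0 mul0r.
have [->|bA] := eqVneq (b A) 0; first by rewrite !mulr0 mul0r.
rewrite -[LHS]mulrA [a _ * _]mulrC mulrA; congr (_ * _ * _).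
have /(congr1 odd) := ginv_count_sym A (S :\: A) (disjoint_setDr _ _).
rewrite oddM (be _ bA) /= oddD => /eqP.
rewrite /gsign -signr_odd -[RHS]signr_odd.
by case: (odd _) (odd _) => -[].
Qed.

End Grassmann.

(** * The commutative ring of even elements *)

Section EvenPart.
Variables (R : realType) (K : nat).
Local Notation G := (grass R K).
Implicit Types (a b : G) (S : {set 'I_K}).

(** The boolean form of [gparity false], from which the subtype [evenG] inherits its structures. *)
Definition geven : pred G := fun a => [forall S, (a S != 0) ==> ~~ odd #|S|].

Lemma gevenP a : reflect (gparity _ _ false a) (geven a).
Proof.
apply: (iffP forallP) => H S; first by move/(implyP (H S)); case: odd.
by apply/implyP => /H ->.
Qed.

Lemma gparity0 e : gparity R K e 0.
Proof. by move=> S; rewrite ffunE eqxx. Qed.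

Lemma gparityD e a b : gparity _ _ e a -> gparity _ _ e b -> gparity _ _ e (a + b).
Proof.
move=> ae be S; rewrite ffunE; have [aS|/ae//] := eqVneq (a S) 0.
by rewrite aS add0r => /be.
Qed.

Lemma gparityN e a : gparity _ _ e a -> gparity _ _ e (- a).
Proof. by move=> ae S; rewrite ffunE oppr_eq0 => /ae. Qed.

Lemma gparityZ e k a : gparity _ _ e a -> gparity _ _ e (gscale k a).
Proof. by move=> ae S; rewrite ffunE mulf_eq0 negb_or => /andP[_ /ae]. Qed.

Lemma gparity_gsc k : gparity R K false (gsc k).
Proof.
by move=> S; rewrite ffunE; case: (eqVneq S _) => [->|_]; rewrite ?cards0 ?eqxx.
Qed.

Lemma gparity_ggen k : gparity R K true (ggen k).
Proof.
by move=> S; rewrite ffunE; case: (eqVneq S _) => [->|_]; rewrite ?cards1 ?eqxx.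
Qed.

(** The full Grassmann algebra is not commutative; on this subtype [ring] and the theory of
    commutative rings become available, and everything fed to [gln] and [gdet] comes from it. *)
Record evenG := EvenG { evval : G; evvalP : geven evval }.

HB.instance Definition _ := [isSub for evval].
HB.instance Definition _ := [Choice of evenG by <:].

Lemma geven_zmod_closed : zmod_closed geven.
Proof.
split=> [|a b /gevenP ae /gevenP be]; apply/gevenP; first exact: gparity0.
by apply: gparityD => //; exact: gparityN.
Qed.

HB.instance Definition _ := GRing.isZmodClosed.Build G geven geven_zmod_closed.
HB.instance Definition _ := [SubChoice_isSubZmodule of evenG by <:].

Implicit Types x y : evenG.

Lemma gevenM x y : geven (gmul (evval x) (evval y)).
Proof. by apply/gevenP/(@gparityM _ _ false false); exact/gevenP/evvalP. Qed.

Lemma geven_gsc k : geven (gsc k).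
Proof. exact/gevenP/gparity_gsc. Qed.

Definition emul x y := EvenG _ (gevenM x y).
Definition esc (k : R[i]) := EvenG _ (geven_gsc k).

Lemma emulA : associative emul.
Proof. by move=> x y z; apply: val_inj; exact: gmulA. Qed.
Lemma emulC : commutative emul.
Proof. by move=> x y; apply: val_inj; apply: gmul_even; exact/gevenP/evvalP. Qed.
Lemma emul1l : left_id (esc 1) emul.
Proof. by move=> x; apply: val_inj; exact: gmul1g. Qed.
Lemma emulDl : left_distributive emul +%R.
Proof. by move=> x y z; apply: val_inj; exact: gmulDl. Qed.
Lemma esc1_neq0 : esc 1 != 0.
Proof.
apply/eqP => /(congr1 evval)/ffunP/(_ finset.set0).
by rewrite !ffunE eqxx => /eqP; rewrite oner_eq0.
Qed.

HB.instance Definition _ :=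
  GRing.Zmodule_isComNzRing.Build evenG emulA emulC emul1l emulDl esc1_neq0.

Lemma evvalM x y : evval (x * y) = gmul (evval x) (evval y). Proof. by []. Qed.
Lemma evvalD x y : evval (x + y) = evval x + evval y. Proof. by []. Qed.
Lemma evval0 : evval 0 = 0. Proof. by []. Qed.
Lemma evval1 : evval 1 = gsc 1. Proof. by []. Qed.

Lemma evval_sum (I : Type) (r : seq I) (P : pred I) (F : I -> evenG) :
  evval (\sum_(i <- r | P i) F i) = \sum_(i <- r | P i) evval (F i).
Proof. exact: (big_morph _ evvalD evval0). Qed.

Lemma esc_is_zmod_morphism : zmod_morphism esc.
Proof.
move=> k l; apply: val_inj; apply/ffunP => S; rewrite !ffunE.
by case: eqP => _; rewrite ?subr0.
Qed.

Lemma esc_is_monoid_morphism : monoid_morphism esc.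
Proof.
split=> // k l; apply: val_inj; rewrite /= -gscaleE.
by apply/ffunP => S; rewrite !ffunE; case: eqP => _; rewrite ?mulr0.
Qed.

HB.instance Definition _ := GRing.isZmodMorphism.Build _ _ esc esc_is_zmod_morphism.
HB.instance Definition _ := GRing.isMonoidMorphism.Build _ _ esc esc_is_monoid_morphism.

Lemma gscale_evval k x : gscale k (evval x) = evval (esc k * x).
Proof. by rewrite gscaleE. Qed.

Lemma gpow_evval x n : gpow (evval x) n = evval (x ^+ n).
Proof. by elim: n => [|n IH] //=; rewrite exprS evvalM -IH. Qed.

Lemma gprod_evval (I : Type) (r : seq I) (F : I -> evenG) :
  gprod [seq evval (F i) | i <- r] = evval (\prod_(i <- r) F i).
Proof. by elim: r => [|i r IH]; rewrite ?big_nil// big_cons evvalM -IH. Qed.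

Definition ebody x : R[i] := gbody (evval x).

Lemma ebodyD x y : ebody (x + y) = ebody x + ebody y.
Proof. by rewrite /ebody /gbody evvalD ffunE. Qed.

Lemma ebodyM x y : ebody (x * y) = ebody x * ebody y.
Proof.
rewrite /ebody /gbody evvalM gmulE (bigD1 finset.set0) ?finset.sub0set//= big1.
  by rewrite addr0 gsign0l finset.setD0 mul1r.
by move=> A /andP[]; rewrite finset.subset0 => ->.
Qed.

Lemma ebody_esc k : ebody (esc k) = k.
Proof. by rewrite /ebody /gbody /= ffunE eqxx. Qed.

Lemma ebody_through k a (ae : geven a) : gthrough _ _ k a -> ebody (EvenG a ae) = 0.
Proof.
move=> ak; apply/eqP; apply: contrapT => /negP/ak.
by rewrite finset.in_set0.
Qed.

Section NilpotentSoul.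
Variables (x : evenG) (k : R[i]).
Hypotheses (K2 : (2 <= K)%N) (xk : ebody x = k) (k0 : k != 0).
Hypothesis nil3 : (x - esc k) ^+ 3 = 0.

Lemma gsoul_evval : gsoul (evval x) = evval (x - esc k).
Proof. by rewrite /gsoul -/(ebody x) xk. Qed.

Lemma soul_nilp (l : R[i]) n : (2 < n)%N -> (esc l * (x - esc k)) ^+ n = 0.
Proof. by move=> n3; rewrite exprMn -(subnK n3) !exprD nil3 !mulr0. Qed.

(** Only the terms of degree 1 and 2 survive the vanishing cube; [2 <= K] ensures that the truncated
    series contains both. *)
Lemma gln_evval : gln (evval x) = evval (esc (rC (ln (cabs k))) +
  (esc k^-1 * (x - esc k) - esc (2^-1) * (esc k^-1 * (x - esc k)) ^+ 2)).
Proof.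
rewrite /gln -/(ebody x) xk evvalD gsoul_evval; congr (_ + _).
under eq_bigr do rewrite gscale_evval gpow_evval gscale_evval.
rewrite -evval_sum; congr evval.
rewrite big_ltn ?ltnS 1?ltnW// big_ltn ?ltnS// big_nat_cond big1 ?addr0; last first.
  by move=> j /andP[/andP[j3 _] _]; rewrite soul_nilp ?mulr0.
rewrite expr1 sqrrN expr1n divr1 rmorph1 mul1r; congr (_ + _).
by rewrite exprS sqrrN expr1n mulr1 mulNr mul1r rmorphN mulNr.
Qed.

(** The geometric series cut after degree 2 leaves as its only error a multiple of the cube of the
    soul. *)
Lemma ginvG_evval : gmul (ginvG (evval x)) (evval x) = gsc 1.
Proof.
rewrite /ginvG -/(ebody x) xk gsoul_evval.
under eq_bigr do rewrite gscale_evval gpow_evval.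
rewrite -evval_sum gscale_evval -evvalM -evval1; congr evval.
rewrite big_ltn// big_ltn ?ltnS 1?ltnW// big_ltn ?ltnS// big_nat_cond big1 ?addr0; last first.
  by move=> j /andP[/andP[j3 _] _]; rewrite soul_nilp.
have kk : esc k^-1 * esc k = 1 by rewrite -rmorphM mulVf// rmorph1.
rewrite rmorphN /=; move: nil3 kk; move: (esc k) (esc k^-1) => u v nil vu.
have -> : v * ((- v * (x - u)) ^+ 0 + ((- v * (x - u)) ^+ 1 + (- v * (x - u)) ^+ 2)) * x =
   v * (1 - v * (x - u) + v ^+ 2 * (x - u) ^+ 2) * (u + (x - u)) by ring.
move: nil; move: (x - u) => t nil.
have -> : v * (1 - v * t + v ^+ 2 * t ^+ 2) * (u + t) =
  v * u + (1 - v * u) * v * t - (1 - v * u) * v ^+ 2 * t ^+ 2 + v ^+ 3 * t ^+ 3 by ring.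
by rewrite vu nil subrr !mul0r mulr0 !addr0 subr0.
Qed.

End NilpotentSoul.

End EvenPart.

(** * Conjugation, parity and support of monomials *)

Section Conjugation.
Variables (R : realType) (K : nat) (sigma : 'I_K -> 'I_K).
Implicit Types (a b : grass R K) (S : {set 'I_K}).

Lemma cconjE (z : R[i]) : cconj z = conjc z.
Proof. by case: z. Qed.

Definition gconj_monomial S : grass R K :=
  gprod [seq ggen (sigma k) | k <- rev (enum S)].

Lemma gconjE a S : gconj sigma a S =
  \sum_(T : {set 'I_K}) conjc (a T) * gconj_monomial T S.
Proof.
rewrite /gconj sum_ffunE; apply: eq_bigr => T _.
by rewrite ffunE cconjE.
Qed.

Lemma gconjD a b : gconj sigma (a + b) = gconj sigma a + gconj sigma b.
Proof.
apply/ffunP => S; rewrite [RHS]ffunE !gconjE -big_split; apply: eq_bigr => T _.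
by rewrite ffunE rmorphD mulrDl.
Qed.

Lemma gconjZ k a : gconj sigma (gscale k a) = gscale (conjc k) (gconj sigma a).
Proof.
apply/ffunP => S; rewrite [RHS]ffunE !gconjE mulr_sumr; apply: eq_bigr => T _.
by rewrite ffunE rmorphM mulrA.
Qed.

Lemma gconj_gsc (k : R[i]) : gconj sigma (gsc k) = gsc (conjc k).
Proof.
apply/ffunP => S; rewrite gconjE (bigD1 finset.set0)//= big1 ?addr0; last first.
  by move=> T T0; rewrite ffunE (negbTE T0) rmorph0 mul0r.
rewrite !ffunE eqxx /gconj_monomial enum_set0 /= ffunE.
by case: eqP; rewrite ?mulr1 ?mulr0.
Qed.

Lemma gparity_gprod (r : seq 'I_K) :
  gparity R K (odd (size r)) (gprod [seq ggen (sigma k) | k <- r]).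
Proof.
elim: r => [|k r IH] /=; first exact: gparity_gsc.
exact: (gparityM _ _ true _ _ _ (gparity_ggen _ _ _) IH).
Qed.

Lemma gthrough_gprod k (r : seq 'I_K) : k \in r ->
  gthrough R K (sigma k) (gprod [seq ggen (sigma k) | k <- r]).
Proof.
elim: r => [//|j r IH]; rewrite inE => /orP[/eqP<-|/IH kr] /=.
  apply: gthroughMl => S; rewrite ffunE.
  by case: (eqVneq S _) => [->|_]; rewrite ?inE ?eqxx.
exact: gthroughMr.
Qed.

Lemma gconj_neq0 a S : gconj sigma a S != 0 ->
  exists2 T, a T != 0 & gconj_monomial T S != 0.
Proof.
move=> aS; apply: contrapT => H; move/eqP: aS; apply.
rewrite gconjE big1// => T _; have [->|aT] := eqVneq (a T) 0.
  by rewrite rmorph0 mul0r.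
have [->|mT] := eqVneq (gconj_monomial T S) 0; first by rewrite mulr0.
by case: H; exists T.
Qed.

Lemma gparity_gconj e a : gparity _ _ e a -> gparity _ _ e (gconj sigma a).
Proof.
move=> ae S /gconj_neq0[T /ae <- /gparity_gprod ->].
by rewrite size_rev -cardE.
Qed.

Lemma gthrough_gconj k a : gthrough _ _ k a ->
  gthrough _ _ (sigma k) (gconj sigma a).
Proof.
move=> ak S /gconj_neq0[T /ak kT]; apply: gthrough_gprod.
by rewrite mem_rev mem_enum.
Qed.

End Conjugation.

(** * Wirtinger calculus *)

Section PathDerivative.
Variable R : realType.
Implicit Types (p q : R -> R[i]) (k l : R[i]).

(** Real and imaginary parts are differentiated at parameter 0, exactly as in [pdx] and [pdy]. *)
Definition pder p l := is_derive (0 : R) 1 (fun t => complex.Re (p t)) (complex.Re l)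
  /\ is_derive (0 : R) 1 (fun t => complex.Im (p t)) (complex.Im l).

Lemma is_derive_eqval (f : R -> R) (x a b : R) :
  is_derive x 1 f a -> a = b -> is_derive x 1 f b.
Proof. by move=> + <-. Qed.

Lemma is_derive_eps (f : R -> R) (l : R) :
  (forall e, 0 < e -> exists2 d, 0 < d &
     forall t, `|t| < d -> `|f t - f 0 - l * t| <= e * `|t|) ->
  is_derive (0 : R) 1 f l.
Proof.
move=> fl.
have cv : ((fun h : R => h^-1 *: ((f \o shift 0) (h *: (1 : R)) - f 0)) @ 0^' --> l)%classic.
  apply/(@cvgrPdist_le _ R^o _ (dnbhs (0 : R^o)) (dnbhs_filter _)) => e e0.
  rewrite near_withinE; have [d d0 H] := fl _ e0.
  apply/nbhs_ballP; exists d => // h; rewrite /ball /= sub0r normrN => /H hd h0.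
  rewrite addr0 -[h *: 1]/(h * 1) mulr1 -[_ *: _]/(_ * _).
  have -> : l - h^-1 * (f h - f 0) = - h^-1 * (f h - f 0 - l * h) by field.
  by rewrite normrM normrN normfV ler_pdivrMl ?normr_gt0// [`|h| * e]mulrC.
by split; [apply/cvg_ex; exists l|apply/cvg_lim].
Qed.

Lemma pder_cst k : pder (fun=> k) 0.
Proof. by split; exact: is_derive_cst. Qed.

Lemma pderD p q k l : pder p k -> pder q l -> pder (fun t => p t + q t) (k + l).
Proof.
move=> [p1 p2] [q1 q2]; split.
- rewrite cReD (_ : (fun t => _) = fun t => complex.Re (p t) + complex.Re (q t)).
    exact: is_deriveD.
  by apply/funext => t; rewrite cReD.
- rewrite cImD (_ : (fun t => _) = fun t => complex.Im (p t) + complex.Im (q t)).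
    exact: is_deriveD.
  by apply/funext => t; rewrite cImD.
Qed.

Lemma pder_conj p k : pder p k -> pder (fun t => conjc (p t)) (conjc k).
Proof.
move=> [p1 p2]; split.
- rewrite (_ : (fun t => _) = fun t => complex.Re (p t)); last first.
    by apply/funext => t; case: (p t).
  by case: k p1 p2.
- rewrite (_ : (fun t => _) = fun t => - complex.Im (p t)); last first.
    by apply/funext => t; case: (p t).
  by case: k p1 p2 => a b p1 p2; exact: is_deriveN.
Qed.

Lemma is_derive_mul (f g : R -> R) (x a b : R) : is_derive x 1 f a ->
  is_derive x 1 g b -> is_derive x 1 (fun t => f t * g t) (f x * b + g x * a).
Proof. by move=> fa gb; exact: is_deriveM. Qed.

Lemma is_derive_add (f g : R -> R) (x a b : R) : is_derive x 1 f a ->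
  is_derive x 1 g b -> is_derive x 1 (fun t => f t + g t) (a + b).
Proof. by move=> fa gb; exact: is_deriveD. Qed.

Lemma is_derive_sub (f g : R -> R) (x a b : R) : is_derive x 1 f a ->
  is_derive x 1 g b -> is_derive x 1 (fun t => f t - g t) (a - b).
Proof. by move=> fa gb; exact: is_deriveB. Qed.

Lemma is_derive_opp (f : R -> R) (x a : R) : is_derive x 1 f a ->
  is_derive x 1 (fun t => - f t) (- a).
Proof. by move=> fa; exact: is_deriveN. Qed.

Lemma pderM p q k l : pder p k -> pder q l ->
  pder (fun t => p t * q t) (k * q 0 + p 0 * l).
Proof.
move=> [p1 p2] [q1 q2]; split.
- rewrite (_ : (fun t => _) = fun t => complex.Re (p t) * complex.Re (q t) -
    complex.Im (p t) * complex.Im (q t)); last by apply/funext => t; rewrite cReM.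
  apply: (is_derive_eqval _ _ _ _
    (is_derive_sub _ _ _ _ _ (is_derive_mul _ _ _ _ _ p1 q1) (is_derive_mul _ _ _ _ _ p2 q2))).
  by rewrite cReD !cReM; ring.
- rewrite (_ : (fun t => _) = fun t => complex.Re (p t) * complex.Im (q t) +
    complex.Im (p t) * complex.Re (q t)); last by apply/funext => t; rewrite cImM.
  apply: (is_derive_eqval _ _ _ _
    (is_derive_add _ _ _ _ _ (is_derive_mul _ _ _ _ _ p1 q2) (is_derive_mul _ _ _ _ _ p2 q1))).
  by rewrite cImD !cImM; ring.
Qed.

(** The squared modulus, polynomial in the two parts and hence differentiable even where [cabs] is
    not. *)
Definition sqnorm (z : R[i]) := complex.Re z * complex.Re z + complex.Im z * complex.Im z.

Lemma sqnorm_gt0 z : z != 0 -> 0 < sqnorm z.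
Proof.
case: z => a b; rewrite eq_complex /= negb_and /sqnorm /= -!expr2 => ab.
by case/orP: ab => ab; [rewrite ltr_wpDr|rewrite ltr_wpDl];
   rewrite ?sqr_ge0// lt_def sqrf_eq0 ab sqr_ge0.
Qed.

Lemma is_derive_sqnorm p k : pder p k ->
  is_derive (0 : R) 1 (fun t => sqnorm (p t))
    (2 * (complex.Re (p 0) * complex.Re k + complex.Im (p 0) * complex.Im k)).
Proof.
move=> [p1 p2]; apply: (is_derive_eqval _ _ _ _
  (is_derive_add _ _ _ _ _ (is_derive_mul _ _ _ _ _ p1 p1) (is_derive_mul _ _ _ _ _ p2 p2))).
by ring.
Qed.

Lemma pderV p k : p 0 != 0 -> pder p k -> pder (fun t => (p t)^-1) (- k / p 0 ^+ 2).
Proof.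
move=> p0 pk; have n0 := sqnorm_gt0 _ p0; have nk := is_derive_sqnorm _ _ pk.
have [p1 p2] := pk.
have iV : is_derive (0 : R) 1 (fun t => (sqnorm (p t))^-1)
    (- (sqnorm (p 0)) ^- 2 * (2 * (complex.Re (p 0) * complex.Re k + complex.Im (p 0) * complex.Im k))).
  by apply: is_deriveV; rewrite gt_eqF.
have nE : sqnorm (p 0) != 0 by rewrite gt_eqF.
have wE : (p 0)^-1 = Complex (complex.Re (p 0) / sqnorm (p 0)) (- complex.Im (p 0) / sqnorm (p 0)).
  by case: (p 0) => a b; rewrite /sqnorm -!expr2 /= mulNr.
rewrite expr2 invfM wE; move: nE {n0 nk p0 wE}; set n := sqnorm (p 0) => nE.
split.
- rewrite (_ : (fun t => _) = fun t => complex.Re (p t) * (sqnorm (p t))^-1); last first.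
    by apply/funext => t; case: (p t) => a b; rewrite /sqnorm /= !expr2.
  apply: (is_derive_eqval _ _ _ _ (is_derive_mul _ _ _ _ _ p1 iV)).
  have nn : n = complex.Re (p 0) * complex.Re (p 0) + complex.Im (p 0) * complex.Im (p 0) by [].
  rewrite -/n !(cReM, cImM) /=; case: (k) => c d /=.
  move: nn nE; move: n (complex.Re (p 0)) (complex.Im (p 0)) => n a b -> nE.
  by field; rewrite nE.
- rewrite (_ : (fun t => _) = fun t => - (complex.Im (p t) * (sqnorm (p t))^-1)); last first.
    by apply/funext => t; case: (p t) => a b; rewrite /sqnorm /= !expr2.
  apply: (is_derive_eqval _ _ _ _ (is_derive_opp _ _ _ (is_derive_mul _ _ _ _ _ p2 iV))).
  have nn : n = complex.Re (p 0) * complex.Re (p 0) + complex.Im (p 0) * complex.Im (p 0) by [].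
  rewrite -/n !(cReM, cImM) /=; case: (k) => c d /=.
  move: nn nE; move: n (complex.Re (p 0)) (complex.Im (p 0)) => n a b -> nE.
  by field; rewrite nE.
Qed.

Lemma pder_ln p k : p 0 != 0 -> pder p k ->
  pder (fun t => rC (ln (cabs (p t)))) (rC (complex.Re (k / p 0))).
Proof.
move=> p0 pk; split; last exact: is_derive_cst.
have n0 := sqnorm_gt0 _ p0; have nk := is_derive_sqnorm _ _ pk.
rewrite (_ : (fun t => _) = fun t => ln (Num.sqrt (sqnorm (p t)))); last first.
  by apply/funext => t; rewrite /cabs /sqnorm !expr2.
have s0 : 0 < Num.sqrt (sqnorm (p 0)) by rewrite sqrtr_gt0.
have d1 := @is_derive1_comp R Num.sqrt (fun t => sqnorm (p t)) 0 _ _ (is_derive1_sqrt n0) nk.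
have d2 := @is_derive1_comp R (@ln R) (Num.sqrt \o (fun t => sqnorm (p t))) 0 _ _ (is_derive1_ln s0) d1.
apply: (is_derive_eqval _ _ _ _ d2) => /=.
rewrite cReM Re_inv Im_inv.
have ss : Num.sqrt (sqnorm (p 0)) ^+ 2 = complex.Re (p 0) ^+ 2 + complex.Im (p 0) ^+ 2.
  by rewrite sqr_sqrtr ?ltW// /sqnorm !expr2.
rewrite -ss; move: s0; move: (Num.sqrt _) => s s0.
by field; rewrite gt_eqF.
Qed.

End PathDerivative.

Section Wirtinger.
Variable R : realType.
Implicit Types (f g : R[i] -> R[i]) (z w a b c d : R[i]).

(** A relation rather than the two functions [dplus] and [dminus]: these are total and by themselves
    carry no information on differentiability, whereas sums, products and inverses require the
    partial derivatives to exist. *)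
Definition wder f z a b := exists px py,
  [/\ pder _ (fun t => f (z + rC t)) px, pder _ (fun t => f (z + Complex 0 t)) py,
      a = (rC 2)^-1 * (px - ci * py) & b = (rC 2)^-1 * (px + ci * py)].

Lemma pder_derive1 (p : R -> R[i]) k : pder _ p k ->
  Complex (derive1 (fun t => complex.Re (p t)) 0) (derive1 (fun t => complex.Im (p t)) 0) = k.
Proof. by move=> [p1 p2]; rewrite !derive1E !derive_val; case: k p1 p2. Qed.

Lemma wder_dplus f z a b : wder f z a b -> dplus f z = a.
Proof.
by move=> [px [py [hx hy -> _]]]; rewrite /dplus /pdx /pdy (pder_derive1 _ _ hx) (pder_derive1 _ _ hy).
Qed.

Lemma wder_dminus f z a b : wder f z a b -> dminus f z = b.
Proof.
by move=> [px [py [hx hy _ ->]]]; rewrite /dminus /pdx /pdy (pder_derive1 _ _ hx) (pder_derive1 _ _ hy).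
Qed.

Lemma rC0 : rC 0 = 0 :> R[i]. Proof. by []. Qed.
Lemma Complex00 : Complex 0 0 = 0 :> R[i]. Proof. by []. Qed.

Lemma conjD z w : conjc (z + w) = conjc z + conjc w. Proof. exact: rmorphD. Qed.
Lemma conjN z : conjc (- z) = - conjc z. Proof. exact: rmorphN. Qed.
Lemma conjM z w : conjc (z * w) = conjc z * conjc w. Proof. exact: rmorphM. Qed.
Lemma conjV z : conjc z^-1 = (conjc z)^-1. Proof. exact: fmorphV. Qed.
Lemma conj_rC (x : R) : conjc (rC x) = rC x.
Proof. by apply/eqP; rewrite eq_complex /= oppr0 !eqxx. Qed.
Lemma conj_ci : conjc ci = - ci :> R[i].
Proof. by apply/eqP; rewrite eq_complex /= oppr0 !eqxx. Qed.
Lemma ci2 : ci * ci = -1 :> R[i].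
Proof. by apply/eqP; rewrite eq_complex /= !(mul0r, mulr0, mul1r) sub0r oppr0 addr0 !eqxx. Qed.

Lemma wder_cst k z : wder (fun=> k) z 0 0.
Proof.
by exists 0, 0; split; rewrite ?mulr0 ?subr0 ?addr0 ?mulr0//; exact: pder_cst.
Qed.

Lemma wderD f g z a b c d : wder f z a b -> wder g z c d ->
  wder (fun w => f w + g w) z (a + c) (b + d).
Proof.
move=> [px [py [hx hy -> ->]]] [qx [qy [kx ky -> ->]]].
by exists (px + qx), (py + qy); split; [exact: pderD|exact: pderD|ring|ring].
Qed.

Lemma wderM f g z a b c d : wder f z a b -> wder g z c d ->
  wder (fun w => f w * g w) z (a * g z + f z * c) (b * g z + f z * d).
Proof.
move=> [px [py [hx hy -> ->]]] [qx [qy [kx ky -> ->]]].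
exists (px * g z + f z * qx), (py * g z + f z * qy); split; [| |ring|ring].
- by have := pderM _ _ _ _ _ hx kx; rewrite rC0 addr0.
- by have := pderM _ _ _ _ _ hy ky; rewrite Complex00 addr0.
Qed.

Lemma wderZ k f z a b : wder f z a b -> wder (fun w => k * f w) z (k * a) (k * b).
Proof. by move=> /(wderM _ _ _ _ _ _ _ (wder_cst k z)); rewrite !mul0r !add0r. Qed.

Lemma wder_conj f z a b : wder f z a b ->
  wder (fun w => conjc (f w)) z (conjc b) (conjc a).
Proof.
move=> [px [py [hx hy -> ->]]]; exists (conjc px), (conjc py).
split; [exact: pder_conj|exact: pder_conj| |];
  by rewrite !(conjM, conjV, conjD, conjN) conj_rC conj_ci; ring.
Qed.

Lemma wderV f z a b : f z != 0 -> wder f z a b ->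
  wder (fun w => (f w)^-1) z (- a / f z ^+ 2) (- b / f z ^+ 2).
Proof.
move=> fz [px [py [hx hy -> ->]]].
exists (- px / f z ^+ 2), (- py / f z ^+ 2); split; [| |ring|ring].
- by have := pderV _ _ _ _ hx; rewrite rC0 addr0; apply.
- by have := pderV _ _ _ _ hy; rewrite Complex00 addr0; apply.
Qed.

Lemma rC_Re z : rC (complex.Re z) = (rC 2)^-1 * (z + conjc z).
Proof.
case: z => x y; rewrite /rC; simpc; rewrite /= expr0n addr0.
by congr Complex; field.
Qed.

(** Formally [ln |f|] is half the sum of [ln f] and its conjugate, and conjugation exchanges the two
    Wirtinger derivatives. *)
Lemma wder_ln f z a b : f z != 0 -> wder f z a b ->
  wder (fun w => rC (ln (cabs (f w)))) z
    ((rC 2)^-1 * (a / f z + conjc (b / f z))) ((rC 2)^-1 * (b / f z + conjc (a / f z))).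
Proof.
move=> fz [px [py [hx hy -> ->]]].
exists (rC (complex.Re (px / f z))), (rC (complex.Re (py / f z))).
split; last 2 first.
- by rewrite !rC_Re !(conjM, conjV, conjD, conjN) !conj_rC conj_ci; ring.
- by rewrite !rC_Re !(conjM, conjV, conjD, conjN) !conj_rC conj_ci; ring.
- by have := pder_ln _ _ _ _ hx; rewrite rC0 addr0; apply.
- by have := pder_ln _ _ _ _ hy; rewrite Complex00 addr0; apply.
Qed.

Lemma Re_mulrC z (t : R) : complex.Re (z * rC t) = complex.Re z * t.
Proof. by rewrite cReM /= mulr0 subr0. Qed.

Lemma Im_mulrC z (t : R) : complex.Im (z * rC t) = complex.Im z * t.
Proof. by rewrite cImM /= mulr0 add0r. Qed.

(** The derivative along a unit direction [u] is [l * u]. Taking [u = 1] and [u = i] gives the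
    Cauchy-Riemann equations, that is, a vanishing [d_-]. *)
Lemma cder_wder f z l : cder _ f z l -> wder f z l 0.
Proof.
move=> fl; have path (u : R[i]) : cabs u = 1 -> pder _ (fun t => f (z + u * rC t)) (l * u).
  move=> u1; have key e : 0 < e -> exists2 d, 0 < d & forall t, `|t| < d ->
      cabs (f (z + u * rC t) - f (z + u * rC 0) - (l * u) * rC t) <= e * `|t|.
    move=> /fl[d d0 H]; exists d => // t td; rewrite rC0 mulr0 addr0 -mulrA.
    have tE : cabs (u * rC t) = `|t| by rewrite cabsM u1 mul1r cabs_rC.
    by rewrite -tE; apply: H; rewrite tE.
  split; apply: is_derive_eps => e /key[d d0 H]; exists d => // t /H; apply: le_trans.
  - by rewrite -Re_mulrC -!cReB; exact: ler_Re_cabs.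
  - by rewrite -Im_mulrC -!cImB; exact: ler_Im_cabs.
exists l, (l * ci); split.
- have := path 1; rewrite mulr1 => /(_ _).
  rewrite (_ : (fun t => f (z + 1 * rC t)) = fun t => f (z + rC t)); last first.
    by apply/funext => t; rewrite mul1r.
  by apply; rewrite /cabs /= expr1n expr0n addr0 sqrtr1.
- have := path ci (cabs_ci _).
  rewrite (_ : (fun t => f (z + ci * rC t)) = fun t => f (z + Complex 0 t))//.
  by apply/funext => t; congr (f (z + _)); rewrite /ci /rC; simpc.
- have -> : l - ci * (l * ci) = l * (1 - ci * ci) by ring.
  rewrite ci2 opprK mulrC -mulrA; have -> : (1 + 1) * (rC 2)^-1 = 1 :> R[i].
    by rewrite /rC; simpc; rewrite /= expr0n addr0; congr Complex; field.
  by rewrite mulr1.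
- have -> : l + ci * (l * ci) = l * (1 + ci * ci) by ring.
  by rewrite ci2 subrr !mulr0.
Qed.

(** * A class of functions with commuting derivatives *)

Section Local.
Variable U : R[i] -> Prop.
Hypothesis Uo : copen U.

Lemma near_line (u : R[i]) z (Q : R[i] -> Prop) : cabs u = 1 -> U z ->
  (forall w, U w -> Q w) -> (\forall t \near (0 : R), Q (z + u * rC t))%classic.
Proof.
move=> u1 Uz UQ; have [r [r0 H]] := Uo _ Uz.
apply/nbhs_ballP; exists r => // t; rewrite /ball /= sub0r normrN => tr.
apply: UQ; apply: H; have -> : z + u * rC t - z = u * rC t by ring.
by rewrite cabsM u1 mul1r cabs_rC.
Qed.

Lemma line_x f z : (fun t => f (z + rC t)) = fun t => f (z + 1 * rC t).
Proof. by apply/funext => t; rewrite mul1r. Qed.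

Lemma line_y f z : (fun t => f (z + Complex 0 t)) = fun t => f (z + ci * rC t).
Proof. by apply/funext => t; congr (f (_ + _)); rewrite /ci /rC; simpc. Qed.

Lemma cabs1 : cabs (1 : R[i]) = 1.
Proof. by rewrite /cabs /= expr1n expr0n addr0 sqrtr1. Qed.

Lemma pder_ext (u : R[i]) f g z k : cabs u = 1 -> U z -> (forall w, U w -> f w = g w) ->
  pder _ (fun t => f (z + u * rC t)) k -> pder _ (fun t => g (z + u * rC t)) k.
Proof.
move=> u1 Uz fg [h1 h2]; split.
- apply: near_eq_is_derive h1.
  by apply: (near_line u z (fun w => complex.Re (f w) = complex.Re (g w))) => // w /fg ->.
- apply: near_eq_is_derive h2.
  by apply: (near_line u z (fun w => complex.Im (f w) = complex.Im (g w))) => // w /fg ->.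
Qed.

Lemma wder_ext f g z a b : U z -> (forall w, U w -> f w = g w) ->
  wder f z a b -> wder g z a b.
Proof.
move=> Uz fg [px [py [hx hy -> ->]]]; exists px, py; split => //.
- by move: hx; rewrite !line_x; exact: pder_ext cabs1 Uz fg.
- by move: hy; rewrite !line_y; exact: pder_ext (cabs_ci _) Uz fg.
Qed.

Definition wdiff f z := wder f z (dplus f z) (dminus f z).

Lemma wder_wdiff f z a b : wder f z a b -> wdiff f z.
Proof. by move=> h; rewrite /wdiff (wder_dplus _ _ _ _ h) (wder_dminus _ _ _ _ h). Qed.

(* The closure rules make the commutation of the two derivatives provable by
   structural induction. *)
Inductive sm : (R[i] -> R[i]) -> Prop :=
| sm_holo f : holo_on U f -> sm f
| sm_conj f : sm f -> sm (fun z => conjc (f z))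
| sm_add f g : sm f -> sm g -> sm (fun z => f z + g z)
| sm_mul f g : sm f -> sm g -> sm (fun z => f z * g z)
| sm_inv f : (forall z, U z -> f z != 0) -> sm f -> sm (fun z => (f z)^-1)
| sm_ln f : (forall z, U z -> f z != 0) -> sm f -> sm (fun z => rC (ln (cabs (f z))))
| sm_ext f g : (forall z, U z -> f z = g z) -> sm f -> sm g.

Lemma holo_cst k : holo_on U (fun=> k).
Proof. by apply/holo_onP => z _; exists 0; exact: cder_cst. Qed.

Lemma sm_cst k : sm (fun=> k).
Proof. exact/sm_holo/holo_cst. Qed.

Lemma holo_wder f : holo_on U f -> forall z, U z -> wder f z (dplus f z) 0.
Proof.
move=> /holo_onP fU z /fU[l /cder_wder fl].
by rewrite (wder_dplus _ _ _ _ fl).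
Qed.

Lemma holo_dplus f : holo_on U f -> holo_on U (dplus f).
Proof.
move=> fU; apply/holo_onP => z Uz.
have [f' [d d0 [ff' [l f'l]]]] := holo_derivative _ _ _ _ Uo fU Uz.
exists l; apply: cder_ext d0 _ f'l => w /ff'/cder_wder fw.
by rewrite (wder_dplus _ _ _ _ fw).
Qed.

(** Differentiability and closure under both derivatives are proved together, since each rule
    expresses the derivatives of a compound through those of its parts. Only the base case needs
    analysis: the derivative of a holomorphic function is holomorphic. *)
Lemma smP f : sm f ->
  [/\ forall z, U z -> wdiff f z, sm (dplus f) & sm (dminus f)].
Proof.
have build g p m : (forall z, U z -> wder g z (p z) (m z)) -> sm p -> sm m ->
    [/\ forall z, U z -> wdiff g z, sm (dplus g) & sm (dminus g)].
  move=> gab sp sq; split => [z /gab/wder_wdiff//| |].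
  - by apply: sm_ext sp => z /gab h; rewrite (wder_dplus _ _ _ _ h).
  - by apply: sm_ext sq => z /gab h; rewrite (wder_dminus _ _ _ _ h).
elim=> {f}[f fU|f sf [h1 h2 h3]|f g sf [h1 h2 h3] sg [k1 k2 k3]
  |f g sf [h1 h2 h3] sg [k1 k2 k3]|f f0 sf [h1 h2 h3]|f f0 sf [h1 h2 h3]
  |f g fg sf [h1 h2 h3]].
- apply: (build _ (dplus f) (fun=> 0)); last exact: sm_cst.
    exact: holo_wder.
  exact/sm_holo/holo_dplus.
- apply: (build _ (fun z => conjc (dminus f z)) (fun z => conjc (dplus f z))).
  + by move=> z /h1; exact: wder_conj.
  + exact: sm_conj.
  + exact: sm_conj.
- apply: (build _ (fun z => dplus f z + dplus g z) (fun z => dminus f z + dminus g z)).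
  + by move=> z Uz; apply: wderD; [exact: h1|exact: k1].
  + exact: sm_add.
  + exact: sm_add.
- apply: (build _ (fun z => dplus f z * g z + f z * dplus g z)
    (fun z => dminus f z * g z + f z * dminus g z)).
  + by move=> z Uz; apply: wderM; [exact: h1|exact: k1].
  + by apply: sm_add; exact: sm_mul.
  + by apply: sm_add; exact: sm_mul.
(* The derivative of the inverse is put in a form built from constants, products and inverses, the
   rules that [sm] provides. *)
- have sV : sm (fun z => (-1) * ((f z)^-1 * (f z)^-1)).
    by apply: sm_mul; [exact: sm_cst|apply: sm_mul; exact: sm_inv].
  have h z : U z -> wder (fun w => (f w)^-1) z
      (dplus f z * (-1 * ((f z)^-1 * (f z)^-1))) (dminus f z * (-1 * ((f z)^-1 * (f z)^-1))).
    move=> Uz; have := wderV _ _ _ _ (f0 _ Uz) (h1 _ Uz).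
    by rewrite expr2 invfM !mulN1r !mulrN !mulNr.
  by apply: (build _ _ _ h); exact: sm_mul.
- apply: (build _ (fun z => (rC 2)^-1 * (dplus f z * (f z)^-1 + conjc (dminus f z * (f z)^-1)))
    (fun z => (rC 2)^-1 * (dminus f z * (f z)^-1 + conjc (dplus f z * (f z)^-1)))).
  + by move=> z Uz; apply: wder_ln; [exact: f0|exact: h1].
  + apply: sm_mul; first exact: sm_cst.
    by apply: sm_add; [|apply: sm_conj]; apply: sm_mul => //; exact: sm_inv.
  + apply: sm_mul; first exact: sm_cst.
    by apply: sm_add; [|apply: sm_conj]; apply: sm_mul => //; exact: sm_inv.
- apply: (build _ (dplus f) (dminus f)) => // z Uz.
  by apply: wder_ext (h1 _ Uz).
Qed.

Lemma sm_wdiff f z : sm f -> U z -> wdiff f z.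
Proof. by move=> /smP[h _ _] /h. Qed.
Lemma sm_dplus f : sm f -> sm (dplus f). Proof. by case/smP. Qed.
Lemma sm_dminus f : sm f -> sm (dminus f). Proof. by case/smP. Qed.

Lemma dplus_ext f g z : U z -> (forall w, U w -> f w = g w) -> sm f ->
  dplus f z = dplus g z.
Proof.
by move=> Uz fg sf; rewrite (wder_dplus _ _ _ _ (wder_ext _ _ _ _ _ Uz fg (sm_wdiff _ _ sf Uz))).
Qed.

Lemma dminus_ext f g z : U z -> (forall w, U w -> f w = g w) -> sm f ->
  dminus f z = dminus g z.
Proof.
by move=> Uz fg sf; rewrite (wder_dminus _ _ _ _ (wder_ext _ _ _ _ _ Uz fg (sm_wdiff _ _ sf Uz))).
Qed.

Lemma dplus_dminusC f p m z a b c c' : sm f ->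
  (forall w, U w -> wder f w (p w) (m w)) -> U z ->
  wder m z c a -> wder p z b c' -> c = c' ->
  dplus (dminus f) z = dminus (dplus f) z.
Proof.
move=> sf fw Uz mz pz cc'.
have -> : dplus (dminus f) z = c.
  rewrite (@dplus_ext _ m)//; [exact: wder_dplus mz| |exact: sm_dminus].
  by move=> w /fw/wder_dminus.
rewrite cc' (@dminus_ext _ p)//; [exact/esym/(wder_dminus _ _ _ _ pz)| |exact: sm_dplus].
by move=> w /fw/wder_dplus.
Qed.

Lemma wder_inv f z : U z -> f z != 0 -> wdiff f z -> wder (fun w => (f w)^-1) z
  (- (dplus f z * ((f z)^-1 * (f z)^-1))) (- (dminus f z * ((f z)^-1 * (f z)^-1))).
Proof.
move=> Uz fz fd; have := wderV _ _ _ _ fz fd.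
by rewrite expr2 invfM !mulNr.
Qed.

(** In the base case both orders give 0. In the other cases both mixed derivatives are explicit in
    those of the parts, and agree by the induction hypothesis and commutativity. *)
Lemma sm_comm f : sm f -> forall z, U z -> dplus (dminus f) z = dminus (dplus f) z.
Proof.
elim=> {f}[f fU|f sf IH|f g sf IHf sg IHg|f g sf IHf sg IHg
  |f f0 sf IH|f f0 sf IH|f g fg sf IH] z Uz.
- apply: (dplus_dminusC f (dplus f) (fun=> 0) z _ _ _ _ _ _ Uz (wder_cst _ _)
    (holo_wder _ (holo_dplus _ fU) _ Uz) erefl); first exact: sm_holo.
  exact: holo_wder.
- have [h1 h2 h3] := smP _ sf.
  apply: (dplus_dminusC _ _ _ z _ _ _ _ _ (fun w Uw => wder_conj _ _ _ _ (h1 w Uw)) Uz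
    (wder_conj _ _ _ _ (sm_wdiff _ _ h2 Uz)) (wder_conj _ _ _ _ (sm_wdiff _ _ h3 Uz))).
    exact: sm_conj.
  by rewrite IH.
- have [h1 h2 h3] := smP _ sf; have [k1 k2 k3] := smP _ sg.
  apply: (dplus_dminusC _ _ _ z _ _ _ _ _
    (fun w Uw => wderD _ _ _ _ _ _ _ (h1 w Uw) (k1 w Uw)) Uz
    (wderD _ _ _ _ _ _ _ (sm_wdiff _ _ h3 Uz) (sm_wdiff _ _ k3 Uz))
    (wderD _ _ _ _ _ _ _ (sm_wdiff _ _ h2 Uz) (sm_wdiff _ _ k2 Uz))).
    exact: sm_add.
  by rewrite IHf// IHg.
- have [h1 h2 h3] := smP _ sf; have [k1 k2 k3] := smP _ sg.
  apply: (dplus_dminusC _ _ _ z _ _ _ _ _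
    (fun w Uw => wderM _ _ _ _ _ _ _ (h1 w Uw) (k1 w Uw)) Uz
    (wderD _ _ _ _ _ _ _
      (wderM _ _ _ _ _ _ _ (sm_wdiff _ _ h3 Uz) (k1 _ Uz))
      (wderM _ _ _ _ _ _ _ (h1 _ Uz) (sm_wdiff _ _ k3 Uz)))
    (wderD _ _ _ _ _ _ _
      (wderM _ _ _ _ _ _ _ (sm_wdiff _ _ h2 Uz) (k1 _ Uz))
      (wderM _ _ _ _ _ _ _ (h1 _ Uz) (sm_wdiff _ _ k2 Uz)))).
    exact: sm_mul.
  rewrite IHf// IHg//; move: (dminus (dplus f) z) (dminus (dplus g) z) => u v.
  by ring.
- have [h1 h2 h3] := smP _ sf.
  have Vw w Uw := wder_inv f w Uw (f0 w Uw) (h1 w Uw).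
  have nw w Uw := wderZ (-1) _ _ _ _ (wderM _ _ _ _ _ _ _ (Vw w Uw) (Vw w Uw)).
  apply: (dplus_dminusC _ (fun w => dplus f w * (-1 * ((f w)^-1 * (f w)^-1)))
    (fun w => dminus f w * (-1 * ((f w)^-1 * (f w)^-1))) z _ _ _ _ _ _ Uz
    (wderM _ _ _ _ _ _ _ (sm_wdiff _ _ h3 Uz) (nw z Uz))
    (wderM _ _ _ _ _ _ _ (sm_wdiff _ _ h2 Uz) (nw z Uz))).
  + exact: sm_inv.
  + by move=> w /Vw; rewrite !mulN1r !mulrN.
  + by rewrite IH//; move: (dminus (dplus f) z) => u; ring.
- have [h1 h2 h3] := smP _ sf.
  have Vw w Uw := wder_inv f w Uw (f0 w Uw) (h1 w Uw).
  have mw := wderM _ _ _ _ _ _ _ (sm_wdiff _ _ h3 Uz) (Vw z Uz).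
  have pw := wderM _ _ _ _ _ _ _ (sm_wdiff _ _ h2 Uz) (Vw z Uz).
  apply: (dplus_dminusC _ _ _ z _ _ _ _ _
    (fun w Uw => wder_ln f w _ _ (f0 w Uw) (h1 w Uw)) Uz
    (wderZ (rC 2)^-1 _ _ _ _ (wderD _ _ _ _ _ _ _ mw (wder_conj _ _ _ _ pw)))
    (wderZ (rC 2)^-1 _ _ _ _ (wderD _ _ _ _ _ _ _ pw (wder_conj _ _ _ _ mw)))).
    exact: sm_ln.
  have sw : dplus f z * - (dminus f z * ((f z)^-1 * (f z)^-1)) =
            dminus f z * - (dplus f z * ((f z)^-1 * (f z)^-1)) by ring.
  by rewrite IH// sw.
- have [h1 h2 h3] := smP _ sf.
  apply: (dplus_dminusC _ _ _ z _ _ _ _ _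
    (fun w Uw => wder_ext _ _ _ _ _ Uw fg (h1 w Uw)) Uz
    (sm_wdiff _ _ h3 Uz) (sm_wdiff _ _ h2 Uz)); first exact: sm_ext sf.
  exact: IH.
Qed.

End Local.
End Wirtinger.

(** * Logarithms of shifted functions *)

Section NilpotentShift.
Variables (A : comNzRingType) (p e q f k a b c : A).
Hypotheses (pp : p * p = 0) (pe : p * e = 0) (ee : e * e = 0).
Hypotheses (qq : q * q = 0) (qf : q * f = 0) (ff : f * f = 0).

(** The shape of [J T(g)]: [e] and [f] are the two increments, [p] and [q] their derivatives, [k] is
    the value of the function, and [a], [b], [c] are its two first derivatives and its mixed one,
    divided by [k]. *)
Let x := (1 + p) * (1 + q) * (k + k * a * e + k * b * f + k * c * (e * f)).
Let u := p + a * e.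
Let w := q + b * f.
Let d := (c - a * b) * (e * f).
Let y := u + w + u * w + d.

Let uu : u * u = 0.
Proof.
have -> : u * u = p * p + (p * e) * (a + a) + (e * e) * a * a by rewrite /u; ring.
by rewrite pp pe ee !mul0r !addr0.
Qed.

Let ww : w * w = 0.
Proof.
have -> : w * w = q * q + (q * f) * (b + b) + (f * f) * b * b by rewrite /w; ring.
by rewrite qq qf ff !mul0r !addr0.
Qed.

Let ud : u * d = 0.
Proof.
have -> : u * d = (p * e + (e * e) * a) * (c - a * b) * f by rewrite /u /d; ring.
by rewrite pe ee mul0r addr0 !mul0r.
Qed.

Let wd : w * d = 0.
Proof.
have -> : w * d = (q * f + (f * f) * b) * (c - a * b) * e by rewrite /w /d; ring.
by rewrite qf ff mul0r addr0 !mul0r.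
Qed.

Let dd : d * d = 0.
Proof.
have -> : d * d = (e * e) * ((c - a * b) ^+ 2 * (f * f)) by rewrite /d; ring.
by rewrite ee mul0r.
Qed.

(* The soul is k ((1 + u) (1 + w) + d - 1), where u, w and d square to zero and
   u d = w d = 0, so its cube vanishes and its logarithm is ln k + u + w + d. *)
Lemma shift_soul : x - k = k * y.
Proof.
have -> : x - k = k * y + k * ((p * e) * (a * (1 + q) * (1 + b * f) + (c - a * b) * (f + q * f)) +
  (q * f) * (b * (1 + p) * (1 + a * e) + (c - a * b) * e) - (p * e) * (q * f) * (a * b)).
  by rewrite /x /y /u /w /d; ring.
by rewrite pe qf !mul0r subr0 addr0 mulr0 addr0.
Qed.

Let y2 : y ^+ 2 = 2%:R * (u * w).
Proof.
have -> : y ^+ 2 = 2%:R * (u * w) + u * u * (1 + 2%:R * w) + w * w * (1 + 2%:R * u + u * u) +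
   u * d * (2%:R + 2%:R * w) + 2%:R * (w * d) + d * d by rewrite /y; ring.
by rewrite uu ww ud wd dd !mul0r mulr0 !addr0.
Qed.

Lemma shift_nil3 : (x - k) ^+ 3 = 0.
Proof.
rewrite shift_soul exprMn [y ^+ 3]exprSr y2.
have -> : 2%:R * (u * w) * y = 2%:R * (u * u * w * (1 + w) + w * w * u + w * (u * d)).
  by rewrite /y; ring.
by rewrite uu ww ud !mul0r mulr0 !addr0 !mulr0.
Qed.

(** Half of [y ^+ 2] is [u * w], the cross term of [y], so the quadratic term of the logarithm
    cancels it. The surviving coefficient [c - a * b] is the mixed derivative of the logarithm of
    the function. *)
Lemma shift_ln (v h : A) : v * k = 1 -> h * 2%:R = 1 ->
  v * (x - k) - h * (v * (x - k)) ^+ 2 =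
  p + q + (a * e + b * f + (c - a * b) * (e * f)).
Proof.
move=> vk h2; rewrite shift_soul mulrA vk mul1r y2 mulrA h2 mul1r.
by rewrite /y /u /w /d; ring.
Qed.

End NilpotentShift.

Section Shift.
Variables (R : realType) (K : nat).
Local Notation ev := (evenG R K).
Local Notation sc := (esc R K).
Hypothesis K2 : (2 <= K)%N.
Variables (p e q f : ev) (k a b c : R[i]).
Hypotheses (pp : p * p = 0) (pe : p * e = 0) (ee : e * e = 0).
Hypotheses (qq : q * q = 0) (qf : q * f = 0) (ff : f * f = 0).
Hypotheses (p0 : ebody _ _ p = 0) (e0 : ebody _ _ e = 0).
Hypotheses (q0 : ebody _ _ q = 0) (f0 : ebody _ _ f = 0).
Hypothesis k0 : k != 0.

Local Notation x := ((1 + p) * (1 + q) * (sc k + sc a * e + sc b * f + sc c * (e * f))).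

Let scM (y z : R[i]) : sc (y * z) = sc y * sc z. Proof. exact: rmorphM. Qed.
Let scB (y z : R[i]) : sc (y - z) = sc y - sc z. Proof. exact: rmorphB. Qed.

Lemma shift_body : ebody _ _ x = k.
Proof.
rewrite !(ebodyM, ebodyD) !ebody_esc p0 q0 e0 f0.
by ring.
Qed.

Let xE : x = (1 + p) * (1 + q) * (sc k + sc k * sc (a / k) * e + sc k * sc (b / k) * f +
  sc k * sc (c / k) * (e * f)).
Proof.
have kE z : sc k * sc (z / k) = sc z by rewrite -scM mulrC divfK.
by rewrite (kE a) (kE b) (kE c).
Qed.

Let nil3 : (x - sc k) ^+ 3 = 0.
Proof. by rewrite xE; exact: shift_nil3. Qed.

Lemma gln_shift : gln (evval _ _ x) = evval _ _ (p + q + (sc (rC (ln (cabs k))) +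
  sc (a / k) * e + sc (b / k) * f + sc (c / k - a * b / k ^+ 2) * (e * f))).
Proof.
rewrite (gln_evval _ _ _ _ K2 shift_body nil3); congr (evval _ _ _).
have vk : sc k^-1 * sc k = 1 by rewrite -scM mulVf// rmorph1.
have h2 : sc 2^-1 * 2%:R = 1.
  have -> : 2%:R = sc 2%:R by rewrite rmorph_nat.
  by rewrite -scM mulVf ?rmorph1// pnatr_eq0.
have -> : sc (c / k - a * b / k ^+ 2) = sc (c / k) - sc (a / k) * sc (b / k).
  by rewrite -scM -scB; congr (esc _ _ _); field.
rewrite xE (shift_ln _ _ _ _ _ _ _ _ _ pp pe ee qq qf ff _ _ vk h2).
by rewrite addrCA !addrA.
Qed.

Lemma ginvG_shift : gmul (ginvG (evval _ _ x)) (evval _ _ x) = gsc 1.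
Proof. exact: (ginvG_evval _ _ _ _ K2 shift_body k0 nil3). Qed.

End Shift.

(** * Even superfunctions *)

Section EvenDerivative.
Variables (R : realType) (K : nat) (U : R[i] -> Prop).
Hypothesis Uo : copen U.
Local Notation ev := (evenG R K).
Local Notation sc := (esc R K).
Local Notation val := (evval R K).
Implicit Types (F G : R[i] -> ev) (z : R[i]) (A B : ev).

Definition ewder F z A B := forall S,
  wder R (fun w => val (F w) S) z (val A S) (val B S).

Lemma wder_sum (I : Type) (r : seq I) (P : pred I) (f : I -> R[i] -> R[i])
    (a b : I -> R[i]) z : (forall i, P i -> wder R (f i) z (a i) (b i)) ->
  wder R (fun w => \sum_(i <- r | P i) f i w) z
    (\sum_(i <- r | P i) a i) (\sum_(i <- r | P i) b i).
Proof.
move=> fab; elim: r => [|i r IH].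
  rewrite !big_nil; under eq_fun do rewrite big_nil; exact: wder_cst.
rewrite !big_cons; under eq_fun do rewrite big_cons.
by case: ifP => // Pi; apply: wderD => //; exact: fab.
Qed.

Lemma ewder_sc f z a b : wder R f z a b -> ewder (fun w => sc (f w)) z (sc a) (sc b).
Proof.
move=> fab S; rewrite /= !ffunE; under eq_fun do rewrite ffunE.
by case: (S == finset.set0) => //; exact: wder_cst.
Qed.

Lemma evalD A B S : val (A + B) S = val A S + val B S.
Proof. by rewrite evvalD ffunE. Qed.

Lemma evalM A B S : val (A * B) S =
  \sum_(T : {set 'I_K} | T \subset S) gsign R K T (S :\: T) * val A T * val B (S :\: T).
Proof. by rewrite evvalM gmulE. Qed.

Lemma ewderD F G z A B A' B' : ewder F z A B -> ewder G z A' B' ->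
  ewder (fun w => F w + G w) z (A + A') (B + B').
Proof.
move=> FA GA S; rewrite !evalD; under eq_fun do rewrite evalD.
exact: wderD (FA S) (GA S).
Qed.

Lemma ewderM F G z A B A' B' : ewder F z A B -> ewder G z A' B' ->
  ewder (fun w => F w * G w) z (A * G z + F z * A') (B * G z + F z * B').
Proof.
move=> FA GA S; rewrite !evalD !evalM -!big_split /=.
under eq_fun do rewrite evalM.
apply: wder_sum => T _.
have := wderM _ _ _ _ _ _ _ _ (wderZ _ (gsign _ _ T (S :\: T)) _ _ _ _ (FA T)) (GA (S :\: T)).
exact.
Qed.

Lemma gdplus_ext (a : R[i] -> grass R K) F z A B : U z ->
  (forall w, U w -> a w = val (F w)) -> ewder F z A B -> gdplus a z = val A.
Proof.
move=> Uz aF FA; apply/ffunP => S; rewrite ffunE.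
apply: wder_dplus (wder_ext _ _ Uo _ _ _ _ _ Uz _ (FA S)) => w /aF ->.
Unshelve. all: by [].
Qed.

Lemma gdminus_ext (a : R[i] -> grass R K) F z A B : U z ->
  (forall w, U w -> a w = val (F w)) -> ewder F z A B -> gdminus a z = val B.
Proof.
move=> Uz aF FA; apply/ffunP => S; rewrite ffunE.
apply: wder_dminus (wder_ext _ _ Uo _ _ _ _ _ Uz _ (FA S)) => w /aF ->.
Unshelve. all: by [].
Qed.

Lemma dplus0 z : dplus (fun=> 0 : R[i]) z = 0.
Proof. exact: wder_dplus (wder_cst _ 0 z). Qed.

Lemma dminus0 z : dminus (fun=> 0 : R[i]) z = 0.
Proof. exact: wder_dminus (wder_cst _ 0 z). Qed.

(** A coefficient that vanishes identically has zero derivative; derivatives thus inherit parity and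
    the ideals [gthrough]. *)
Lemma coef_dplus_neq0 (a : R[i] -> grass R K) z S :
  dplus (fun w => a w S) z != 0 -> exists w, a w S != 0.
Proof.
move=> h; apply: contrapT => H; move/eqP: h; apply.
rewrite (_ : (fun w => a w S) = fun=> 0) ?dplus0//.
by apply/funext => w; apply/eqP; apply: contrapT => /negP h; apply: H; exists w.
Qed.

Lemma coef_dminus_neq0 (a : R[i] -> grass R K) z S :
  dminus (fun w => a w S) z != 0 -> exists w, a w S != 0.
Proof.
move=> h; apply: contrapT => H; move/eqP: h; apply.
rewrite (_ : (fun w => a w S) = fun=> 0) ?dminus0//.
by apply/funext => w; apply/eqP; apply: contrapT => /negP h; apply: H; exists w.
Qed.

Lemma geven_gdplus F z : geven R K (gdplus (fun w => val (F w)) z).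
Proof.
apply/gevenP => S; rewrite ffunE => /coef_dplus_neq0[w].
by apply/gevenP; exact: evvalP.
Qed.

Lemma geven_gdminus F z : geven R K (gdminus (fun w => val (F w)) z).
Proof.
apply/gevenP => S; rewrite ffunE => /coef_dminus_neq0[w].
by apply/gevenP; exact: evvalP.
Qed.

Definition edplus F z : ev := EvenG _ _ _ (geven_gdplus F z).
Definition edminus F z : ev := EvenG _ _ _ (geven_gdminus F z).

Lemma gthrough_edplus k F z : (forall w, gthrough R K k (val (F w))) ->
  gthrough R K k (val (edplus F z)).
Proof. by move=> Fk S; rewrite /= ffunE => /coef_dplus_neq0[w /Fk]. Qed.

Lemma gthrough_edminus k F z : (forall w, gthrough R K k (val (F w))) ->
  gthrough R K k (val (edminus F z)).
Proof. by move=> Fk S; rewrite /= ffunE => /coef_dminus_neq0[w /Fk]. Qed.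

Definition eholo F := forall S, holo_on U (fun w => val (F w) S).
Definition eaholo F := forall S, holo_on U (fun w => conjc (val (F w) S)).

Lemma ewder_holo F z : eholo F -> U z -> ewder F z (edplus F z) 0.
Proof.
by move=> Fh Uz S; rewrite /= !ffunE; exact: holo_wder (Fh S) _ Uz.
Qed.

Lemma eholo_edplus F : eholo F -> eholo (edplus F).
Proof.
move=> Fh S; rewrite (_ : (fun w => _) = dplus (fun w => val (F w) S)).
  exact: holo_dplus.
by apply/funext => w; rewrite /= ffunE.
Qed.

Lemma aholo_wder (f : R[i] -> R[i]) z : holo_on U (fun w => conjc (f w)) -> U z ->
  wder R f z 0 (dminus f z).
Proof.
move=> fh Uz; have h := wder_conj _ _ _ _ _ (holo_wder _ _ _ fh _ Uz).
rewrite (_ : (fun w => _) = f) in h; last by apply/funext => w; rewrite conjcK.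
move: h; rewrite conjc0 => h.
by rewrite (wder_dminus _ _ _ _ _ h).
Qed.

Lemma ewder_aholo F z : eaholo F -> U z -> ewder F z 0 (edminus F z).
Proof.
by move=> Fh Uz S; rewrite /= !ffunE; exact: aholo_wder (Fh S) Uz.
Qed.

Lemma holo_ext (f g : R[i] -> R[i]) : (forall z, U z -> f z = g z) ->
  holo_on U f -> holo_on U g.
Proof.
move=> fg /holo_onP fh; apply/holo_onP => z Uz; have [l fl] := fh z Uz.
have [r [r0 H]] := Uo _ Uz; exists l; apply: cder_ext r0 _ fl => w /H; exact: fg.
Qed.

Lemma eaholo_edminus F : eaholo F -> eaholo (edminus F).
Proof.
move=> Fh S; apply: holo_ext (holo_dplus _ _ Uo _ (Fh S)) => z Uz.
rewrite /= ffunE; apply: wder_dplus; apply: wder_conj; exact: aholo_wder (Fh S) Uz.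
Qed.

End EvenDerivative.

(** * Exact Taylor expansions at increments of square zero *)

Section TaylorAlgebra.
Variables (A : comNzRingType) (e b f0 fp fm fc : A).

Lemma taylorD_ring (g0 gp gm gc : A) :
  f0 + g0 + (fp + gp) * e + (fm + gm) * b + (fc + gc) * (e * b) =
  (f0 + fp * e + fm * b + fc * (e * b)) + (g0 + gp * e + gm * b + gc * (e * b)).
Proof. by ring. Qed.

Lemma taylorM_ring (g0 gp gm gc : A) : e * e = 0 -> b * b = 0 ->
  f0 * g0 + (fp * g0 + f0 * gp) * e + (fm * g0 + f0 * gm) * b +
    (fc * g0 + fm * gp + (fp * gm + f0 * gc)) * (e * b) =
  (f0 + fp * e + fm * b + fc * (e * b)) * (g0 + gp * e + gm * b + gc * (e * b)).
Proof.
move=> ee bb; set lhs := (X in X = _).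
have -> : (f0 + fp * e + fm * b + fc * (e * b)) * (g0 + gp * e + gm * b + gc * (e * b)) =
  lhs + (e * e) * (fp * gp + fp * gc * b + fc * gp * b + fc * gc * (b * b)) +
  (b * b) * (fm * gm + fm * gc * e + fc * gm * e) by rewrite /lhs; ring.
by rewrite ee bb !mul0r !addr0.
Qed.

(** The left side is what the product rule yields term by term, the zeros being derivatives of [b].
    The factor [1 + s] comes out because the extra terms it creates contain [s * e]. *)
Lemma taylor_dplus_ring (fpp fcp s : A) : s * e = 0 ->
  fp + (fpp * e + fp * s) + (fc * b + fm * 0) + (fcp * (e * b) + fc * (s * b + e * 0)) =
  (1 + s) * (fp + fpp * e + fc * b + fcp * (e * b)).
Proof.
move=> se; have -> : (1 + s) * (fp + fpp * e + fc * b + fcp * (e * b)) =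
  (1 + s) * fp + fpp * e + fc * b * (1 + s) + fcp * (e * b) + (s * e) * (fpp + fcp * b) by ring.
by rewrite se mul0r addr0; ring.
Qed.

Lemma taylor_dminus_ring (fmm fcm s : A) : s * b = 0 ->
  fm + (fc * e + fp * 0) + (fmm * b + fm * s) + (fcm * (e * b) + fc * (0 * b + e * s)) =
  (1 + s) * (fm + fc * e + fmm * b + fcm * (e * b)).
Proof.
move=> sb; have -> : (1 + s) * (fm + fc * e + fmm * b + fcm * (e * b)) =
  (1 + s) * fm + fc * e * (1 + s) + fmm * b + fcm * (e * b) + (s * b) * (fmm + fcm * e) by ring.
by rewrite sb [0 * (_ + _)]mul0r addr0; ring.
Qed.

End TaylorAlgebra.

Section Taylor.
Variables (R : realType) (K : nat).
Local Notation ev := (evenG R K).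
Local Notation sc := (esc R K).
Variables (e b : ev).

(* The exact Taylor expansion at increments e, b of square zero. *)
Definition taylor (f0 fp fm fc : R[i]) : ev :=
  sc f0 + sc fp * e + sc fm * b + sc fc * (e * b).

Lemma taylorD f0 fp fm fc g0 gp gm gc :
  taylor (f0 + g0) (fp + gp) (fm + gm) (fc + gc) = taylor f0 fp fm fc + taylor g0 gp gm gc.
Proof. by rewrite /taylor !rmorphD; exact: taylorD_ring. Qed.

Lemma taylorM f0 fp fm fc g0 gp gm gc : e * e = 0 -> b * b = 0 ->
  taylor (f0 * g0) (fp * g0 + f0 * gp) (fm * g0 + f0 * gm)
    (fc * g0 + fm * gp + (fp * gm + f0 * gc)) = taylor f0 fp fm fc * taylor g0 gp gm gc.
Proof. by move=> ee bb; rewrite /taylor !(rmorphD, rmorphM); exact: taylorM_ring. Qed.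

Lemma taylor_cst f0 : taylor f0 0 0 0 = sc f0.
Proof. by rewrite /taylor rmorph0 !mul0r !addr0. Qed.

(* The chain rule, e' and b' being the derivatives of e and b. *)
Lemma taylor_dplus fp fm fc fpp fcp (e' : ev) : e' * e = 0 ->
  sc fp + (sc fpp * e + sc fp * e') + (sc fc * b + sc fm * 0) +
    (sc fcp * (e * b) + sc fc * (e' * b + e * 0)) = (1 + e') * taylor fp fpp fc fcp.
Proof. exact: taylor_dplus_ring. Qed.

Lemma taylor_dminus fp fm fc fmm fcm (b' : ev) : b' * b = 0 ->
  sc fm + (sc fc * e + sc fp * 0) + (sc fmm * b + sc fm * b') +
    (sc fcm * (e * b) + sc fc * (0 * b + e * b')) = (1 + b') * taylor fm fc fmm fcm.
Proof. exact: taylor_dminus_ring. Qed.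

End Taylor.

(** * Transport of functions to the shifted arguments *)

Section Transport.
Variables (R : realType) (K : nat) (U : R[i] -> Prop).
Hypotheses (K2 : (2 <= K)%N) (Uo : copen U).
Local Notation ev := (evenG R K).
Local Notation sc := (esc R K).
Local Notation val := (evval R K).
Local Notation sm := (sm R U).
Variables (E Eb : R[i] -> ev) (k0 k1 : 'I_K).
Hypotheses (Eh : eholo R K U E) (Ebh : eaholo R K U Eb).
Hypotheses (Ek : forall w, gthrough R K k0 (val (E w))).
Hypotheses (Ebk : forall w, gthrough R K k1 (val (Eb w))).
Implicit Types (f g : R[i] -> R[i]) (z : R[i]).

Local Notation E' := (edplus R K E).
Local Notation Eb' := (edminus R K Eb).

Lemma mul_through k (A B : ev) : gthrough R K k (val A) -> gthrough R K k (val B) ->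
  A * B = 0.
Proof. by move=> Ak Bk; apply: val_inj; exact: gthrough_mul0 Ak Bk. Qed.

Lemma body_through k (A : ev) : gthrough R K k (val A) -> ebody R K A = 0.
Proof. by case: A => a ae; exact: ebody_through. Qed.

Let E'k z : gthrough R K k0 (val (E' z)). Proof. exact: gthrough_edplus. Qed.
Let Eb'k z : gthrough R K k1 (val (Eb' z)). Proof. exact: gthrough_edminus. Qed.

Let EE z : E z * E z = 0. Proof. exact: mul_through (Ek z) (Ek z). Qed.
Let E'E z : E' z * E z = 0. Proof. exact: mul_through (E'k z) (Ek z). Qed.
Let E'E' z : E' z * E' z = 0. Proof. exact: mul_through (E'k z) (E'k z). Qed.
Let BB z : Eb z * Eb z = 0. Proof. exact: mul_through (Ebk z) (Ebk z). Qed.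
Let B'B z : Eb' z * Eb z = 0. Proof. exact: mul_through (Eb'k z) (Ebk z). Qed.
Let B'B' z : Eb' z * Eb' z = 0. Proof. exact: mul_through (Eb'k z) (Eb'k z). Qed.

(* f(x_+ + E, x_- + Eb) *)
Definition transport f z : ev :=
  taylor R K (E z) (Eb z) (f z) (dplus f z) (dminus f z) (dplus (dminus f) z).
Local Notation T := transport.

Lemma transport_ext f g z : sm f -> (forall w, U w -> f w = g w) -> U z -> T f z = T g z.
Proof.
move=> sf fg Uz; have mE w : U w -> dminus f w = dminus g w.
  by move=> Uw; exact: (dminus_ext _ _ Uo _ _ _ Uw fg sf).
rewrite /T (fg z Uz) (dplus_ext _ _ Uo _ _ _ Uz fg sf) (mE z Uz).
by rewrite (dplus_ext _ _ Uo _ _ _ Uz mE (sm_dminus _ _ Uo _ sf)).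
Qed.

Lemma transport_cst (k : R[i]) z : T (fun=> k) z = sc k.
Proof.
have h w := wder_cst _ k w.
rewrite /T (wder_dplus _ _ _ _ _ (h z)) (wder_dminus _ _ _ _ _ (h z)).
rewrite (_ : dminus _ = fun=> 0) ?dplus0; last first.
  by apply/funext => w; exact: wder_dminus (h w).
exact: taylor_cst.
Qed.

Lemma dplus_dminus_val f m z a b : sm f -> (forall w, U w -> dminus f w = m w) ->
  U z -> wder R m z a b -> dplus (dminus f) z = a.
Proof.
move=> sf fm Uz mz; rewrite (dplus_ext _ _ Uo _ m z Uz fm (sm_dminus _ _ Uo _ sf)).
exact: wder_dplus mz.
Qed.

Lemma transportD f g z : sm f -> sm g -> U z ->
  T (fun w => f w + g w) z = T f z + T g z.
Proof.
move=> sf sg Uz; have h w Uw := wderD _ _ _ _ _ _ _ _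
  (sm_wdiff _ _ Uo f w sf Uw) (sm_wdiff _ _ Uo g w sg Uw).
rewrite /T (wder_dplus _ _ _ _ _ (h z Uz)) (wder_dminus _ _ _ _ _ (h z Uz)).
rewrite (dplus_dminus_val _ (fun w => dminus f w + dminus g w) z
  (dplus (dminus f) z + dplus (dminus g) z) (dminus (dminus f) z + dminus (dminus g) z)); first last.
- by apply: wderD; apply: (sm_wdiff _ _ Uo) Uz; exact: sm_dminus.
- exact: Uz.
- by move=> w /h/wder_dminus.
- exact: sm_add.
exact: taylorD.
Qed.

Lemma transportM f g z : sm f -> sm g -> U z ->
  T (fun w => f w * g w) z = T f z * T g z.
Proof.
move=> sf sg Uz; have h w Uw := wderM _ _ _ _ _ _ _ _
  (sm_wdiff _ _ Uo f w sf Uw) (sm_wdiff _ _ Uo g w sg Uw).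
rewrite /T (wder_dplus _ _ _ _ _ (h z Uz)) (wder_dminus _ _ _ _ _ (h z Uz)).
have m := wderD _ _ _ _ _ _ _ _
  (wderM _ _ _ _ _ _ _ _ (sm_wdiff _ _ Uo _ z (sm_dminus _ _ Uo _ sf) Uz) (sm_wdiff _ _ Uo g z sg Uz))
  (wderM _ _ _ _ _ _ _ _ (sm_wdiff _ _ Uo f z sf Uz) (sm_wdiff _ _ Uo _ z (sm_dminus _ _ Uo _ sg) Uz)).
rewrite (dplus_dminus_val _ _ _ _ _ _ _ Uz m); first last.
- by move=> w /h/wder_dminus.
- exact: sm_mul.
exact: taylorM (EE z) (BB z).
Qed.

Lemma ewder_eq (F : R[i] -> ev) z (A B A1 B1 : ev) :
  ewder R K F z A B -> A = A1 -> B = B1 -> ewder R K F z A1 B1.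
Proof. by move=> h <- <-. Qed.

Lemma ewder_transport f z : sm f -> U z -> ewder R K (T f) z
  ((1 + E' z) * T (dplus f) z) ((1 + Eb' z) * T (dminus f) z).
Proof.
move=> sf Uz; have sp := sm_dplus _ _ Uo _ sf; have sq := sm_dminus _ _ Uo _ sf.
have spq := sm_dplus _ _ Uo _ sq.
have W g : sm g -> ewder R K (fun w => sc (g w)) z (sc (dplus g z)) (sc (dminus g z)).
  by move=> sg; apply: ewder_sc; exact: (sm_wdiff _ _ Uo).
have We := ewder_holo _ _ _ _ _ Eh Uz; have Wb := ewder_aholo _ _ _ _ _ Ebh Uz.
have H := ewderD _ _ _ _ _ _ _ _ _ (ewderD _ _ _ _ _ _ _ _ _ (ewderD _ _ _ _ _ _ _ _ _ (W _ sf)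
   (ewderM _ _ _ _ _ _ _ _ _ (W _ sp) We))
   (ewderM _ _ _ _ _ _ _ _ _ (W _ sq) Wb))
   (ewderM _ _ _ _ _ _ _ _ _ (W _ spq) (ewderM _ _ _ _ _ _ _ _ _ We Wb)).
have ep := taylor_dplus R K (E z) (Eb z) (dplus f z) (dminus f z)
  (dplus (dminus f) z) (dplus (dplus f) z) (dplus (dplus (dminus f)) z) (E' z) (E'E z).
have em := taylor_dminus R K (E z) (Eb z) (dplus f z) (dminus f z)
  (dplus (dminus f) z) (dminus (dminus f) z) (dminus (dplus (dminus f)) z) (Eb' z) (B'B z).
(* The expansions of [dplus f] and [dminus f] take derivatives in an order different from that
   produced by the product rule. [c1] reorders second derivatives, [c2] and [c3] third ones. *)
have c1 := sm_comm _ _ Uo f sf z Uz; have c2 := sm_comm _ _ Uo _ sq z Uz.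
have c3 := dplus_ext _ _ Uo _ _ z Uz (sm_comm _ _ Uo f sf) spq.
have T1 := congr2 (taylor R K (E z) (Eb z) (dplus f z) (dplus (dplus f) z)) c1 c3.
have T2 := congr1 (taylor R K (E z) (Eb z) (dminus f z) (dplus (dminus f) z)
  (dminus (dminus f) z)) c2.
have Em := congr1 (fun c => sc (dminus f z) + (sc c * E z + sc (dplus f z) * 0) +
  (sc (dminus (dminus f) z) * Eb z + sc (dminus f z) * Eb' z) +
  (sc (dminus (dplus (dminus f)) z) * (E z * Eb z) +
   sc (dplus (dminus f) z) * (0 * Eb z + E z * Eb' z))) (esym c1).
exact (ewder_eq _ _ _ _ _ _ H (etrans ep (congr1 (fun A => (1 + E' z) * A) T1))
  (etrans (etrans Em em) (congr1 (fun A => (1 + Eb' z) * A) (esym T2)))).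
Qed.

Lemma sm_sum (I : Type) (r : seq I) (F : I -> R[i] -> R[i]) :
  (forall i, sm (F i)) -> sm (fun w => \sum_(i <- r) F i w).
Proof.
move=> sF; elim: r => [|i r IH]; under eq_fun do rewrite ?big_nil ?big_cons.
  exact: sm_cst.
exact: sm_add.
Qed.

Lemma transport_sum (I : Type) (r : seq I) (F : I -> R[i] -> R[i]) z :
  (forall i, sm (F i)) -> U z ->
  T (fun w => \sum_(i <- r) F i w) z = \sum_(i <- r) T (F i) z.
Proof.
move=> sF Uz; elim: r => [|i r IH].
  by rewrite big_nil; under eq_fun do rewrite big_nil; rewrite transport_cst rmorph0.
rewrite big_cons; under eq_fun do rewrite big_cons.
by rewrite transportD// ?IH//; exact: sm_sum.
Qed.

Lemma sm_prod (I : Type) (r : seq I) (F : I -> R[i] -> R[i]) :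
  (forall i, sm (F i)) -> sm (fun w => \prod_(i <- r) F i w).
Proof.
move=> sF; elim: r => [|i r IH]; under eq_fun do rewrite ?big_nil ?big_cons.
  exact: sm_cst.
exact: sm_mul.
Qed.

Lemma transport_prod (I : Type) (r : seq I) (F : I -> R[i] -> R[i]) z :
  (forall i, sm (F i)) -> U z ->
  T (fun w => \prod_(i <- r) F i w) z = \prod_(i <- r) T (F i) z.
Proof.
move=> sF Uz; elim: r => [|i r IH].
  by rewrite big_nil; under eq_fun do rewrite big_nil; rewrite transport_cst rmorph1.
rewrite big_cons; under eq_fun do rewrite big_cons.
by rewrite transportM// ?IH//; exact: sm_prod.
Qed.

Section Real.
Variable f : R[i] -> R[i].
Hypotheses (sf : sm f) (f0 : forall z, U z -> f z != 0).
Hypothesis fr : forall z, U z -> conjc (f z) = f z.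
Local Notation L := (fun w => rC (ln (cabs (f w)))).

Lemma conj_dminus_real z : U z -> conjc (dminus f z) = dplus f z.
Proof.
move=> Uz; have h := wder_conj _ _ _ _ _ (sm_wdiff _ _ Uo f z sf Uz).
rewrite -(wder_dplus _ _ _ _ _ h).
exact (dplus_ext _ _ Uo _ f z Uz fr (sm_conj _ _ _ sf)).
Qed.

(** For real [f] the two halves of [wder_ln] coincide, which gives the plain logarithmic
    derivatives. *)
Lemma wder_ln_real z : U z -> wder R L z (dplus f z / f z) (dminus f z / f z).
Proof.
move=> Uz; have := wder_ln _ _ _ _ _ (f0 _ Uz) (sm_wdiff _ _ Uo f z sf Uz).
have cD (a : R[i]) : conjc (a / f z) = conjc a / f z by rewrite conjM conjV fr.
have cp : conjc (dplus f z) = dminus f z by rewrite -(conj_dminus_real z Uz) conjcK.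
rewrite (cD (dminus f z)) (cD (dplus f z)) (conj_dminus_real z Uz) cp.
have h (a : R[i]) : (rC 2)^-1 * (a + a) = a.
  have -> : a + a = rC 2 * a.
    by have -> : rC 2 = 1 + 1 :> R[i]; [rewrite /rC; apply/eqP; rewrite eq_complex /= addr0 !eqxx|ring].
  by rewrite mulKf// eq_complex /= pnatr_eq0.
by rewrite (h (dplus f z / f z)) (h (dminus f z / f z)).
Qed.

Lemma dplus_dminus_ln z : U z -> dplus (dminus L) z =
  dplus (dminus f) z / f z - dplus f z * dminus f z / f z ^+ 2.
Proof.
move=> Uz; have m := wderM _ _ _ _ _ _ _ _
  (sm_wdiff _ _ Uo _ z (sm_dminus _ _ Uo _ sf) Uz)
  (wderV _ _ _ _ _ (f0 _ Uz) (sm_wdiff _ _ Uo f z sf Uz)).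
rewrite (dplus_dminus_val L _ _ _ _ (sm_ln _ _ _ f0 sf)
  (fun w Uw => wder_dminus _ _ _ _ _ (wder_ln_real w Uw)) Uz m).
have alg (a b c d : R[i]) : a / d + b * (- c / d ^+ 2) = a / d - c * b / d ^+ 2.
  by rewrite mulNr mulrN mulrA [b * c]mulrC.
exact: alg.
Qed.

Lemma gln_transport z : U z -> gln (val ((1 + E' z) * (1 + Eb' z) * T f z)) =
  val (E' z + Eb' z + T L z).
Proof.
move=> Uz; rewrite /T /taylor (gln_shift _ _ K2 _ _ _ _ _ _ _ _ (E'E' z) (E'E z) (EE z)
  (B'B' z) (B'B z) (BB z) (body_through _ _ (E'k z)) (body_through _ _ (Ek z))
  (body_through _ _ (Eb'k z)) (body_through _ _ (Ebk z)) (f0 z Uz)).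
by rewrite (wder_dplus _ _ _ _ _ (wder_ln_real z Uz))
   (wder_dminus _ _ _ _ _ (wder_ln_real z Uz)) dplus_dminus_ln.
Qed.

Lemma gln_transport0 z : U z -> gln (val (T f z)) = val (T L z).
Proof.
move=> Uz; have -> : T f z = (1 + 0) * (1 + 0) * T f z by rewrite addr0 !mul1r.
have -> : T L z = 0 + 0 + T L z by rewrite !add0r.
have b0 : ebody R K 0 = 0 by rewrite /ebody /gbody evval0 ffunE.
rewrite /T /taylor (gln_shift _ _ K2 _ _ _ _ _ _ _ _ (mul0r 0) (mul0r (E z)) (EE z)
  (mul0r 0) (mul0r (Eb z)) (BB z) b0 (body_through _ _ (Ek z))
  b0 (body_through _ _ (Ebk z)) (f0 z Uz)).
by rewrite (wder_dplus _ _ _ _ _ (wder_ln_real z Uz))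
   (wder_dminus _ _ _ _ _ (wder_ln_real z Uz)) dplus_dminus_ln.
Qed.

Lemma ginvG_transport z : U z ->
  let x := val ((1 + E' z) * (1 + Eb' z) * T f z) in gmul (ginvG x) x = gsc 1.
Proof.
move=> Uz; exact: (ginvG_shift _ _ K2 _ _ _ _ _ _ _ _ (E'E' z) (E'E z) (EE z)
  (B'B' z) (B'B z) (BB z) (body_through _ _ (E'k z)) (body_through _ _ (Ek z))
  (body_through _ _ (Eb'k z)) (body_through _ _ (Ebk z)) (f0 z Uz)).
Qed.

End Real.

(** The factor [1 + Eb'] is antiholomorphic, so [d_+] passes it and acts on the transported function
    alone, producing the second factor of [J]. *)
Let ewder_dminus_transport f z : sm f -> U z ->
  ewder R K (fun w => (1 + Eb' w) * T (dminus f) w) z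
    ((1 + E' z) * (1 + Eb' z) * T (dplus (dminus f)) z)
    (edminus R K Eb' z * T (dminus f) z + (1 + Eb' z) * ((1 + Eb' z) * T (dminus (dminus f)) z)).
Proof.
move=> sf Uz; have sq := sm_dminus _ _ Uo _ sf.
have h : ewder R K (fun w => 1 + Eb' w) z 0 (edminus R K Eb' z).
  have := ewderD _ _ _ _ _ _ _ _ _ (ewder_sc _ K _ _ _ _ (wder_cst R 1 z))
     (ewder_aholo _ _ _ _ z (eaholo_edminus _ _ _ Uo _ Ebh) Uz).
  by rewrite rmorph1 rmorph0 !add0r.
apply: ewder_eq (ewderM _ _ _ _ _ _ _ _ _ h (ewder_transport _ _ sq Uz)) _ _ => //.
by rewrite mul0r add0r mulrA [(1 + Eb' z) * _]mulrC.
Qed.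

Lemma laplacian_transport (a : R[i] -> grass R K) f z : sm f -> U z ->
  (forall w, U w -> a w = val (T f w)) ->
  gdplus (gdminus a) z =
  val ((1 + E' z) * (1 + Eb' z) * T (dplus (dminus f)) z).
Proof.
move=> sf Uz aE; apply: (gdplus_ext _ _ _ Uo _ _ z _ _ Uz _ (ewder_dminus_transport f z sf Uz)).
move=> w Uw; exact: (gdminus_ext _ _ _ Uo _ (T f) w _ _ Uw aE
  (ewder_transport f w sf Uw)).
Qed.

(** [E'] is holomorphic and disappears under [d_-]; what [d_-] makes of [Eb'] is antiholomorphic and
    disappears under [d_+]. *)
Lemma laplacian_shift_transport (a : R[i] -> grass R K) f z : sm f -> U z ->
  (forall w, U w -> a w = val (E' w + Eb' w + T f w)) ->
  gdplus (gdminus a) z =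
  val ((1 + E' z) * (1 + Eb' z) * T (dplus (dminus f)) z).
Proof.
move=> sf Uz aE; have E'h := eholo_edplus _ _ _ Uo _ Eh.
have Eb'h := eaholo_edminus _ _ _ Uo _ Ebh.
have D := ewderD _ _ _ _ _ _ _ _ _
  (ewder_aholo _ _ _ _ z (eaholo_edminus _ _ _ Uo _ Eb'h) Uz) (ewder_dminus_transport f z sf Uz).
rewrite (gdplus_ext _ _ _ Uo _ _ z _ _ Uz _ D) ?add0r//.
move=> w Uw; rewrite (gdminus_ext _ _ _ Uo _ _ w _ _ Uw aE
  (ewderD _ _ _ _ _ _ _ _ _ (ewderD _ _ _ _ _ _ _ _ _ (ewder_holo _ _ _ _ w E'h Uw)
    (ewder_aholo _ _ _ _ w Eb'h Uw)) (ewder_transport f w sf Uw))).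
by rewrite add0r.
Qed.

Lemma transport_holo f z : holo_on U f -> U z -> T f z = sc (f z) + sc (dplus f z) * E z.
Proof.
move=> fh Uz; have h w Uw := wder_dminus _ _ _ _ _ (holo_wder _ _ f fh w Uw).
rewrite /T (h z Uz) (dplus_dminus_val _ _ _ _ _ (sm_holo _ _ _ fh) h Uz (wder_cst _ 0 z)).
by rewrite /taylor rmorph0 !mul0r !addr0.
Qed.

Lemma transport_conj_holo f z : holo_on U f -> U z ->
  T (fun w => conjc (f w)) z = sc (conjc (f z)) + sc (conjc (dplus f z)) * Eb z.
Proof.
move=> fh Uz; have h w Uw := wder_conj _ _ _ _ _ (holo_wder _ _ f fh w Uw).
have h2 := wder_conj _ _ _ _ _ (holo_wder _ _ _ (holo_dplus _ _ Uo _ fh) z Uz).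
rewrite /T (wder_dplus _ _ _ _ _ (h z Uz)) (wder_dminus _ _ _ _ _ (h z Uz)).
rewrite (dplus_dminus_val _ _ _ _ _ (sm_conj _ _ _ (sm_holo _ _ _ fh))
  (fun w Uw => wder_dminus _ _ _ _ _ (h w Uw)) Uz h2).
by rewrite /taylor conjc0 rmorph0 !mul0r !addr0.
Qed.

End Transport.

(** * The invariant holomorphic extension *)

Section Curvature.
Variables (R : realType) (n N M : nat) (U : R[i] -> Prop).
Variables (Z : R[i] -> 'M[R[i]]_(N, M)) (eta : R[i] -> grass R n.+2) (kappa : R[i]).
Hypothesis Uo : copen U.
Hypothesis Zh : forall i j, holo_on U (fun z => Z z i j).
Hypothesis Zrk : forall z, U z -> \det (cadj (Z z) *m Z z) != 0.
Hypothesis Zg : forall z, U z -> bos_metric Z z != 0.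
Hypothesis Zk : forall z, U z -> bos_curv Z z = kappa.
Hypothesis etaF : fermionic_holo U eta.
Local Notation K := n.+2.
Local Notation ev := (evenG R K).
Local Notation sc := (esc R K).
Local Notation val := (evval R K).
Local Notation sm := (sm R U).

Let sigma := @sconj_gen n.
Let theta_eta z : grass R K := gscale ci (gmul theta_p (eta z)).

Let theta_eta_even z : geven R K (theta_eta z).
Proof.
apply/gevenP/gparityZ/(@gparityM _ _ true true); first exact: gparity_ggen.
by move=> S /etaF.1[-> _].
Qed.

Let theta_eta_through z : gthrough R K (inord 0) (theta_eta z).
Proof.
move=> S; rewrite ffunE mulf_eq0 negb_or => /andP[_].
apply: gthroughMl => T; rewrite ffunE.
by case: (eqVneq T _) => [->|_]; rewrite ?inE ?eqxx.
Qed.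

Let E z : ev := EvenG _ _ _ (theta_eta_even z).

Let conj_even z : geven R K (gconj sigma (theta_eta z)).
Proof. by apply/gevenP/gparity_gconj/gevenP. Qed.

Let Eb z : ev := EvenG _ _ _ (conj_even z).

(** Conjugation exchanges [theta_+] and [theta_-], so it carries the ideal of the one to that of the
    other. *)
Let Eb_through z : gthrough R K (inord 1) (val (Eb z)).
Proof.
have -> : inord 1 = sigma (inord 0) by rewrite /sigma /sconj_gen /= inordK.
exact: gthrough_gconj.
Qed.

Lemma holo_sum (I : Type) (r : seq I) (P : pred I) (f : I -> R[i] -> R[i]) :
  (forall i, holo_on U (f i)) -> holo_on U (fun w => \sum_(i <- r | P i) f i w).
Proof.
move=> fh; elim: r => [|i r IH].
  by under eq_fun do rewrite big_nil; exact: holo_cst.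
under eq_fun do rewrite big_cons; case: (P i) => //.
apply/holo_onP => z Uz.
have [a fa] := (proj1 (holo_onP _ _ _) (fh i)) z Uz.
have [b fb] := (proj1 (holo_onP _ _ _) IH) z Uz.
by exists (a + b); exact: cderD.
Qed.

Lemma holoZ (k : R[i]) (f : R[i] -> R[i]) : holo_on U f -> holo_on U (fun w => k * f w).
Proof.
move=> fh; apply/holo_onP => z Uz; have [a fa] := (proj1 (holo_onP _ _ _) fh) z Uz.
by eexists; apply: cderM; [exact: cder_cst|exact: fa].
Qed.

Let Eh : eholo R K U E.
Proof.
move=> S; rewrite /E /theta_eta /=; under eq_fun do rewrite ffunE gmulE.
by apply: holoZ; apply: holo_sum => A; apply: holoZ; exact: etaF.2.
Qed.

Let Ebh : eaholo R K U Eb.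
Proof.
move=> S; rewrite (_ : (fun w => _) = fun w => \sum_(A : {set 'I_K})
    conjc (gconj_monomial R K sigma A S) * val (E w) A); last first.
  apply/funext => w; rewrite [val (Eb w) S]gconjE raddf_sum; apply: eq_bigr => A _.
  by rewrite /= conjM conjcK mulrC.
by apply: holo_sum => A; apply: holoZ; exact: Eh.
Qed.

Local Notation T := (transport R K E Eb).
Local Notation E' := (edplus R K E).
Local Notation Eb' := (edminus R K Eb).

Let Zij i j w := Z w i j.
Let D w := \det (cadj (Z w) *m Z w).
Let G w := rC (ln (cabs (D w))).
Let g := dplus (dminus G).
Let h w := rC (ln (cabs (g w))).

(** The entries of [Z] are holomorphic, so their expansion keeps only the first-order term in
    [E]. *)
Lemma superWE z i j : U z -> superW Z eta z i j = val (T (Zij i j) z).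
Proof.
move=> Uz; rewrite (transport_holo R K U Uo E Eb (Zij i j) z (Zh i j) Uz).
rewrite mxE evvalD; congr (_ + _); rewrite -gscale_evval.
by apply/ffunP => S; rewrite !ffunE mulrA [dplus _ z * _]mulrC.
Qed.

Lemma gadjE z i j : U z ->
  gadj sigma (superW Z eta z) i j = val (T (fun w => conjc (Z w j i)) z).
Proof.
move=> Uz; rewrite (transport_conj_holo R K U Uo E Eb (Zij j i) z (Zh j i) Uz).
rewrite mxE (superWE z j i Uz) (transport_holo R K U Uo E Eb (Zij j i) z (Zh j i) Uz).
by rewrite !evvalD -!gscale_evval gconjD gconjZ gconj_gsc.
Qed.

Let smZ i j : sm (Zij i j). Proof. exact/sm_holo/Zh. Qed.

Let entry i j w := \sum_(k <- index_enum 'I_N) conjc (Z w k i) * Z w k j.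

Let sm_entry i j : sm (entry i j).
Proof.
apply: (sm_sum R U) => k.
by apply: sm_mul; [apply: sm_conj|]; exact: smZ.
Qed.

Lemma entryE i j w : (cadj (Z w) *m Z w) i j = entry i j w.
Proof. by rewrite mxE; apply: eq_bigr => k _; rewrite mxE cconjE. Qed.

Lemma gmxmulE z i j : U z ->
  gmxmul (gadj sigma (superW Z eta z)) (superW Z eta z) i j = val (T (entry i j) z).
Proof.
move=> Uz; rewrite mxE (transport_sum R K U Uo E Eb)//; last first.
  by move=> k; apply: sm_mul; [apply: sm_conj|]; exact: smZ.
rewrite evval_sum; apply: eq_bigr => k _.
have -> : T (fun w => conjc (Z w k i) * Z w k j) z =
    T (fun w => conjc (Z w k i)) z * T (Zij k j) z.
  exact (transportM R K U Uo E Eb (inord 0) (inord 1) theta_eta_through Eb_through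
    (fun w => conjc (Z w k i)) (Zij k j) z (sm_conj _ _ _ (smZ k i)) (smZ k j) Uz).
exact (congr2 gmul (gadjE z i k Uz) (superWE z k j Uz)).
Qed.

Let DE w : D w = \sum_(s <- index_enum 'S_M)
  (-1) ^+ s * \prod_(i <- index_enum 'I_M) entry i (s i) w.
Proof.
rewrite /D /determinant; apply: eq_bigr => s _; congr (_ * _).
by apply: eq_bigr => i _; rewrite entryE.
Qed.

Let smD : sm D.
Proof.
rewrite (_ : D = fun w => \sum_(s <- index_enum 'S_M)
  (-1) ^+ s * \prod_(i <- index_enum 'I_M) entry i (s i) w); last exact/funext/DE.
apply: (sm_sum R U) => s; apply: sm_mul; first exact: sm_cst.
by apply: (sm_prod R U) => i; exact: sm_entry.
Qed.

(** Both determinants are Leibniz sums, polynomial in the entries, and [transport] respects sums,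
    products and constants. *)
Lemma gdetE z : U z ->
  gdet (gmxmul (gadj sigma (superW Z eta z)) (superW Z eta z)) = val (T D z).
Proof.
move=> Uz; rewrite (_ : D = fun w => \sum_(s <- index_enum 'S_M)
  (-1) ^+ s * \prod_(i <- index_enum 'I_M) entry i (s i) w); last exact/funext/DE.
have smP s : sm (fun w => \prod_(i <- index_enum 'I_M) entry i (s i) w).
  by apply: (sm_prod R U) => i; exact: sm_entry.
rewrite (transport_sum R K U Uo E Eb)//; last first.
  by move=> s; apply: sm_mul; [exact: sm_cst|exact: smP].
rewrite evval_sum; apply: eq_bigr => s _.
rewrite (transportM R K U Uo E Eb (inord 0) (inord 1) theta_eta_through Eb_through
  (fun=> (-1) ^+ s) _ z (sm_cst _ _ _) (smP s) Uz) transport_cst.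
rewrite (transport_prod R K U Uo E Eb (inord 0) (inord 1) theta_eta_through Eb_through
  _ _ _ z (fun i => sm_entry i (s i)) Uz).
rewrite -gscale_evval; congr gscale.
rewrite -[index_enum 'I_M]enumT -gprod_evval; congr gprod.
by apply: eq_map => i; rewrite gmxmulE.
Qed.

(** [Z^dagger Z] is hermitian: conjugating its entries transposes it, which leaves the determinant
    unchanged. *)
Let Dr z : U z -> conjc (D z) = D z.
Proof.
move=> _; rewrite /D -det_map_mx -det_tr; congr (\det _).
apply/matrixP => i j; rewrite !mxE raddf_sum; apply: eq_bigr => k _.
by rewrite /= !mxE !cconjE conjM conjcK mulrC.
Qed.

Let smG : sm G. Proof. exact: sm_ln. Qed.
Let smg : sm g. Proof. exact: (sm_dplus _ _ Uo _ (sm_dminus _ _ Uo _ smG)). Qed.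

Let g0 z : U z -> g z != 0. Proof. exact: Zg. Qed.

(** [G] is real, so conjugation swaps [d_+] and [d_-] in [g], and these commute on [G]. *)
Let gr z : U z -> conjc (g z) = g z.
Proof.
move=> Uz; have sGm := sm_dminus _ _ Uo _ smG.
have H := wder_conj _ _ _ _ _ (sm_wdiff _ _ Uo _ z sGm Uz).
have Gr w : U w -> conjc (dminus G w) = dplus G w.
  by apply: conj_dminus_real => // u _; exact: conj_rC.
rewrite /g -(wder_dminus _ _ _ _ _ H) (dminus_ext _ _ Uo _ _ z Uz Gr (sm_conj _ _ _ sGm)).
exact/esym/(sm_comm _ _ Uo).
Qed.

Let smh : sm h. Proof. exact: sm_ln. Qed.

Let K2 : (2 <= K)%N. Proof. by []. Qed.

Lemma super_metricE z : U z ->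
  super_metric Z eta z = val ((1 + E' z) * (1 + Eb' z) * T g z).
Proof.
move=> Uz; apply: (laplacian_transport R K U Uo E Eb (inord 0) (inord 1) Eh Ebh
  theta_eta_through Eb_through _ G z smG Uz) => w Uw.
rewrite gdetE//; exact: (gln_transport0 R K U K2 Uo E Eb (inord 0) (inord 1)
  theta_eta_through Eb_through D smD Zrk Dr w Uw).
Qed.

Let curvE z : U z -> dplus (dminus h) z = - kappa * g z.
Proof.
have alg (a x k : R[i]) : a != 0 -> - a^-1 * x = k -> x = - k * a.
  by move=> a0 <-; rewrite !mulNr opprK mulrAC mulVf ?mul1r.
by move=> Uz; exact (alg _ _ _ (g0 z Uz) (Zk z Uz)).
Qed.

Lemma super_curvE z : U z -> super_curv Z eta z = gsc kappa.
Proof.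
move=> Uz; rewrite /super_curv.
rewrite (laplacian_shift_transport R K U Uo E Eb (inord 0) (inord 1) Eh Ebh
  theta_eta_through Eb_through _ h z smh Uz); last first.
  move=> w Uw; rewrite super_metricE//; exact: (gln_transport R K U K2 Uo E Eb
    (inord 0) (inord 1) theta_eta_through Eb_through g smg g0 gr w Uw).
rewrite (transport_ext R K U Uo E Eb _ (fun w => - kappa * g w) z _ curvE Uz); last first.
  exact: (sm_dplus _ _ Uo _ (sm_dminus _ _ Uo _ smh)).
rewrite (transportM R K U Uo E Eb (inord 0) (inord 1) theta_eta_through Eb_through (fun=> - kappa));
  [|exact: sm_cst|exact: smg|exact: Uz].
(* [ginvG] yields a bare Grassmann element, outside [evenG]. The metric is therefore moved to the
   left inside the even factor, so that associativity brings it next to its left inverse. *)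
rewrite transport_cst super_metricE// mulrCA [sc _ * _]mulrC evvalM gmulA.
rewrite (ginvG_transport R K U K2 E Eb (inord 0) (inord 1) theta_eta_through Eb_through g g0 z Uz).
rewrite gmul1g; apply/ffunP => S; rewrite !ffunE.
by case: ifP => _; rewrite ?mulr0// mulN1r opprK.
Qed.

End Curvature.

Theorem theorem1 (R : realType) (n N M : nat) (U : R[i] -> Prop)
  (Z : R[i] -> 'M[R[i]]_(N, M)) (eta : R[i] -> grass R n.+2) (kappa : R[i]) :
  copen U ->
  (forall i j, holo_on U (fun z => Z z i j)) ->
  (forall z, U z -> \det (cadj (Z z) *m Z z) != 0) ->
  (forall z, U z -> bos_metric Z z != 0) ->
  (forall z, U z -> bos_curv Z z = kappa) ->
  fermionic_holo U eta ->
  forall z, U z -> super_curv Z eta z = gsc kappa.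
Proof.
move=> Uo Zh Zrk Zg Zk etaF z Uz.
exact: (super_curvE R n N M U Z eta kappa Uo Zh Zrk Zg Zk etaF z Uz).
Qed.
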